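(* Let $p>0$ be a prime, let $k$ be an algebraically closed field of characteristic $p$, and let $q$ be a power of $p$. Let $\mathcal{X} \subset \mathbb{P}^3$ be the Giulietti--Korchmáros curve over $k$, defined (in affine coordinates $x,y,z$) by $$x^q+x-y^{q+1}=0 \quad\text{and}\quad y\left((x^q+x)^{q-1}-1\right)-z^{q^2-q+1}=0.$$ Let $C_{q^2-q+1} \subset \mathrm{Aut}(\mathcal{X})$ be the cyclic group $$C_{q^2-q+1}=\left\{(x,y,z)\mapsto(x,y,\zeta z) \ \middle|\ \zeta \in k,\ \zeta^{q^2-q+1}=1\right\},$$ and let $H$ be a subgroup of $C_{q^2-q+1}$. Then there exists a birational embedding $\psi: \mathcal{X}/H \to \mathbb{P}^2$ of degree $q^3+1$ with two (different) inner Galois points for $\psi(\mathcal{X}/H)$.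
   Context: A birational embedding $\psi: \mathcal{D} \to \mathbb{P}^2$ of a smooth projective curve $\mathcal{D}$ is a morphism that is birational onto its image; its degree is the degree of the plane curve $\psi(\mathcal{D})$. For a plane curve $C \subset \mathbb{P}^2$, a point $P \in \mathbb{P}^2$ is a Galois point for $C$ if the function field extension $k(C)/\pi_P^*k(\mathbb{P}^1)$ induced by the projection $\pi_P: C \dashrightarrow \mathbb{P}^1$ from $P$ is Galois. A Galois point $P$ is called inner if $P$ is a smooth point of $C$ (in particular $P \in C$). $\mathcal{X}/H$ denotes the quotient curve. The curve $\mathcal{X}$ is the projective curve in $\mathbb{P}^3$ given by the displayed affine equations; it is smooth. *)

(* Defs.v *)
(* Varieties over an algebraically closed field k are treated classically, as
   topological spaces with a sheaf of k-valued regular functions. *)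
From HB Require Import structures.
From mathcomp Require Import all_boot all_order all_algebra all_field.
From mathcomp Require Import boolp classical_sets.
From mathcomp Require Import mpoly.

Set Implicit Arguments.
Unset Strict Implicit.
Unset Printing Implicit Defensive.

Import GRing.Theory.
Local Open Scope classical_set_scope.
Local Open Scope ring_scope.
Local Open Scope quotient_scope.

(* [regular U f] only depends on the restriction of f to U.  The topology and
   sheaf axioms are not recorded; they hold for [proj_space] and are preserved
   by [subspace] and [quotient_space]. *)
Record kspace (k : closedFieldType) := KSpace {
  carrier :> Type;
  opens : set carrier -> Prop;
  regular : set carrier -> (carrier -> k) -> Prop }.

Arguments opens {k} _ _.
Arguments regular {k} _ _ _.

Definition morphism (k : closedFieldType) (S T : kspace k) (f : S -> T) : Prop :=
  forall V : set T, opens T V ->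
    opens S (f @^-1` V) /\
    forall g : T -> k, regular T V g -> regular S (f @^-1` V) (g \o f).

Definition automorphism (k : closedFieldType) (S : kspace k) (f : S -> S) : Prop :=
  morphism f /\ exists g : S -> S, [/\ morphism g, cancel f g & cancel g f].

Definition subspace (k : closedFieldType) (S : kspace k) (A : set S) : kspace k :=
  @KSpace k {x : S | A x}
    (fun U => exists2 V, opens S V & U = (@sval S A) @^-1` V)
    (fun U f => forall x, U x ->
       exists V g, [/\ opens S V, V (sval x), regular S V g &
         forall y, U y -> V (sval y) -> f y = g (sval y)]).

Definition orbit_of (T : Type) (H : set (T -> T)) (x : T) : set T :=
  [set s x | s in H].

Definition orbits (T : Type) (H : set (T -> T)) : Type :=
  {O : set T | exists x, O = orbit_of H x}.

Definition to_orbit (T : Type) (H : set (T -> T)) (x : T) : orbits H :=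
  exist _ (orbit_of H x) (ex_intro _ x erefl).

(* The quotient S/H: the orbit space with the quotient topology, whose regular
   functions are the H-invariant regular functions upstairs. *)
Definition quotient_space (k : closedFieldType) (S : kspace k)
    (H : set (S -> S)) : kspace k :=
  @KSpace k (orbits H)
    (fun U => opens S (@to_orbit S H @^-1` U))
    (fun U f => regular S (@to_orbit S H @^-1` U) (f \o @to_orbit S H)).

Section ProjectiveSpace.
Variables (k : closedFieldType) (n : nat).

Definition nzvec : Type := {v : 'rV[k]_n.+1 | v != 0}.

Definition proportional : rel nzvec := fun u v => (val u == val v)%MS.

Lemma proportional_refl : reflexive proportional.
Proof. by move=> u; rewrite /proportional submx_refl. Qed.

Lemma proportional_sym : ssrbool.symmetric proportional.
Proof. by move=> u v; rewrite /proportional andbC. Qed.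

Lemma proportional_trans : transitive proportional.
Proof.
move=> v u w /andP[uv vu] /andP[vw wv].
by rewrite /proportional (submx_trans uv vw) (submx_trans wv vu).
Qed.

Canonical proportional_equiv := EquivRel proportional
  proportional_refl proportional_sym proportional_trans.

Definition pt : Type := {eq_quot proportional}.

Definition coords (P : pt) : 'rV[k]_n.+1 :=
  val (repr (P : {eq_quot proportional})).

Lemma const1_neq0 : const_mx 1 != 0 :> 'rV[k]_n.+1.
Proof.
by apply/eqP => /rowP/(_ ord0)/eqP; rewrite !mxE oner_eq0.
Qed.

(* The point with homogeneous coordinates v; a junk value when v = 0. *)
Definition pt_of (v : 'rV[k]_n.+1) : pt :=
  \pi_{eq_quot proportional}
    (insubd (Sub (const_mx 1) const1_neq0 : nzvec) v).

(* Only used for vanishing, and for ratios, of homogeneous polynomials, where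
   the choice of representative made by [coords] is irrelevant. *)
Definition peval (F : {mpoly k[n.+1]}) (P : pt) : k :=
  F.@[fun i => coords P 0 i].

Definition zariski_closed (Z : set pt) : Prop :=
  exists2 E : set {mpoly k[n.+1]},
    (forall F, E F -> exists d : nat, F \is d.-homog) &
    Z = [set P | forall F, E F -> peval F P = 0].

Definition zariski_open (U : set pt) : Prop := zariski_closed (~` U).

Definition proj_space : kspace k :=
  @KSpace k pt zariski_open
    (fun U f => forall P, U P ->
       exists (V : set pt) (d : nat) (G H : {mpoly k[n.+1]}),
         [/\ zariski_open V /\ V P, G \is d.-homog, H \is d.-homog &
           forall Q, U Q -> V Q ->
             peval H Q != 0 /\ f Q = peval G Q / peval H Q]).

End ProjectiveSpace.

(* Admissible pairs represent rational functions on an irreducible S. *)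
Definition admissible (k : closedFieldType) (S : kspace k) (U : set S)
    (f : S -> k) : Prop :=
  [/\ opens S U, U !=set0 & regular S U f].

(* [germ U f] is the class <U, f> of the rational function represented by f
   on U; its value on non-admissible pairs is irrelevant.  This determines
   K up to a unique isomorphism as the function field k(S). *)
Definition is_function_field (k : closedFieldType) (S : kspace k)
    (K : fieldType) (germ : set S -> (S -> k) -> K) : Prop :=
  [/\ forall a : K, exists U f, admissible U f /\ germ U f = a,
      forall U f V g, admissible U f -> admissible V g ->
        (germ U f = germ V g <-> (forall x, U x -> V x -> f x = g x)),
      germ setT (fun=> 1) = 1,
      forall U f V g, admissible U f -> admissible V g ->
        germ (U `&` V) (fun x => f x + g x) = germ U f + germ V g &
      forall U f V g, admissible U f -> admissible V g ->
        germ (U `&` V) (fun x => f x * g x) = germ U f * germ V g].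

(* Algebraic, normal and separable. *)
Definition galois_extension (F E : fieldType) (iota : {rmorphism F -> E}) : Prop :=
  forall a : E, exists m : {poly F},
    [/\ irreducible_poly m, separable_poly m, root (map_poly iota m) a &
        exists rs : seq E, map_poly iota m %= \prod_(r <- rs) ('X - r%:P)].

Section PlaneCurves.
Variable k : closedFieldType.
Let P2 : kspace k := proj_space k 2.
Let P1 : kspace k := proj_space k 1.

Definition irreducible_mpoly (n : nat) (F : {mpoly k[n]}) : Prop :=
  [/\ F != 0, F \isn't a GRing.unit &
      forall G H, F = G * H -> G \is a GRing.unit \/ H \is a GRing.unit].

Definition defining_equation (C : set P2) (d : nat) (F : {mpoly k[3]}) : Prop :=
  [/\ F \is d.-homog, irreducible_mpoly F & C = [set P | peval F P = 0]].

Definition plane_curve_of_degree (C : set P2) (d : nat) : Prop :=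
  exists F, defining_equation C d F.

Definition smooth_point (C : set P2) (P : P2) : Prop :=
  C P /\ exists d F, defining_equation C d F /\
    exists i : 'I_3, peval F^`M(i) P != 0.

(* The columns of A are two independent linear forms vanishing at P; they
   define the projection from P, and another choice of A changes it by an
   automorphism of P^1. *)
Definition projection_from (P : P2) (A : 'M[k]_(3, 2)) : Prop :=
  \rank A = 2 /\ coords P *m A = 0.

Definition projection (A : 'M[k]_(3, 2)) (Q : P2) : P1 :=
  pt_of (coords Q *m A).

(* The part of C that projection from P, undefined at P, sends into V. *)
Definition projection_dom (C : set P2) (P : P2) (A : 'M[k]_(3, 2))
    (V : set P1) : set (subspace C) :=
  [set Q | sval Q <> P /\ V (projection A (sval Q))].

Arguments projection_dom : clear implicits.

Definition galois_point (C : set P2) (P : P2) : Prop :=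
  exists A : 'M[k]_(3, 2), projection_from P A /\
  exists (K0 : fieldType) (germ0 : set P1 -> (P1 -> k) -> K0)
         (K : fieldType) (germ : set (subspace C) -> (subspace C -> k) -> K)
         (pullback : {rmorphism K0 -> K}),
    [/\ is_function_field germ0, is_function_field germ,
        forall V h, admissible V h ->
          projection_dom C P A V !=set0 /\
          pullback (germ0 V h) =
            germ (projection_dom C P A V) (fun Q => h (projection A (sval Q))) &
        galois_extension pullback].

Definition inner_galois_point (C : set P2) (P : P2) : Prop :=
  galois_point C P /\ smooth_point C P.

(* The second condition provides the inverse chi, on a nonempty open subset W
   of the image, of psi seen as a map onto its image. *)
Definition birational_embedding (S : kspace k) (psi : S -> P2) : Prop :=
  morphism psi /\
  exists (W : set (subspace (range psi))) (chi : subspace W -> S),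
    [/\ opens (subspace (range psi)) W, W !=set0, morphism chi,
        forall w : subspace W, psi (chi w) = sval (sval w) &
        forall (s : S) (w : subspace W), psi s = sval (sval w) -> chi w = s].

End PlaneCurves.

Section GiuliettiKorchmaros.
Variables (k : closedFieldType) (q : nat).

Definition row4 (a b c d : k) : 'rV[k]_4 := \row_(i < 4) [:: a; b; c; d]`_i.

Definition GK_affine : set (proj_space k 3) :=
  [set P | exists x y z : k,
     [/\ P = pt_of (row4 1 x y z),
         x ^+ q + x - y ^+ q.+1 = 0 &
         y * ((x ^+ q + x) ^+ (q - 1) - 1) - z ^+ (q ^ 2 - q + 1) = 0]].

(* The projective closure of the affine curve. *)
Definition GK_points : set (proj_space k 3) :=
  [set P | forall Z, zariski_closed Z -> GK_affine `<=` Z -> Z P].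

Definition GK_curve : kspace k := subspace GK_points.

(* (x, y, z) |-> (x, y, zeta z), in homogeneous coordinates. *)
Definition GK_cyclic_group : set (GK_curve -> GK_curve) :=
  [set s : GK_curve -> GK_curve | automorphism s /\
     exists2 zeta : k, zeta ^+ (q ^ 2 - q + 1) = 1 &
       forall P : GK_curve, sval (s P) =
         pt_of (coords (sval P) *m diag_mx (row4 1 1 1 zeta))].

End GiuliettiKorchmaros.

(* G is meant to be a group of permutations of T under composition. *)
Definition is_subgroup (T : Type) (H G : set (T -> T)) : Prop :=
  [/\ H `<=` G, H id,
      forall s t, H s -> H t -> H (s \o t) &
      forall s, H s -> exists2 t, H t & cancel s t /\ cancel t s].

(* Main.v *)
Require Import Defs.
From HB Require Import structures.
From mathcomp Require Import all_boot all_order all_algebra all_field.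
From mathcomp Require Import boolp classical_sets.
From mathcomp Require Import mpoly.
From mathcomp Require Import ring zify.

(** Write [N = q ^ 2 - q + 1] and [n = q ^ 3 + 1 = (q + 1) N].  The curve has the
    equivalent affine equations [x ^ q + x = y ^ (q + 1)], [y ^ (q ^ 2) - y = z ^ N],
    and a single point at infinity [(0 : 1 : 0 : 0)].  A subgroup of the cyclic
    group of order [N] consists of the rotations of [z] by the [m]-th roots of
    unity, for some factorization [s m = N] ([subgroup_rotations]).  The quotient
    therefore has the affine equations [x ^ q + x = y ^ (q + 1)],
    [y ^ (q ^ 2) - y = w ^ s] with [w = z ^ m], and the embedding is
    [(x, y, w) |-> (1 : x ^ m : w)].

    The translations [(x, y) |-> (x + b ^ q y + c, y + b)] with [b ^ (q ^ 2) = b] and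
    [c ^ q + c = b ^ (q + 1)] form a group of order [q ^ 3] that is simply transitive
    on the fibres of [w].  By Artin's theorem the function field is Galois over
    [k(w)] with this group ([function_field_galois]).  Since [1], [x] and [y] are
    linearly independent, the [q ^ 3] conjugates of [x ^ m] are distinct
    ([conj_power_inj]); hence [x ^ m] and [w] generate the function field, so that
    the embedding is birational, and the projection from [(0 : 1 : 0)], which is
    [w], makes this point a Galois point.

    Eliminating [y] from the equations of the curve itself gives
    [z ^ n = (x ^ q + x) ((x ^ q + x) ^ (q - 1) - 1) ^ (q + 1)], whose homogenization
    turns out to be symmetric in the first two coordinates ([base_value_swap]).
    The product of its conjugates under multiplication of the second coordinate
    by [m]-th roots of unity is a polynomial in the [m]-th powers of the
    coordinates; it defines a form of degree [n] whose zero set is the image of the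
    embedding ([plane_equation], [range_psi]).  This form inherits the symmetry,
    which carries the Galois point [(0 : 1 : 0)] to [(1 : 0 : 0)].  Along the line
    joining these two points the form has simple zeros at both, so that they are
    smooth points ([plane_smooth_infinity], [plane_smooth_origin]).

    The form is irreducible, so that [n] is the degree of the image: a form
    vanishing on the image restricts, on the line of slope [w] through [(0 : 1 : 0)],
    to a polynomial with the [q ^ 3] conjugates of [x ^ m] as roots, and passes
    through [(0 : 1 : 0)], which forces its degree to exceed [q ^ 3]
    ([plane_degree]); but in a proper factorization one of the factors would yield
    a form of lower degree vanishing on the image ([irreducible_of_degree]).

    Two facts carry the passage between points and fields.  The affine curve is
    irreducible ([vanishes_prime]): giving [x], [y], [w] the weights
    [(q + 1) s], [q s], [q ^ 3], their pole orders at infinity, the monomials with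
    exponents less than [q] in [x] and less than [q ^ 2] in [y] have distinct weights
    and form a basis of the polynomial functions on the curve.  And for an
    irreducible space in projective space, any field in which the forms are
    evaluated with the right kernel, and that is generated by ratios of forms of
    equal degree, is its function field ([function_field_of_germs]). *)

Set Implicit Arguments.
Unset Strict Implicit.
Unset Printing Implicit Defensive.

Import GRing.Theory.
Local Open Scope classical_set_scope.
Local Open Scope ring_scope.
Local Open Scope quotient_scope.

(** * Fields of fractions modulo a prime ideal *)

Section PrimeIdealField.
Variables (R : comNzRingType) (I : R -> Prop).
Hypothesis I0 : I 0.
Hypothesis IB : forall a b, I a -> I b -> I (a - b).
Hypothesis IM : forall a b, I b -> I (a * b).
Hypothesis I1 : ~ I 1.
Hypothesis Iprime : forall a b, I (a * b) -> I a \/ I b.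

Definition prime_pred : {pred R} := fun a => `[< I a >].

Lemma prime_pred_closed : idealr_closed prime_pred.
Proof.
split; rewrite /prime_pred ?unfold_in; first exact/asboolP.
  exact/asboolPn.
move=> a u v /asboolP Iu /asboolP Iv; apply/asboolP.
rewrite -[v]opprK; apply: IB; first exact: IM.
by rewrite -[- v]sub0r; apply: IB.
Qed.

Lemma prime_pred_prime : prime_idealr_closed prime_pred.
Proof.
move=> u v /asboolP/Iprime[Iu|Iv]; apply/orP; [left|right]; exact/asboolP.
Qed.

HB.instance Definition _ := isIdealr.Build R prime_pred prime_pred_closed.
HB.instance Definition _ :=
  isPrimeIdealrClosed.Build R prime_pred prime_pred_prime.

Definition residue := {ideal_quot prime_pred}.
HB.instance Definition _ := GRing.ComNzRing.on residue.

(** Invertibility is decided classically; this gives the residue ring the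
    inverse function that the construction of fractions asks for. *)
Definition residue_unit : pred residue := fun a => `[< exists b, b * a = 1 >].
Definition residue_inv (a : residue) : residue :=
  match pselect (exists b, b * a = 1) with
  | left ab => projT1 (cid ab)
  | right _ => a
  end.

Lemma residue_mulV : {in residue_unit, left_inverse 1 residue_inv *%R}.
Proof.
move=> a /asboolP ab; rewrite /residue_inv.
by case: pselect => // ab'; case: (cid ab').
Qed.

Lemma residue_unitP (a b : residue) : b * a = 1 -> residue_unit a.
Proof. by move=> ba; apply/asboolP; exists b. Qed.

Lemma residue_inv_out : {in [predC residue_unit], residue_inv =1 id}.
Proof.
move=> a /asboolPn na; rewrite /residue_inv; by case: pselect.
Qed.

HB.instance Definition _ := GRing.ComNzRing_hasMulInverse.Build residue
  residue_mulV residue_unitP residue_inv_out.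

Lemma residue_domain (a b : residue) : a * b = 0 -> (a == 0) || (b == 0).
Proof. exact: Quotient.rquot_IdomainAxiom. Qed.

HB.instance Definition _ :=
  GRing.ComUnitRing_isIntegral.Build residue residue_domain.

Lemma prime_ideal_field : exists (K : fieldType) (phi : {rmorphism R -> K}),
  (forall a, phi a = 0 <-> I a) /\
  forall x, exists a b, phi b != 0 /\ x = phi a / phi b.
Proof.
pose pi : {rmorphism R -> residue} := \pi_residue.
pose f : {rmorphism R -> {fraction residue}} := (@FracField.tofrac residue) \o pi.
have pi_eq0 a : (pi a == 0) = (a \in prime_pred).
  by rewrite -(rmorph0 pi) -[a in RHS]subr0 Quotient.idealrBE.
have f_eq0 a : (f a == 0) = (a \in prime_pred) by rewrite /f /= tofrac_eq0 pi_eq0.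
exists {fraction residue}, f; split.
  by move=> a; split => [/eqP|Ia]; [rewrite f_eq0 => /asboolP|
     apply/eqP; rewrite f_eq0; apply/asboolP].
move=> x; pose r := repr x.
exists (repr (\n_r)), (repr (\d_r)).
have fr (y : residue) : f (repr y : R) = FracField.tofrac y by rewrite /f /= /pi reprK.
rewrite !fr tofrac_eq0 denom_ratioP; split=> //.
have d0 : FracField.tofrac \d_r != 0 by rewrite tofrac_eq0 denom_ratioP.
apply: (canRL (mulfK d0)).
rewrite -[x]reprK -/r -{1}(Ratio_numden r).
unlock FracField.tofrac; rewrite -[LHS]FracField.pi_mul.
by rewrite /FracField.mulf /= !numden_Ratio ?(oner_neq0, mulr1) ?denom_ratioP //;
   apply/eqmodP; rewrite /= /FracField.equivf !numden_Ratio ?denom_ratioP ?oner_neq0 //= ?mulr1 mulrC.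
Qed.
End PrimeIdealField.

(** A field of fractions is used through [phi_frac] alone, so that maps out of it
    do not depend on how it was built. *)
Section ExtendToFractions.
Variables (R : comNzRingType) (K L : fieldType).
Variables (phi : {rmorphism R -> K}) (psi : {rmorphism R -> L}).
Hypothesis phi_frac : forall x, exists a b, phi b != 0 /\ x = phi a / phi b.
Hypothesis ker_eq : forall a, phi a = 0 <-> psi a = 0.

Definition frac_ext (x : K) : L :=
  let: exist a ha := cid (phi_frac x) in
  let: exist b _ := cid ha in psi a / psi b.

Lemma frac_extE a b : phi b != 0 -> frac_ext (phi a / phi b) = psi a / psi b.
Proof.
rewrite /frac_ext; case: cid => a' ha; case: cid => b' [b'0 e] b0.
have nz c : phi c != 0 -> psi c != 0.
  by apply: contra => /eqP/ker_eq/eqP.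
apply/eqP; rewrite eqr_div ?nz // -!rmorphM -subr_eq0 -rmorphB.
apply/eqP/ker_eq/eqP; rewrite rmorphB !rmorphM subr_eq0 -eqr_div //.
by rewrite e.
Qed.

Lemma frac_ext_id a : frac_ext (phi a) = psi a.
Proof.
have := @frac_extE a 1; rewrite !rmorph1 !divr1; apply; exact: oner_neq0.
Qed.

Lemma frac_ext_zmod : zmod_morphism frac_ext.
Proof.
move=> x y; have [a [b [b0 ->]]] := phi_frac x; have [c [d [d0 ->]]] := phi_frac y.
have pb : psi b != 0 by apply: contra b0 => /eqP/ker_eq/eqP.
have pd : psi d != 0 by apply: contra d0 => /eqP/ker_eq/eqP.
rewrite -!mulNr -rmorphN addf_div // -!rmorphM -rmorphD !frac_extE ?rmorphM ?mulf_neq0 //.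
by rewrite -[- (psi c / _)]mulNr -[- psi c]rmorphN addf_div // rmorphD !rmorphM.
Qed.

Lemma frac_ext_monoid : monoid_morphism frac_ext.
Proof.
split; first by rewrite -(rmorph1 phi) frac_ext_id rmorph1.
move=> x y; have [a [b [b0 ->]]] := phi_frac x; have [c [d [d0 ->]]] := phi_frac y.
by rewrite !mulf_div -!rmorphM !frac_extE ?rmorphM ?mulf_neq0 // mulf_div.
Qed.

HB.instance Definition _ := GRing.isZmodMorphism.Build K L frac_ext frac_ext_zmod.
HB.instance Definition _ := GRing.isMonoidMorphism.Build K L frac_ext frac_ext_monoid.

Lemma extend_to_fractions : exists f : {rmorphism K -> L}, forall a, f (phi a) = psi a.
Proof. by exists frac_ext; exact: frac_ext_id. Qed.

End ExtendToFractions.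

(** * Finite groups of automorphisms *)

Section Artin.
Variables (K0 K : fieldType) (iota : {rmorphism K0 -> K}).
Variables (J : eqType) (s : seq J) (F : J -> {rmorphism K -> K}).
Hypothesis F_comp : forall i j, i \in s -> j \in s ->
  exists2 l, l \in s & forall x, F i (F j x) = F l x.
Hypothesis F_id : exists2 i, i \in s & forall x, F i x = x.
Hypothesis F_iota : forall i c, i \in s -> F i (iota c) = iota c.
Hypothesis F_fix : forall x, (forall i, i \in s -> F i x = x) ->
  exists c, x = iota c.

Lemma fixed_poly (p : {poly K}) :
  (forall i, i \in s -> map_poly (F i) p = p) -> exists p0, p = map_poly iota p0.
Proof.
move=> pF; have pc j : exists c, p`_j = iota c.
  by apply: F_fix => i si; rewrite -coef_map pF.
pose c j := projT1 (cid (pc j)).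
exists (\poly_(j < size p) c j); apply/polyP=> j.
rewrite coef_map coef_poly; case: ltnP => [_|pj].
  by rewrite /c; case: cid.
by rewrite nth_default //; symmetry; exact: rmorph0.
Qed.

Lemma map_iota_fixed i (p : {poly K0}) : i \in s ->
  map_poly (F i) (map_poly iota p) = map_poly iota p.
Proof.
by move=> si; apply/polyP=> j; rewrite !coef_map /= F_iota.
Qed.

Lemma root_conj i (p : {poly K0}) a : i \in s ->
  root (map_poly iota p) (F i a) = root (map_poly iota p) a.
Proof.
move=> si; rewrite /root -{1}(map_iota_fixed p si) horner_map.
by rewrite fmorph_eq0.
Qed.

(** Artin's theorem.  The product of the [X - b] over the orbit of [a] is fixed by
    the group, hence defined over [K0].  Its roots are distinct, which makes it
    separable, and permuted transitively, which makes it irreducible: a root of a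
    factor over [K0] drags the whole orbit along. *)
Lemma artin_galois : galois_extension iota.
Proof.
move=> a; pose os := undup [seq F i a | i <- s].
have os_uniq : uniq os by rewrite undup_uniq.
have osF i : i \in s -> perm_eq [seq F i b | b <- os] os.
  move=> si; have u : uniq [seq F i b | b <- os].
    by rewrite map_inj_uniq //; apply: fmorph_inj.
  have sub : {subset [seq F i b | b <- os] <= os}.
    move=> y /mapP[b]; rewrite mem_undup => /mapP[j sj ->] ->.
    have [l sl e] := F_comp si sj; rewrite e mem_undup; exact: map_f.
  by have [|_ e] := uniq_min_size u sub; rewrite ?size_map //; apply: uniq_perm.
have a_os : a \in os.
  have [i si Fi] := F_id; by rewrite mem_undup; apply/mapP; exists i.
have [m mE] : exists m, \prod_(b <- os) ('X - b%:P) = map_poly iota m.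
  apply: fixed_poly => i si; rewrite rmorph_prod -[RHS](perm_big _ (osF i si)) /=.
  by rewrite big_map; apply: eq_bigr => b _; rewrite rmorphB /= map_polyX map_polyC.
exists m; split.
- split.
    rewrite -(size_map_poly iota) -mE size_prod_XsubC ltnS.
    by rewrite -has_predT; apply/hasP; exists a.
  move=> g g1 gm; rewrite -(eqp_map iota).
  have gmK : map_poly iota g %| \prod_(b <- os) ('X - b%:P) by rewrite mE dvdp_map.
  have [b] : exists b, root (map_poly iota g) b /\ b \in os.
    have [msk /= gE] := dvdp_prod_XsubC gmK.
    have : size (mask msk os) != 0%N.
      apply: contra g1 => /eqP sz; rewrite -(size_map_poly iota) (eqp_size gE).
      by rewrite size_prod_XsubC sz.
    case e : (mask msk os) => [//|b r] _; exists b; split.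
      by rewrite (eqp_root gE) root_prod_XsubC e mem_head.
    by apply: (mem_mask (m := msk)); rewrite e mem_head.
  case; rewrite [in X in _ -> X -> _]mem_undup => gb /mapP[i si bE].
  rewrite bE root_conj // in gb.
  rewrite -mE /eqp gmK; apply: uniq_roots_dvdp.
    apply/allP=> c; rewrite mem_undup => /mapP[j sj ->]; by rewrite root_conj.
  by rewrite uniq_rootsE.
- rewrite -(separable_map iota) -mE; by rewrite separable_prod_XsubC.
- by rewrite -mE root_prod_XsubC.
- by exists os; rewrite mE eqpxx.
Qed.

Variable t : K.
Hypothesis s_uniq : uniq s.
Hypothesis F_t : {in s &, injective (fun i => F i t)}.

(** Lagrange interpolation.  When [t] has distinct conjugates [t_i], the polynomial
    with value [F_i b] times the product of the [t_i - t_j] at each [t_i] is fixed by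
    the group.  At [t] it takes the value [b] times a factor that does not depend
    on [b], and the quotient of the cases [b = a] and [b = 1] is [a]. *)
Lemma rational_in_primitive a : exists p r : {poly K0},
  (map_poly iota r).[t] != 0 /\ a = (map_poly iota p).[t] / (map_poly iota r).[t].
Proof.
(* The product skips the indices with the same conjugate, which keeps the family
   indexed by [s]. *)
pose Lg b := \sum_(i <- s) (F i b)%:P * \prod_(j <- s | F j t != F i t) ('X - (F j t)%:P).
have LgF b : exists p, Lg b = map_poly iota p.
  apply: fixed_poly => l sl.
  pose S := [seq (F i t, F i b) | i <- s].
  have S_inj : {in s &, injective (fun i => (F i t, F i b))}.
    by move=> i j si sj [/F_t e _]; apply: e.
  have S_uniq : uniq S by rewrite map_inj_in_uniq.
  have LS : Lg b = \sum_(u <- S) u.2%:P * \prod_(v <- S | v.1 != u.1) ('X - v.1%:P).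
    rewrite /S big_map; apply: eq_bigr => i _; by rewrite big_map.
  pose f u := (F l u.1, F l u.2).
  have fS : perm_eq [seq f u | u <- S] S.
    have u : uniq [seq f u | u <- S].
      by rewrite map_inj_uniq // => -[x y] [x' y'] [] /fmorph_inj -> /fmorph_inj ->.
    have sub : {subset [seq f u | u <- S] <= S}.
      move=> _ /mapP[_ /mapP[i si ->] ->]; have [j sj Fj] := F_comp sl si.
      by apply/mapP; exists j => //; rewrite /f /= !Fj.
    by have [|_ e] := uniq_min_size u sub; rewrite ?size_map //; apply: uniq_perm.
  rewrite LS; transitivity (\sum_(u <- [seq f u | u <- S])
     u.2%:P * \prod_(v <- [seq f u | u <- S] | v.1 != u.1) ('X - v.1%:P)); last first.
    by rewrite (perm_big _ fS); apply: eq_bigr => u _; rewrite (perm_big _ fS).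
  rewrite rmorph_sum [RHS]big_map; apply: eq_bigr => u _.
  rewrite rmorphM rmorph_prod [in RHS]big_map /= map_polyC; congr (_ * _).
  by apply: eq_big => v; rewrite ?(inj_eq (fmorph_inj (F l))) // rmorphB /= map_polyX map_polyC.
have [i0 s0 Fi0] := F_id.
have Lgt b : (Lg b).[t] = b * \prod_(j <- s | F j t != t) (t - F j t).
  rewrite /Lg horner_sum (bigD1_seq i0) //= !Fi0 [X in _ + X]big1_seq ?addr0.
    rewrite hornerM hornerC horner_prod; congr (_ * _).
    by apply: eq_bigr => j _; rewrite hornerXsubC.
  move=> i /andP[ii0 si]; rewrite hornerM; have tt : F i0 t != F i t.
    by apply: contra ii0 => /eqP/F_t ->.
  apply/eqP; rewrite mulf_eq0 horner_prod prodf_seq_eq0; apply/orP; right.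
  by apply/hasP; exists i0; rewrite //= tt hornerXsubC Fi0 subrr eqxx.
have [p pE] := LgF a; have [r rE] := LgF 1.
exists p, r; rewrite -pE -rE !Lgt mul1r.
have nz : \prod_(j <- s | F j t != t) (t - F j t) != 0.
  rewrite prodf_seq_neq0; apply/allP=> j _; apply/implyP.
  by rewrite subr_eq0 eq_sym.
by rewrite mulfK.
Qed.

End Artin.

(** * Roots in algebraically closed fields *)

Section ClosedField.
Variable k : closedFieldType.

Lemma poly_eq0_horner (p : {poly k}) : (forall x, p.[x] = 0) -> p = 0.
Proof.
move=> p0; have s1 : size (p + 1) == 1%N.
  rewrite -[_ == _]negbK; apply/negP => /closed_rootP[x].
  by rewrite /root hornerD hornerC p0 add0r oner_eq0.
have [c pc] : exists c, p = c%:P.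
  have /size_poly1P[c _ e] := s1.
  by exists (c - 1); rewrite polyCB -e addrK.
by have := p0 0; rewrite pc hornerC => ->.
Qed.

Lemma separable_roots (p : {poly k}) : separable_poly p ->
  exists rs, [/\ uniq rs, size rs = (size p).-1 & forall x, (x \in rs) = root p x].
Proof.
move=> sp; have p0 : p != 0.
  by apply: separable_poly_neq0.
have [rs e] := closed_field_poly_normal p.
have lp : lead_coef p != 0 by rewrite lead_coef_eq0.
exists rs; split.
- rewrite -separable_prod_XsubC; move: sp; rewrite {1}e.
  by rewrite (eqp_separable (eqp_scale _ lp)).
- by rewrite e size_scale // size_prod_XsubC.
- by move=> x; rewrite {1}e rootZ // root_prod_XsubC.
Qed.

Lemma nth_root_exists (n : nat) (a : k) : (0 < n)%N -> exists z, z ^+ n = a.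
Proof.
move=> n0; have /closed_rootP[z] : size ('X^n - a%:P) != 1%N.
  by rewrite size_XnsubC // eqSS -lt0n.
by rewrite /root !hornerE subr_eq0 => /eqP e; exists z.
Qed.

Lemma prim_root_exists (n : nat) : (0 < n)%N -> n%:R != 0 :> k ->
  exists z : k, n.-primitive_root z.
Proof.
move=> n0 nk; have sep : separable_poly ('X^n - 1 : {poly k}).
  by rewrite separable_Xn_sub_1.
have [rs [u sz rP]] := separable_roots sep.
have : has n.-primitive_root rs.
  apply: cyclic.has_prim_root => //.
    by apply/allP => x; rewrite rP /root !hornerE subr_eq0 => /eqP xn; apply/unity_rootP.
  by rewrite sz size_XnsubC.
by case/hasP => z _ zn; exists z.
Qed.

End ClosedField.

(** * Projective space *)

Section ProjectiveSpace.
Variables (k : closedFieldType) (n : nat).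
Implicit Types (P Q : pt k n) (v w : 'rV[k]_n.+1) (G H : {mpoly k[n.+1]}).

(** Unlike [peval], this does not involve the representative chosen by [coords]. *)
Definition heval G v : k := G.@[fun i => v 0 i].

Lemma heval_scale d G v c : G \is d.-homog -> heval G (c *: v) = c ^+ d * heval G v.
Proof.
move=> /dhomogP hG; rewrite /heval !mevalE big_distrr /=; apply: eq_big_seq => m mG.
rewrite mulrCA; congr (_ * _); have /= <- := hG m mG.
rewrite mdegE expr_sum -big_split /=; by apply: eq_bigr => i _; rewrite mxE exprMn.
Qed.

Lemma coords_neq0 P : coords P != 0.
Proof. exact: (valP (repr (P : {eq_quot (@proportional k n)}))). Qed.

Lemma pt_of_coords P : pt_of (coords P) = P.
Proof. by rewrite /pt_of /coords valKd reprK. Qed.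

Lemma eq_pt_of v w : v != 0 -> w != 0 ->
  pt_of v = pt_of w <-> exists2 c, c != 0 & v = c *: w.
Proof.
move=> v0 w0; split.
  move=> /eqmodP; rewrite /= /proportional !insubdK // => /andP[/sub_rVP[c vE] _].
  by exists c => //; apply: contra v0; rewrite vE => /eqP ->; rewrite scale0r.
case=> c c0 vE; apply/eqmodP; rewrite /= /proportional !insubdK //.
by rewrite vE; apply/eqmxP; exact: eqmx_scale.
Qed.

Lemma coords_pt_of v : v != 0 -> exists2 c, c != 0 & coords (pt_of v) = c *: v.
Proof. by move=> v0; apply/eq_pt_of; rewrite ?coords_neq0 ?pt_of_coords. Qed.

Lemma peval_pt_of v : v != 0 -> exists2 c, c != 0 &
  forall d G, G \is d.-homog -> peval G (pt_of v) = c ^+ d * heval G v.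
Proof.
move=> v0; have [c c0 cE] := coords_pt_of v0; exists c => // d G hG.
by rewrite -(heval_scale _ _ hG) -cE.
Qed.

Lemma peval_eq0 v d G : v != 0 -> G \is d.-homog ->
  (peval G (pt_of v) == 0) = (heval G v == 0).
Proof.
move=> v0 hG; have [c c0 e] := peval_pt_of v0; rewrite (e _ _ hG).
by rewrite mulf_eq0 expf_eq0 (negPf c0) andbF.
Qed.

Lemma pevalM G H P : peval (G * H) P = peval G P * peval H P.
Proof. exact: mevalM. Qed.

Lemma pevalD G H P : peval (G + H) P = peval G P + peval H P.
Proof. exact: mevalD. Qed.

(** In this form openness passes through maps given by forms, and the families of
    equations in the definition of closed sets need not be handled again. *)
Lemma zariski_openP (V : set (pt k n)) : zariski_open V <->
  forall P, V P -> exists d H, [/\ H \is d.-homog, peval H P != 0 &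
    forall Q, peval H Q != 0 -> V Q].
Proof.
split.
  case=> E hE VE P VP; have : ~ (~` V) P by [].
  rewrite VE /= => /existsNP[H] /not_implyP[EH /eqP HP].
  have [d hH] := hE _ EH; exists d, H; split=> // Q HQ.
  apply: contrapT => nVQ; have : (~` V) Q by [].
  by rewrite VE => /(_ _ EH)/eqP; apply/negP.
move=> VP; exists [set H | (exists d : nat, H \is d.-homog) /\ forall Q, peval H Q != 0 -> V Q].
  by move=> F [].
apply/seteqP; split=> [Q nVQ F [_ hF]|Q hQ VQ].
  by apply/eqP; apply: contrapT => /negP/hF.
have [d [H [hH HQ HV]]] := VP _ VQ; move/eqP: HQ; apply; apply: hQ; split=> //; by exists d.
Qed.

Lemma zariski_openI (V W : set (pt k n)) :
  zariski_open V -> zariski_open W -> zariski_open (V `&` W).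
Proof.
move=> /zariski_openP oV /zariski_openP oW; apply/zariski_openP => P [VP WP].
have [d [G [hG GP GV]]] := oV _ VP; have [e [H [hH HP HW]]] := oW _ WP.
exists (d + e)%N, (G * H); split; first exact: dhomogM.
  by rewrite pevalM mulf_neq0.
by move=> Q; rewrite pevalM mulf_eq0 negb_or => /andP[/GV ? /HW ?].
Qed.

Lemma zariski_openD d H : H \is d.-homog -> zariski_open [set P : pt k n | peval H P != 0].
Proof. by move=> hH; apply/zariski_openP => P HP; exists d, H; split. Qed.

Lemma zariski_openT : zariski_open [set: pt k n].
Proof.
apply/zariski_openP => P _; exists 0%N, 1; split=> //; first exact: dhomog1.
by rewrite /peval meval1 oner_neq0.
Qed.

End ProjectiveSpace.

(** * Function fields of spaces in projective space *)

Section FunctionField.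
Variables (k : closedFieldType) (n : nat).

(** What the structure of a subspace of projective space amounts to, for
    subspaces of subspaces as well as for projective space itself. *)
Definition local_ratio (T : Type) (j : T -> pt k n) (U : set T) (f : T -> k) :=
  forall x, U x -> exists (V : set (pt k n)) d (G H : {mpoly k[n.+1]}),
    [/\ zariski_open V /\ V (j x), G \is d.-homog, H \is d.-homog &
      forall y, U y -> V (j y) ->
        peval H (j y) != 0 /\ f y = peval G (j y) / peval H (j y)].

Definition embedded (S : kspace k) (j : S -> pt k n) :=
  (forall U : set S, opens S U <-> exists2 V, zariski_open V & U = j @^-1` V) /\
  forall (U : set S) f, regular S U f <-> local_ratio j U f.

Lemma cross_homog d e (G H G' H' : {mpoly k[n.+1]}) :
  G \is d.-homog -> H \is d.-homog -> G' \is e.-homog -> H' \is e.-homog ->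
  G * H' - G' * H \is (d + e).-homog.
Proof.
move=> hG hH hG' hH'; apply: rpredB; first exact: dhomogM.
by rewrite mulrC; exact: dhomogM.
Qed.

Lemma embedded_id : @embedded (proj_space k n) id.
Proof.
split; last by [].
by move=> U; split=> [oU|[V oV ->]] //; exists U.
Qed.

Lemma embedded_subspace (S : kspace k) (j : S -> pt k n) (A : set S) :
  embedded j -> @embedded (subspace A) (j \o sval).
Proof.
case=> jO jR; split.
  move=> U; split.
    by case=> V /jO[W oW ->] ->; exists W.
  by case=> W oW ->; exists (j @^-1` W) => //; apply/jO; exists W.
move=> U f; split.
  move=> rf x Ux; have [V [g [/jO[W oW ->] Wx /jR rg fg]]] := rf x Ux.
  have [V' [d [G [H [[oV' V'x] hG hH e]]]]] := rg _ Wx.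
  exists (W `&` V'), d, G, H; split=> //; first by split; [exact: zariski_openI|].
  by move=> y Uy [Wy V'y]; rewrite (fg _ Uy Wy); exact: e.
move=> rf x Ux; have [V [d [G [H [[oV Vx] hG hH e]]]]] := rf x Ux.
exists (j @^-1` (V `&` [set P | peval H P != 0])),
  (fun y => peval G (j y) / peval H (j y)); split.
- by apply/jO; exists (V `&` [set P | peval H P != 0]) => //;
    apply: zariski_openI => //; exact: zariski_openD hH.
- by split=> //; have [] := e x Ux Vx.
- apply/jR => y [Vy Hy]; exists [set P | peval H P != 0], d, G, H; split=> //.
  by split=> //; exact: zariski_openD hH.
- by move=> y Uy [Vy Hy]; have [] := e y Uy Vy.
Qed.

Variables (S : kspace k) (j : S -> pt k n) (K : fieldType).
Variable phi : {rmorphism {mpoly k[n.+1]} -> K}.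
Hypothesis S_embedded : embedded j.
Hypothesis phi_ker : forall d (G : {mpoly k[n.+1]}), G \is d.-homog ->
  (phi G = 0 <-> forall x, peval G (j x) = 0).

Let S_opens U : opens S U <-> exists2 V, zariski_open V & U = j @^-1` V :=
  S_embedded.1 U.
Let S_regular U f : regular S U f <-> local_ratio j U f := S_embedded.2 U f.

(** One fraction of forms serves on the whole of [U]; the product form of the
    equation allows its denominator to vanish at points of [U]. *)
Definition represents (a : K) (U : set S) (f : S -> k) :=
  exists d (G H : {mpoly k[n.+1]}), [/\ G \is d.-homog, H \is d.-homog, phi H != 0,
    a = phi G / phi H & forall x, U x -> f x * peval H (j x) = peval G (j x)].

(** Irreducibility enters here: multiplied with a form that vanishes off a basic
    open subset, [G] vanishes everywhere, and a field has no zero divisors. *)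
Lemma vanish_on_open U d (G : {mpoly k[n.+1]}) : opens S U -> U !=set0 -> G \is d.-homog ->
  (forall x, U x -> peval G (j x) = 0) -> phi G = 0.
Proof.
move=> /S_opens[V /zariski_openP oV ->] [x Vx] hG GU.
have [e [H [hH Hx HV]]] := oV _ Vx.
have /eqP : phi (G * H) = 0.
  apply/(phi_ker (dhomogM hG hH)) => y; rewrite pevalM.
  have [->|/HV Vy] := eqVneq (peval H (j y)) 0; first by rewrite mulr0.
  by rewrite GU ?mul0r.
rewrite rmorphM mulf_eq0 => /orP[/eqP//|/eqP/(phi_ker hH)/(_ x) H0].
by rewrite H0 eqxx in Hx.
Qed.

Lemma opens_setI U V : opens S U -> opens S V -> opens S (U `&` V).
Proof.
move=> /S_opens[U' oU ->] /S_opens[V' oV ->]; apply/S_opens.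
by exists (U' `&` V') => //; exact: zariski_openI.
Qed.

Lemma basic_open U x : opens S U -> U x -> exists d H,
  [/\ H \is d.-homog, peval H (j x) != 0, phi H != 0 & forall y, peval H (j y) != 0 -> U y].
Proof.
move=> /S_opens[V /zariski_openP oV ->] Vx; have [d [H [hH Hx HV]]] := oV _ Vx.
exists d, H; split=> //; last by move=> y /HV.
by apply: contra Hx => /eqP/(phi_ker hH)/(_ x) ->.
Qed.

Lemma opens_meet U V : opens S U -> U !=set0 -> opens S V -> V !=set0 ->
  U `&` V !=set0.
Proof.
move=> oU [x Ux] oV [y Vy].
have [d [G [hG Gx G0 GU]]] := basic_open oU Ux.
have [e [H [hH Hy H0 HV]]] := basic_open oV Vy.
apply: contrapT => /set0P/negP; rewrite negbK => /eqP UV0.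
have : phi (G * H) = 0.
  apply/(phi_ker (dhomogM hG hH)) => z; apply/eqP; apply: contrapT => /negP.
  rewrite pevalM mulf_eq0 negb_or => /andP[/GU Uz /HV Vz].
  by have : (U `&` V) z by []; rewrite UV0.
by move/eqP; rewrite rmorphM mulf_eq0 (negPf G0) (negPf H0).
Qed.

Lemma represents_uniq a b U f : opens S U -> U !=set0 ->
  represents a U f -> represents b U f -> a = b.
Proof.
move=> oU U0 [d [G [H [hG hH H0 -> GH]]]] [e [G' [H' [hG' hH' H'0 -> GH']]]].
apply/eqP; rewrite eqr_div // -subr_eq0 -!rmorphM -rmorphB; apply/eqP.
have hh : G * H' - G' * H \is (d + e).-homog.
  exact: cross_homog.
apply: (vanish_on_open oU U0 hh) => x Ux.
by rewrite /peval mevalB -!/(peval _ _) !pevalM -GH // -GH' // mulrAC subrr.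
Qed.

(** Two local expressions of [f] are both valid on a common nonempty open set, so
    their cross difference vanishes there, hence everywhere. *)
Lemma local_ratio_global U f x V d (G H : {mpoly k[n.+1]}) :
  opens S U -> local_ratio j U f -> U x -> zariski_open V -> V (j x) ->
  G \is d.-homog -> H \is d.-homog ->
  (forall y, U y -> V (j y) -> peval H (j y) != 0 /\ f y = peval G (j y) / peval H (j y)) ->
  forall y, U y -> f y * peval H (j y) = peval G (j y).
Proof.
move=> oU rf Ux oV Vx hG hH e y Uy.
have o1 : opens S (j @^-1` V) by apply/S_opens; exists V.
have [V' [d' [G' [H' [[oV' V'y] hG' hH' e']]]]] := rf _ Uy.
have o2 : opens S (j @^-1` V') by apply/S_opens; exists V'.
have [H'y ->] := e' y Uy V'y.
have hh : G' * H - G * H' \is (d' + d).-homog by exact: cross_homog.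
have : phi (G' * H - G * H') = 0.
  apply: (vanish_on_open (U := (U `&` j @^-1` V) `&` (U `&` j @^-1` V'))) hh _.
  - by do 2 ?apply: opens_setI.
  - by apply: opens_meet; [exact: opens_setI|exists x|exact: opens_setI|exists y].
  - move=> z [[Uz Vz] [_ V'z]]; have [Hz fz] := e z Uz Vz; have [H'z] := e' z Uz V'z.
    rewrite fz => /eqP; rewrite eqr_div // => /eqP ee.
    by rewrite /peval mevalB -!/(peval _ _) !pevalM -ee mulrC subrr.
move/(phi_ker hh)/(_ y); rewrite /peval mevalB -!/(peval _ _) !pevalM => /eqP.
by rewrite subr_eq0 => /eqP ee; rewrite mulrAC ee mulfK.
Qed.

Lemma represents_exists U f : admissible U f -> exists a, represents a U f.
Proof.
case=> oU [x Ux] /S_regular rf.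
have [V [d [G [H [[oV Vx] hG hH e]]]]] := rf _ Ux.
have H0 : phi H != 0.
  apply/eqP => /(phi_ker hH)/(_ x); apply/eqP; by have [] := e x Ux Vx.
exists (phi G / phi H), d, G, H; split=> //.
exact: local_ratio_global oU rf Ux oV Vx hG hH e.
Qed.

Lemma represents_sub a U V f : represents a U f -> V `<=` U -> represents a V f.
Proof.
by move=> [d [G [H [hG hH H0 -> e]]]] VU; exists d, G, H; split=> // x /VU /e.
Qed.

Lemma represents_eq a U f V g : admissible U f -> admissible V g ->
  represents a U f -> represents a V g -> forall x, U x -> V x -> f x = g x.
Proof.
move=> [oU U0 /S_regular rf] [oV V0 /S_regular rg] raf rag x Ux Vx.
have [W [d [G [H [[oW Wx] hG hH e]]]]] := rf _ Ux.
have [W' [d' [G' [H' [[oW' W'x] hG' hH' e']]]]] := rg _ Vx.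
have [Hx ->] := e x Ux Wx; have [H'x ->] := e' x Vx W'x.
pose U1 := (U `&` j @^-1` W); pose V1 := V `&` j @^-1` W'.
have o1 : opens S U1 by apply: opens_setI => //; apply/S_opens; exists W.
have o2 : opens S V1 by apply: opens_setI => //; apply/S_opens; exists W'.
have H0 : phi H != 0 by apply/eqP => /(phi_ker hH)/(_ x)/eqP; apply/negP.
have H'0 : phi H' != 0 by apply/eqP => /(phi_ker hH')/(_ x)/eqP; apply/negP.
have aE : a = phi G / phi H.
  apply: (represents_uniq o1); first by exists x.
    by apply: represents_sub raf _ => z [].
  exists d, G, H; split=> // z [Uz Wz]; have [Hz ->] := e z Uz Wz; by rewrite divfK.
have aE' : a = phi G' / phi H'.
  apply: (represents_uniq o2); first by exists x.
    by apply: represents_sub rag _ => z [].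
  exists d', G', H'; split=> // z [Uz Wz]; have [Hz ->] := e' z Uz Wz; by rewrite divfK.
have hh : G * H' - G' * H \is (d + d').-homog.
  exact: cross_homog.
have : phi (G * H' - G' * H) = 0.
  apply/eqP; rewrite rmorphB !rmorphM subr_eq0 -eqr_div //; by rewrite -aE aE'.
move/(phi_ker hh)/(_ x)/eqP.
by rewrite /peval mevalB -!/(peval _ _) !pevalM subr_eq0 -eqr_div // => /eqP.
Qed.

Lemma represents1 U : represents 1 U (fun=> 1).
Proof.
exists 0%N, 1, 1; rewrite dhomog1 rmorph1 divr1 oner_neq0; split=> // x _.
by rewrite mul1r.
Qed.

Lemma representsD a b U f V g : represents a U f -> represents b V g ->
  represents (a + b) (U `&` V) (fun x => f x + g x).
Proof.
move=> [d [G [H [hG hH H0 -> e]]]] [d' [G' [H' [hG' hH' H'0 -> e']]]].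
exists (d + d')%N, (G * H' + G' * H), (H * H'); split.
- rewrite -[G' * H]opprK -mulNr; apply: cross_homog => //; by rewrite rpredN.
- exact: dhomogM.
- by rewrite rmorphM mulf_neq0.
- by rewrite rmorphD !rmorphM addf_div.
- move=> x [/e ex /e' e'x]; rewrite pevalD !pevalM -ex -e'x mulrDl.
  by rewrite mulrA; congr (_ + _); rewrite -mulrA; congr (_ * _); rewrite mulrC.
Qed.

Lemma representsM a b U f V g : represents a U f -> represents b V g ->
  represents (a * b) (U `&` V) (fun x => f x * g x).
Proof.
move=> [d [G [H [hG hH H0 -> e]]]] [d' [G' [H' [hG' hH' H'0 -> e']]]].
exists (d + d')%N, (G * G'), (H * H'); split.
- exact: dhomogM.
- exact: dhomogM.
- by rewrite rmorphM mulf_neq0.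
- by rewrite !rmorphM mulf_div.
- by move=> x [/e ex /e' e'x]; rewrite !pevalM -ex -e'x mulrACA.
Qed.

(** The value [0] is for pairs that are not admissible. *)
Definition germ_in (U : set S) (f : S -> k) : K :=
  match pselect (exists a, represents a U f) with
  | left ra => projT1 (cid ra)
  | right _ => 0
  end.

Lemma germ_inE U f a : opens S U -> U !=set0 -> represents a U f -> germ_in U f = a.
Proof.
move=> oU U0 ra; rewrite /germ_in; case: pselect => [ra'|]; last by case; exists a.
by case: cid => b /= rb; apply: represents_uniq rb ra.
Qed.

Hypothesis phi_gen : forall a, exists d (G H : {mpoly k[n.+1]}),
  [/\ G \is d.-homog, H \is d.-homog, phi H != 0 & a = phi G / phi H].

(** Each requirement amounts to the uniqueness of the represented element, since
    sums and products of fractions represent sums and products of functions. *)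
Theorem function_field_of_germs : is_function_field germ_in.
Proof.
have gE U f a : admissible U f -> represents a U f -> germ_in U f = a.
  by case=> oU U0 _; exact: germ_inE.
split.
- move=> a; have [d [G [H [hG hH H0 aE]]]] := phi_gen a.
  pose U : set S := j @^-1` [set P | peval H P != 0].
  have adm : admissible U (fun x => peval G (j x) / peval H (j x)).
    split.
    + by apply/S_opens; exists [set P | peval H P != 0] => //; exact: zariski_openD hH.
    + apply: contrapT => /forallNP U0; move/eqP: H0; apply; apply/(phi_ker hH) => x.
      by apply/eqP; apply: contrapT => /negP; exact: U0.
    + apply/S_regular => x Ux; exists [set P | peval H P != 0], d, G, H; split=> //.
      by split=> //; exact: zariski_openD hH.
  exists U, (fun x => peval G (j x) / peval H (j x)); split=> //; apply: gE => //.
  by exists d, G, H; split=> // x Ux; rewrite divfK.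
- move=> U f V g aU aV; have [a ra] := represents_exists aU.
  have [b rb] := represents_exists aV; rewrite (gE _ _ _ aU ra) (gE _ _ _ aV rb); split.
    by move=> ab; rewrite ab in ra; exact: represents_eq ra rb.
  move=> fg; have [oU U0 _] := aU; have [oV V0 _] := aV.
  apply: (represents_uniq (opens_setI oU oV)); first exact: opens_meet.
    by apply: represents_sub ra _ => x [].
  have [d [G [H [hG hH H0 bE e]]]] := rb.
  by exists d, G, H; split=> // x [Ux Vx]; rewrite fg // e.
- apply: germ_inE; last exact: represents1.
    by apply/S_opens; exists setT => //; exact: zariski_openT.
  apply: contrapT => /forallNP no; have /eqP := oner_neq0 K; apply.
  rewrite -(rmorph1 phi); apply/(phi_ker (dhomog1 _ _)) => x.
  by case: (no x).
- move=> U f V g aU aV; have [a ra] := represents_exists aU.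
  have [b rb] := represents_exists aV; rewrite (gE _ _ _ aU ra) (gE _ _ _ aV rb).
  have [oU U0 _] := aU; have [oV V0 _] := aV.
  by apply: germ_inE (representsD ra rb); [exact: opens_setI|exact: opens_meet].
- move=> U f V g aU aV; have [a ra] := represents_exists aU.
  have [b rb] := represents_exists aV; rewrite (gE _ _ _ aU ra) (gE _ _ _ aV rb).
  have [oU U0 _] := aU; have [oV V0 _] := aV.
  by apply: germ_inE (representsM ra rb); [exact: opens_setI|exact: opens_meet].
Qed.

End FunctionField.

(** The factor [c] absorbs the choice of representatives made by [coords]; it
    cancels in ratios of forms of equal degree. *)
Lemma pullback_morphism (k : closedFieldType) n n' (S : kspace k) (j : S -> pt k n)
    (f : S -> proj_space k n') (pb : {mpoly k[n'.+1]} -> {mpoly k[n.+1]}) e :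
  embedded j -> (forall d H, H \is d.-homog -> pb H \is (e * d).-homog) ->
  (forall x, exists2 c, c != 0 & forall d H, H \is d.-homog ->
     peval H (f x) = c ^+ d * peval (pb H) (j x)) ->
  morphism f.
Proof.
move=> [jO jR] pbh pbE V oV.
have nz x d H : H \is d.-homog -> (peval H (f x) != 0) = (peval (pb H) (j x) != 0).
  by move=> hH; have [c c0 cE] := pbE x; rewrite (cE _ _ hH) mulf_eq0 expf_eq0 (negPf c0) andbF.
split.
  apply/jO; exists [set P | exists d H, [/\ H \is d.-homog, peval (pb H) P != 0 &
      forall Q, peval H Q != 0 -> V Q]].
    apply/zariski_openP => P [d [H [hH HP HV]]]; exists (e * d)%N, (pb H); split=> //.
      exact: pbh.
    by move=> Q HQ; exists d, H.
  apply/seteqP; split=> x.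
    move=> Vfx; have [d [H [hH HP HV]]] := (zariski_openP V).1 oV _ Vfx.
    by exists d, H; split=> //; rewrite -(nz _ _ _ hH).
  by case=> d [H [hH HP HV]]; apply: HV; rewrite (nz _ _ _ hH).
move=> g rg; apply/jR => x Vfx; have [W [d [G [H [[oW Wx] hG hH E]]]]] := rg _ Vfx.
have [d' [H' [hH' H'x H'W]]] := (zariski_openP W).1 oW _ Wx.
exists [set P | peval (pb H') P != 0], (e * d)%N, (pb G), (pb H); split.
- split; first by apply: zariski_openD (pbh _ _ hH').
  by rewrite /= -(nz _ _ _ hH').
- exact: pbh.
- exact: pbh.
move=> y Vfy /=; rewrite -(nz _ _ _ hH') => /H'W Wy; have [Hy gE] := E _ Vfy Wy.
rewrite -(nz _ _ _ hH) Hy gE; split=> //.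
have [c c0 cE] := pbE y; rewrite (cE _ _ hG) (cE _ _ hH) invfM mulrACA divff ?mul1r //.
by rewrite expf_neq0.
Qed.

(** * Polynomial functions on the quotient curve *)

Section Roots.
Variable k : closedFieldType.

Lemma artin_schreier_roots n (c a : k) : (1 < n)%N -> n%:R = 0 :> k -> c != 0 ->
  exists rs, [/\ uniq rs, size rs = n & forall x, (x \in rs) = (x ^+ n + c * x == a)].
Proof.
move=> n1 n0 c0; pose p : {poly k} := 'X^n + (c *: 'X - a%:P).
have sz : size (c *: 'X - a%:P : {poly k}) = 2%N.
  by rewrite -mul_polyC -polyCN size_MXaddC polyC_eq0 (negPf c0) /= size_polyC c0.
have szp : size p = n.+1 by rewrite /p size_polyDl size_polyXn // sz.
have dp : p^`() = c *: 1.
  (* The derivative is the nonzero constant [c], so the polynomial is separable. *)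
  rewrite /p derivD derivXn -mulr_natr -polyC_natr n0 mulr0 add0r.
  by rewrite derivB derivC derivZ derivX subr0.
have sep : separable_poly p.
  by rewrite separable_poly.unlock dp coprimepZr // coprimep1.
have [rs [u srs rP]] := separable_roots sep; exists rs; split=> //.
  by rewrite srs szp.
by move=> x; rewrite rP /root /p !hornerE ?addrA subr_eq0.
Qed.
End Roots.

Lemma poly_sum_coef (R : nzRingType) (I : eqType) (r : seq I) (c : I -> R) (d : I -> nat) j :
  (\sum_(i <- r) (c i *: 'X^(d i)))`_j = \sum_(i <- r | d i == j) c i.
Proof.
rewrite coef_sum [RHS]big_mkcond; apply: eq_bigr => i _.
by rewrite coefZ coefXn eq_sym; case: eqP; rewrite ?mulr1 ?mulr0.
Qed.

Section Monomials.
Variables (k : closedFieldType).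

Definition o0 : 'I_3 := ord0.
Definition o1 : 'I_3 := lift ord0 ord0.
Definition o2 : 'I_3 := lift ord0 (lift ord0 ord0).

Definition vec3 (R : Type) (x y z : R) (i : 'I_3) : R :=
  if i == o0 then x else if i == o1 then y else z.

Lemma ord3P (P : 'I_3 -> Prop) : P o0 -> P o1 -> P o2 -> forall i, P i.
Proof.
move=> P0 P1 P2 [[|[|[|//]]] h].
- by rewrite (_ : Ordinal h = o0) //; apply: val_inj.
- by rewrite (_ : Ordinal h = o1) //; apply: val_inj.
- by rewrite (_ : Ordinal h = o2) //; apply: val_inj.
Qed.

Lemma big3 (R : Type) (idx : R) (op : Monoid.law idx) (F : 'I_3 -> R) :
  \big[op/idx]_(i < 3) F i = op (F o0) (op (F o1) (F o2)).
Proof. by rewrite !big_ord_recl big_ord0 Monoid.mulm1. Qed.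

Definition mon3 (a b c : nat) : 'X_{1..3} := [multinom vec3 a b c i | i < 3].

Lemma mon3E a b c : (mon3 a b c o0 = a) * (mon3 a b c o1 = b) * (mon3 a b c o2 = c).
Proof. by rewrite !mnmE. Qed.

Lemma mnm3P (m m' : 'X_{1..3}) : m o0 = m' o0 -> m o1 = m' o1 -> m o2 = m' o2 -> m = m'.
Proof. by move=> e0 e1 e2; apply/mnmP; apply: ord3P. Qed.

Lemma evalX3 (R : comNzRingType) (x y w : R) m :
  ('X_[m] : {mpoly R[3]}).@[vec3 x y w] = x ^+ m o0 * y ^+ m o1 * w ^+ m o2.
Proof. by rewrite mevalX big3 /= mulrA. Qed.

Lemma eval3E (R : comNzRingType) (x y w : R) (P : {mpoly R[3]}) :
  P.@[vec3 x y w] = \sum_(m <- msupp P) P@_m * (x ^+ m o0 * y ^+ m o1 * w ^+ m o2).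
Proof. by rewrite mevalE; apply: eq_bigr => m _; rewrite big3 /= !mulrA. Qed.

End Monomials.

Section Curve.
Variables (k : closedFieldType) (q s : nat).
Hypothesis q_gt1 : (1 < q)%N.
Hypothesis q_eq0 : q%:R = 0 :> k.
Hypothesis s_gt0 : (0 < s)%N.
Hypothesis s_coprime : coprime q s.

Definition on_curve (x y w : k) := x ^+ q + x = y ^+ q.+1 /\ y ^+ (q ^ 2) - y = w ^+ s.

Definition vanishes (P : {mpoly k[3]}) :=
  forall x y w, on_curve x y w -> P.@[vec3 x y w] = 0.

(** The pole orders of [x], [y] and [w] at infinity: [w] has degree [q ^ 3], and the
    two equations determine the other orders. *)
Definition wt (m : 'X_{1..3}) := (m o0 * (q.+1 * s) + m o1 * (q * s) + m o2 * q ^ 3)%N.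
(** The monomials that neither [x ^ q] nor [y ^ (q ^ 2)], the leading monomials of the
    equations, divides. *)
Definition normal (m : 'X_{1..3}) := (m o0 < q)%N && (m o1 < q ^ 2)%N.
Definition wt_lt D (P : {mpoly k[3]}) := {in msupp P, forall m, (wt m < D)%N}.

Lemma wtD m m' : wt (m + m')%MM = (wt m + wt m')%N.
Proof. by rewrite /wt !mnmDE; lia. Qed.

Lemma coprime_mul_inj d i i' : coprime d s -> (i < d)%N -> (i' < d)%N ->
  (i * s = i' * s %[mod d])%N -> i = i'.
Proof.
move=> co; wlog le : i i' / (i <= i')%N => [hw|_ lt' /esym/eqP].
  case: (leqP i i') => [le|/ltnW le] l l' e; first exact: hw.
  by symmetry; apply: hw.
rewrite eqn_mod_dvd ?leq_mul2r ?le ?orbT // -mulnBl Gauss_dvdl //.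
move=> dv; apply/eqP; rewrite eqn_leq le /= -subn_eq0; apply: contraTT dv => ne.
by rewrite gtnNdvd ?lt0n //; apply: leq_ltn_trans lt'; rewrite leq_subr.
Qed.

(** Modulo [q] the weight determines the exponent of [x], and then modulo [q ^ 2]
    that of [y], because [s] is prime to [q]. *)
Lemma wt_inj m m' : normal m -> normal m' -> wt m = wt m' -> m = m'.
Proof.
move=> /andP[a0 a1] /andP[b0 b1] e.
have q0 : (0 < q)%N by exact: ltnW.
have e0 : m o0 = m' o0.
  apply: (coprime_mul_inj s_coprime a0 b0).
  have w (u : 'X_{1..3}) : wt u = ((u o0 * s + u o1 * s + u o2 * q ^ 2) * q + u o0 * s)%N.
    by rewrite /wt; lia.
  by have := congr1 (modn^~ q) e; rewrite /= !w !modnMDl.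
have e1 : m o1 = m' o1.
  have co : coprime (q ^ 2) s by rewrite coprimeXl.
  apply: (coprime_mul_inj co a1 b1).
  have : (m o2 * q ^ 2 + m o1 * s = m' o2 * q ^ 2 + m' o1 * s)%N.
    apply/eqP; rewrite -(eqn_pmul2r q0); apply/eqP; move: e; rewrite /wt e0; lia.
  by move/(congr1 (modn^~ (q ^ 2)%N)); rewrite /= !modnMDl.
apply: mnm3P => //; apply/eqP; rewrite -(eqn_pmul2r (_ : 0 < q ^ 3)%N) ?expn_gt0 ?q0 //.
by apply/eqP; move: e; rewrite /wt e0 e1; lia.
Qed.

Lemma wt_ltD D P Q : wt_lt D P -> wt_lt D Q -> wt_lt D (P + Q).
Proof. by move=> hP hQ m /msuppD_le; rewrite mem_cat => /orP[/hP|/hQ]. Qed.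

Lemma wt_ltZ D c P : wt_lt D P -> wt_lt D (c *: P).
Proof. by move=> hP m /msuppZ_le/hP. Qed.

Lemma wt_ltX D m : (wt m < D)%N -> wt_lt D 'X_[m].
Proof. by move=> hm m'; rewrite msuppX inE => /eqP ->. Qed.

Lemma wt_ltM D D' P Q : wt_lt D P -> wt_lt D'.+1 Q -> wt_lt (D + D') (P * Q).
Proof.
move=> hP hQ m /msuppM_le/allpairsP[[a b] /= [/hP ha /hQ hb ->]].
by rewrite wtD; lia.
Qed.

Lemma wt_ltW D D' P : (D <= D')%N -> wt_lt D P -> wt_lt D' P.
Proof. by move=> le hP m /hP h; exact: leq_trans h le. Qed.

Lemma vanishesD P Q : vanishes P -> vanishes Q -> vanishes (P + Q).
Proof. by move=> hP hQ x y w on; rewrite mevalD hP ?hQ ?addr0. Qed.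

Lemma vanishesB P Q : vanishes P -> vanishes Q -> vanishes (P - Q).
Proof. by move=> hP hQ x y w on; rewrite mevalB hP ?hQ ?subr0. Qed.

Lemma vanishesZ c P : vanishes P -> vanishes (c *: P).
Proof. by move=> hP x y w on; rewrite mevalZ hP ?mulr0. Qed.

Lemma vanishesM P Q : vanishes Q -> vanishes (P * Q).
Proof. by move=> hQ x y w on; rewrite mevalM hQ ?mulr0. Qed.

(** Replacing [x ^ q] with [y ^ (q + 1) - x], or [y ^ (q ^ 2)] with [w ^ s + y], turns a
    monomial into one of the same weight plus one of smaller weight. *)
Lemma reduce_monomial m : exists m' R, [/\ normal m', wt m' = wt m, wt_lt (wt m) R &
  vanishes ('X_[m] - 'X_[m'] - R)].
Proof.
have q0 : (0 < q)%N by exact: ltnW.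
have [a le_a] := ubnP (m o0); elim: a => // a IHa in m le_a *.
have [b le_b] := ubnP (m o1); elim: b => // b IHb in m le_a le_b *.
have step m2 r c : wt m2 = wt m -> (wt r < wt m)%N ->
    vanishes ('X_[m] - 'X_[m2] - c *: 'X_[r]) ->
    (exists m' R, [/\ normal m', wt m' = wt m2, wt_lt (wt m2) R &
       vanishes ('X_[m2] - 'X_[m'] - R)]) ->
    exists m' R, [/\ normal m', wt m' = wt m, wt_lt (wt m) R &
       vanishes ('X_[m] - 'X_[m'] - R)].
  move=> e2 lr v2 [m' [R [n' e' lR v']]]; exists m', (R + c *: 'X_[r]); split=> //.
  - by rewrite e'.
  - by apply: wt_ltD; [rewrite -e2|apply: wt_ltZ; exact: wt_ltX].
  - have -> : 'X_[m] - 'X_[m'] - (R + c *: 'X_[r]) =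
      ('X_[m] - 'X_[m2] - c *: 'X_[r]) + ('X_[m2] - 'X_[m'] - R) by ring.
    exact: vanishesD.
have [m0q|qm0] := ltnP (m o0) q.
  have [m1q|qm1] := ltnP (m o1) (q ^ 2).
    exists m, 0; split=> //; first by rewrite /normal m0q.
    + by move=> u; rewrite msupp0.
    + by move=> x y w _; rewrite !mevalB subrr meval0 subr0.
  pose m2 := mon3 (m o0) (m o1 - q ^ 2) (m o2 + s).
  pose r := mon3 (m o0) (m o1 - q ^ 2).+1 (m o2).
  apply: (step m2 r 1).
  + rewrite /wt !mon3E; have : (m o1 = (m o1 - q ^ 2) + q ^ 2)%N by lia.
    move: (m o1 - q ^ 2)%N => c ->; lia.
  + rewrite /wt !mon3E; have : (m o1 = (m o1 - q ^ 2) + q ^ 2)%N by lia.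
    move: (m o1 - q ^ 2)%N => c ->; rewrite ltn_add2r ltn_add2l ltn_pmul2r ?muln_gt0 ?q0 //.
    have : (1 < q ^ 2)%N by rewrite -[1%N](expn0 q) ltn_exp2l.
    by lia.
  + move=> x y w [_ e]; rewrite !mevalB mevalZ !evalX3 !mon3E exprD -e.
    have {1}-> : (m o1 = (m o1 - q ^ 2) + q ^ 2)%N by lia.
    by rewrite exprD exprS; ring.
  + apply: IHb; rewrite !mon3E //.
    have : (0 < q ^ 2)%N by rewrite expn_gt0 q0.
    by lia.
pose m2 := mon3 (m o0 - q) (m o1 + q.+1) (m o2).
pose r := mon3 (m o0 - q).+1 (m o1) (m o2).
have em0 : (m o0 = (m o0 - q) + q)%N by rewrite subnK.
apply: (step m2 r (-1)).
- rewrite /wt !mon3E; move: em0; move: (m o0) (m o0 - q)%N => u v ->; lia.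
- rewrite /wt !mon3E ltn_add2r ltn_add2r ltn_pmul2r ?muln_gt0 ?s_gt0 // -addn1 {2}em0.
  by rewrite ltn_add2l.
- move=> x y w [e _]; rewrite !mevalB mevalZ !evalX3 !mon3E exprD -e.
  by rewrite {1}em0 exprD exprS; ring.
- apply: IHa; rewrite !mon3E; lia.
Qed.

Lemma normal_form D P : wt_lt D P -> exists P', [/\ wt_lt D P',
  {in msupp P', forall m, normal m} & vanishes (P - P')].
Proof.
have [d le_d] := ubnP D; elim: d => // d IHd in D P le_d *.
move=> hP; rewrite (mpolyE P).
move: (msupp P) (hP : {in msupp P, forall m, (wt m < D)%N}) => ms.
elim: ms {hP} => [|m ms IHms] hP.
  exists 0; rewrite big_nil; split.
  - by move=> m; rewrite msupp0.
  - by move=> m; rewrite msupp0.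
  - by move=> x y w _; rewrite subrr meval0.
have hm : (wt m < D)%N by apply: hP; rewrite mem_head.
have [|P1 [l1 n1 v1]] := IHms; first by move=> m' m'ms; apply: hP; rewrite inE m'ms orbT.
have [m' [R [n' e' lR vR]]] := reduce_monomial m.
have [|R' [lR' nR' vR']] := IHd (wt m) R _ lR; first by lia.
exists (P@_m *: ('X_[m'] + R') + P1); split.
- apply: wt_ltD => //; apply: wt_ltZ; apply: wt_ltD; first by apply: wt_ltX; rewrite e'.
  by apply: wt_ltW lR'; exact: ltnW.
- move=> u /msuppD_le; rewrite mem_cat => /orP[/msuppZ_le/msuppD_le|/n1//].
  by rewrite mem_cat msuppX inE => /orP[/eqP ->|/nR'].
- rewrite big_cons.
  set Q := \sum_(_ <- _) _ in v1 *.
  have -> : P@_m *: 'X_[m] + Q - (P@_m *: ('X_[m'] + R') + P1) =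
     P@_m *: (('X_[m] - 'X_[m'] - R) + (R - R')) + (Q - P1).
    rewrite -!mul_mpolyC; ring.
  by apply: vanishesD => //; apply: vanishesZ; exact: vanishesD.
Qed.

Lemma y_roots w : exists rs : seq k, [/\ uniq rs, size rs = (q ^ 2)%N &
  forall y, (y \in rs) = (y ^+ (q ^ 2) - y == w ^+ s)].
Proof.
have [|||rs [u sz rP]] := @artin_schreier_roots k (q ^ 2) (-1) (w ^+ s).
- by rewrite -[1%N](expn0 q) ltn_exp2l.
- by rewrite natrX q_eq0 expr0n.
- by rewrite oppr_eq0 oner_neq0.
by exists rs; split=> // y; rewrite rP mulN1r.
Qed.

Lemma x_roots y : exists rs : seq k, [/\ uniq rs, size rs = q &
  forall x, (x \in rs) = (x ^+ q + x == y ^+ q.+1)].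
Proof.
have [|||rs [u sz rP]] := @artin_schreier_roots k q 1 (y ^+ q.+1) => //.
  exact: oner_neq0.
by exists rs; split=> // x; rewrite rP mul1r.
Qed.

Lemma curve_over w : exists x y, on_curve x y w.
Proof.
have [ys [_ sy yP]] := y_roots w.
have : (0 < size ys)%N by rewrite sy expn_gt0 (ltnW q_gt1).
case: ys yP {sy} => // y ys yP _.
have [xs [_ sx xP]] := x_roots y.
have : (0 < size xs)%N by rewrite sx (ltnW q_gt1).
case: xs xP {sx} => // x xs xP _; exists x, y; split.
  by apply/eqP; rewrite -xP mem_head.
by apply/eqP; rewrite -yP mem_head.
Qed.

Lemma poly_sum_const (I : eqType) (r : seq I) (c : I -> k) (d : I -> nat) n (rs : seq k) C :
  (0 < n)%N -> {in r, forall i, (d i < n)%N} -> uniq rs -> size rs = n ->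
  (forall x, x \in rs -> \sum_(i <- r) c i * x ^+ d i = C) ->
  forall j, \sum_(i <- r | d i == j) c i = if j == 0%N then C else 0.
Proof.
move=> n0 dn u sz xC j.
have : \sum_(i <- r) (c i *: 'X^(d i)) - C%:P = 0.
  apply: (@roots_geq_poly_eq0 _ _ rs) => //.
    apply/allP => x /xC e; rewrite /root hornerD hornerN hornerC horner_sum -e.
    by under eq_bigr do rewrite hornerZ hornerXn; rewrite subrr.
  rewrite sz; apply: (leq_trans (size_polyD _ _)); rewrite geq_max size_polyN.
  rewrite (leq_trans (size_polyC_leq1 _)) // andbT big_seq.
  elim/big_ind: _ => [|p1 p2 h1 h2|i ir]; first by rewrite size_poly0.
    by apply: (leq_trans (size_polyD _ _)); rewrite geq_max h1.
  by apply: (leq_trans (size_scale_leq _ _)); rewrite size_polyXn dn.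
by move/polyP/(_ j); rewrite coefB coefC poly_sum_coef coef0 => /eqP; rewrite subr_eq0 => /eqP.
Qed.

(** Over each value of [w] there are [q ^ 2] values of [y], and over each of
    these [q] values of [x]: enough points to read off the coefficients of a
    normal form. *)
Lemma normal_coef P w C : {in msupp P, forall m, normal m} ->
  (forall x y, on_curve x y w -> P.@[vec3 x y w] = C) ->
  forall i j, \sum_(m <- msupp P | (m o0 == i) && (m o1 == j)) P@_m * w ^+ m o2 =
    if (i == 0%N) && (j == 0%N) then C else 0.
Proof.
move=> nP PC i j.
have [ys [uy sy yP]] := y_roots w.
have Cy y : y \in ys -> \sum_(m <- msupp P | m o0 == i) P@_m * w ^+ m o2 * y ^+ m o1 =
    if i == 0%N then C else 0.
  rewrite yP => /eqP wy; have [xs [ux sx xP]] := x_roots y.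
  apply: (poly_sum_const (n := q) (rs := xs)) => //.
  - exact: ltnW.
  - by move=> m /nP/andP[].
  - move=> x; rewrite xP => /eqP xy; rewrite -(PC x y) // eval3E; apply: eq_bigr => m _; ring.
have := @poly_sum_const 'X_{1..3} [seq m : 'X_{1..3} <- msupp P | m o0 == i] (fun m => P@_m * w ^+ m o2)
  (fun m : 'X_{1..3} => m o1) (q ^ 2)%N ys (if i == 0%N then C else 0).
move=> /(_ _ _ uy sy _ j); rewrite big_filter_cond => ->.
- by case: eqP => //=; case: eqP.
- by rewrite expn_gt0 (ltnW q_gt1).
- by move=> m; rewrite mem_filter => /andP[_ /nP/andP[]].
- by move=> y /Cy <-; rewrite big_filter.
Qed.

Lemma normal_vanishes P : {in msupp P, forall m, normal m} -> vanishes P -> P = 0.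
Proof.
move=> nP vP; apply/mpolyP => m; rewrite mcoeff0.
have p0 : \sum_(m' <- msupp P | (m' o0 == m o0) && (m' o1 == m o1)) P@_m' *: 'X^(m' o2) = 0.
  apply: poly_eq0_horner => w; rewrite horner_sum.
  under eq_bigr do rewrite hornerZ hornerXn.
  rewrite (@normal_coef P w 0) ?if_same // => x y; exact: vP.
have := congr1 (fun p : {poly k} => p`_(m o2)) p0; rewrite coef0 -big_filter poly_sum_coef.
rewrite big_filter_cond /=.
have [mP|/memN_msupp_eq0 //] := boolP (m \in msupp P).
rewrite (big_rem m mP) /= !eqxx /= big1_seq ?addr0 // => u /andP[/andP[/andP[/eqP e0 /eqP e1] /eqP e2]].
by rewrite mem_rem_uniq ?msupp_uniq // inE (mnm3P e0 e1 e2) eqxx.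
Qed.

Lemma vanishes_normal P : exists P', [/\ {in msupp P', forall m, normal m},
  vanishes (P - P') & P' = 0 <-> vanishes P].
Proof.
have [|P' [_ nP' vP']] := @normal_form (\max_(m <- msupp P) wt m).+1 P.
  by move=> m mP; rewrite ltnS; exact: leq_bigmax_seq.
exists P'; split=> //; split.
  by move=> e x y w on; have := vP' x y w on; rewrite e subr0.
move=> vP; apply: normal_vanishes => //.
have -> : P' = P - (P - P') by ring.
exact: vanishesB.
Qed.

Lemma leading_term P : {in msupp P, forall m, normal m} -> P != 0 ->
  exists m, [/\ P@_m != 0, normal m & wt_lt (wt m) (P - P@_m *: 'X_[m])].
Proof.
move=> nP P0.
have [m mP mmax] : exists2 m, m \in msupp P & {in msupp P, forall u, (wt u <= wt m)%N}.
  have : msupp P != [::] by rewrite msupp_eq0.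
  elim: (msupp P) => // a [|b r] IH _.
    by exists a => [|u]; rewrite ?mem_head // inE => /eqP ->.
  have [//|m mr mmax] := IH; have [le|lt] := leqP (wt a) (wt m).
    by exists m => [|u]; rewrite inE ?mr ?orbT // => /orP[/eqP ->|/mmax].
  exists a => [|u]; rewrite inE ?eqxx // => /orP[/eqP ->|/mmax h] //.
  by apply: ltnW; exact: leq_ltn_trans h lt.
exists m; split; [by rewrite -mcoeff_msupp|exact: nP|].
move=> u uP; have um : u != m.
  apply: contraTneq uP => ->; rewrite mcoeff_msupp mcoeffB mcoeffZ mcoeffX eqxx mulr1.
  by rewrite subrr eqxx.
have uP' : u \in msupp P.
  move: uP; rewrite !mcoeff_msupp mcoeffB mcoeffZ mcoeffX [m == u]eq_sym (negPf um).
  by rewrite mulr0 subr0.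
rewrite ltn_neqAle mmax // andbT; apply: contra um => /eqP e.
by apply/eqP; apply: wt_inj e; exact: nP.
Qed.

(** The leading monomials of two normal forms multiply to a monomial whose
    reduction has a weight that no other term of the product reaches. *)
Lemma vanishes_prime P Q : vanishes (P * Q) -> vanishes P \/ vanishes Q.
Proof.
move=> vPQ; have [P' [nP vP <-]] := vanishes_normal P.
have [Q' [nQ vQ <-]] := vanishes_normal Q.
have [->|P0] := eqVneq P' 0; first by left.
have [->|Q0] := eqVneq Q' 0; first by right.
have [m [cm nm lm]] := leading_term nP P0.
have [m' [cm' nm' lm']] := leading_term nQ Q0.
set R := P' - _ in lm; set R' := Q' - _ in lm'.
have [u [T [nu eu lT vT]]] := reduce_monomial (m + m')%MM.
rewrite wtD in eu lT.
set c := P'@_m in cm R lm *; set c' := Q'@_m' in cm' R' lm' *.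
pose L := (c * c') *: T + (c *: 'X_[m]) * R' + R * Q'.
have lL : wt_lt (wt m + wt m') L.
  apply: wt_ltD; first apply: wt_ltD; first exact: wt_ltZ.
    rewrite mulrC addnC; apply: wt_ltM => //; apply: wt_ltZ; exact: wt_ltX.
  apply: wt_ltM => //; have -> : Q' = R' + c' *: 'X_[m'] by rewrite subrK.
  by apply: wt_ltD; [apply: wt_ltW lm'|apply: wt_ltZ; exact: wt_ltX].
have [L' [lL' nL' vL']] := normal_form lL.
have vE : vanishes ((c * c') *: 'X_[u] + L').
  have -> : (c * c') *: 'X_[u] + L' = P * Q - P * (Q - Q') - Q' * (P - P')
     - (c * c') *: ('X_[m + m'] - 'X_[u] - T) - (L - L').
    have eP : P' = R + c *: 'X_[m] by rewrite subrK.
    have eQ : Q' = R' + c' *: 'X_[m'] by rewrite subrK.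
    rewrite /L; move: eP eQ; rewrite mpolyXD -!mul_mpolyC rmorphM /=.
    move=> -> ->; ring.
  do 2 ?apply: vanishesB => //; do ?apply: vanishesB => //; do ?exact: vanishesM; exact: vanishesZ.
(* A normal form of the product [P Q], hence zero if the product vanishes. *)
have E0 : (c * c') *: 'X_[u] + L' = 0.
  apply: normal_vanishes => // v /msuppD_le; rewrite mem_cat => /orP[/msuppZ_le|/nL' //].
  by rewrite msuppX inE => /eqP ->.
have := congr1 (mcoeff u) E0; rewrite mcoeffD mcoeffZ mcoeffX eqxx mulr1 mcoeff0.
rewrite [L'@_u]memN_msupp_eq0 ?addr0 => [/eqP|].
  by rewrite mulf_eq0 (negPf cm) (negPf cm').
by apply/negP => /lL'; rewrite eu ltnn.
Qed.

(** Reading off the coefficients on each fibre leaves only the powers of [w] in the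
    normal form. *)
Lemma fiberwise_constant P :
  (forall x y x' y' w, on_curve x y w -> on_curve x' y' w ->
     P.@[vec3 x y w] = P.@[vec3 x' y' w]) ->
  exists c : {poly k}, forall x y w, on_curve x y w -> P.@[vec3 x y w] = c.[w].
Proof.
move=> PC; have [P' [nP' vP' _]] := vanishes_normal P.
exists (\sum_(m <- msupp P' | (m o0 == 0%N) && (m o1 == 0%N)) P'@_m *: 'X^(m o2)).
move=> x y w on; rewrite horner_sum.
under eq_bigr do rewrite hornerZ hornerXn.
rewrite (@normal_coef P' w P.@[vec3 x y w]) // => x' y' on'.
rewrite (PC x y x' y' w) //; apply/esym/eqP; rewrite -subr_eq0 -mevalB; apply/eqP.
exact: vP'.
Qed.

End Curve.

(** * The function field of the quotient curve *)

(** Every large degree is allowed, so that the two terms of a fraction can be given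
    the same degree; [f] is evaluation at a point where the [i]-th coordinate is
    [1]. *)
Lemma homogenize (R : comNzRingType) n (P : {mpoly R[n]}) (i : 'I_n) :
  exists d0, forall d, (d0 <= d)%N -> exists G : {mpoly R[n]}, G \is d.-homog /\
    forall (L : comNzRingType) (f : {rmorphism {mpoly R[n]} -> L}), f 'X_i = 1 -> f G = f P.
Proof.
exists (msize P) => d dP.
exists (\sum_(m <- msupp P) P@_m *: ('X_[m] * 'X_i ^+ (d - mdeg m))); split.
  rewrite big_seq; apply: rpred_sum => m mP; apply: rpredZ.
  have h : ('X_[m] * 'X_i ^+ (d - mdeg m) : {mpoly R[n]}) \is (mdeg m + 1 * (d - mdeg m)).-homog.
    apply: dhomogM; first by rewrite dhomogX.
    by apply: dhomogMn; rewrite dhomogX /= mdeg1.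
  move: h; rewrite mul1n subnKC //; apply: leq_trans dP; exact: ltnW (msize_mdeg_lt mP).
move=> L f fX; rewrite {3}(mpolyE P) !rmorph_sum; apply: eq_bigr => m _.
by rewrite -!mul_mpolyC !rmorphM rmorphXn fX expr1n mulr1.
Qed.

Section CurveField.
Variables (k : closedFieldType) (q s : nat).
Hypothesis q_gt1 : (1 < q)%N.
Hypothesis q_pchar : [pchar k].-nat q.
Hypothesis s_gt0 : (0 < s)%N.
Hypothesis s_coprime : coprime q s.
Local Notation onC := (@on_curve k q s).
Local Notation vanish := (@vanishes k q s).
Local Notation R3 := {mpoly k[3]}.

Lemma pchar_nat_eq0 : q%:R = 0 :> k.
Proof.
have pd : pdiv q \in [pchar k].
  by apply: (pnatP _ (ltnW q_gt1) q_pchar); rewrite ?pdiv_prime ?pdiv_dvd.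
by apply/eqP; rewrite -(dvdn_pcharf pd) pdiv_dvd.
Qed.
Let q_eq0 := pchar_nat_eq0.

Lemma frobD (a b : k) : (a + b) ^+ q = a ^+ q + b ^+ q.
Proof. exact: exprDn_pchar. Qed.

Lemma frobN (a : k) : (- a) ^+ q = - a ^+ q.
Proof.
apply/eqP; rewrite -subr_eq0 opprK -frobD addNr expr0n.
by case: (q) q_gt1.
Qed.

Lemma frobD2 (a b : k) : (a + b) ^+ (q ^ 2) = a ^+ (q ^ 2) + b ^+ (q ^ 2).
Proof. by rewrite !exprM !frobD. Qed.

(** The unipotent group of the Hermitian curve.  Its element [(b, c)] moves the
    origin to [(c, b)], so that the group is a copy of the fibre over [w = 0]. *)
Definition actx (g : k * k) (x y : k) := x + g.1 ^+ q * y + g.2.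
Definition acty (g : k * k) (y : k) := y + g.1.
Definition in_group (g : k * k) := onC g.2 g.1 0.

Lemma in_groupP g : in_group g <-> g.1 ^+ (q ^ 2) = g.1 /\ g.2 ^+ q + g.2 = g.1 ^+ q.+1.
Proof.
rewrite /in_group /on_curve expr0n eqn0Ngt s_gt0 /=; split; move=> [e1 e2]; split=> //.
  by apply/eqP; rewrite -subr_eq0 e2.
by rewrite e1 subrr.
Qed.

Lemma act_on_curve g x y w : in_group g -> onC x y w -> onC (actx g x y) (acty g y) w.
Proof.
move=> /in_groupP[b2 cb] [xy yw]; rewrite /actx /acty; split.
  rewrite !frobD exprMn -exprM mulnn b2.
  have -> : x ^+ q + g.1 * y ^+ q + g.2 ^+ q + (x + g.1 ^+ q * y + g.2) =
     (x ^+ q + x) + (g.2 ^+ q + g.2) + g.1 * y ^+ q + g.1 ^+ q * y by ring.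
  by rewrite xy cb !exprS frobD; ring.
by rewrite frobD2 b2 -yw; ring.
Qed.

Lemma act_transitive x y x' y' w : onC x y w -> onC x' y' w ->
  exists g, [/\ in_group g, actx g x y = x' & acty g y = y'].
Proof.
move=> [xy yw] [xy' yw'].
exists (y' - y, x' - x - (y' - y) ^+ q * y); split; rewrite /actx /acty /=.
- have b2 : (y' - y) ^+ (q ^ 2) = y' - y.
    rewrite frobD2 !exprM frobN frobN -!exprM mulnn.
    have -> : y' ^+ (q ^ 2) = y' + w ^+ s by rewrite -yw' addrC subrK.
    have -> : y ^+ (q ^ 2) = y + w ^+ s by rewrite -yw addrC subrK.
    ring.
  have [d dE] : exists d, d = y' - y by exists (y' - y).
  rewrite -dE in b2 *; have yE : y' = y + d by rewrite dE addrC subrK.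
  apply/in_groupP; split=> //=.
  rewrite !frobD !frobN exprMn -exprM mulnn b2.
  have -> : x' ^+ q - x ^+ q - d * y ^+ q + (x' - x - d ^+ q * y)
    = (x' ^+ q + x') - (x ^+ q + x) - d * y ^+ q - d ^+ q * y by ring.
  by rewrite xy xy' yE !exprS frobD; ring.
- ring.
- ring.
Qed.

Lemma act_inj g g' x y : actx g x y = actx g' x y -> acty g y = acty g' y -> g = g'.
Proof.
case: g g' => [b c] [b' c']; rewrite /actx /acty /= => ex /addrI eb.
by move: ex; rewrite eb => /addrI ->.
Qed.

Definition group_comp (g h : k * k) := (g.1 + h.1, actx h g.2 g.1).

Lemma group_comp_in g h : in_group g -> in_group h -> in_group (group_comp g h).
Proof. by move=> hg hh; exact: act_on_curve. Qed.

Lemma actx_comp g h x y : actx h (actx g x y) (acty g y) = actx (group_comp g h) x y.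
Proof. by rewrite /actx /acty /= /actx frobD; ring. Qed.

Lemma acty_comp g h y : acty h (acty g y) = acty (group_comp g h) y.
Proof. by rewrite /acty /= addrA. Qed.

Lemma group_id : in_group (0, 0).
Proof.
by apply/in_groupP; rewrite !expr0n /= expn_eq0 /= eqn0Ngt (ltnW q_gt1) addr0.
Qed.

Lemma fiber w : exists r : seq (k * k), [/\ uniq r, size r = (q ^ 3)%N &
  forall y x, ((y, x) \in r) <-> onC x y w].
Proof.
have [ys [uy sy yP]] := y_roots s q_gt1 q_eq0 w.
have [xs xsP] := choice (x_roots q_gt1 q_eq0).
exists [seq (y, x) | y <- ys, x <- xs y]; split.
- apply: allpairs_uniq_dep => //; first by move=> y _; have [] := xsP y.
  by move=> [y x] [y' x'] _ _ /= [-> ->].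
- rewrite size_allpairs_dep (eq_map (g := fun=> q)); last by move=> y; have [] := xsP y.
  by rewrite sumnE big_map big_const_seq count_predT iter_addn_0 sy; lia.
- move=> y x; have [_ _ xP] := xsP y; split.
    by case/allpairsPdep => y' [x' [+ + [-> ->]]]; rewrite yP;
       have [_ _ ->] := xsP y'; move=> /eqP ? /eqP.
  move=> [xy yw]; apply/allpairsPdep; exists y, x; rewrite yP xP; split=> //; exact/eqP.
Qed.

Definition act_mp (g : k * k) : 3.-tuple R3 :=
  [tuple 'X_o0 + (g.1 ^+ q) *: 'X_o1 + g.2%:MP; 'X_o1 + g.1%:MP; 'X_o2].

Lemma act_mp_eval g (P : R3) x y w :
  (P \mPo act_mp g).@[vec3 x y w] = P.@[vec3 (actx g x y) (acty g y) w].
Proof.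
rewrite comp_mpoly_meval; congr (P.@[_]); apply/funext.
by apply: ord3P; rewrite (tnth_nth 0) /= ?mevalD ?mevalZ ?mevalC ?mevalXU.
Qed.

Lemma act_mp_vanish g P : in_group g -> vanish (P \mPo act_mp g) <-> vanish P.
Proof.
move=> hg; split=> vP x y w on; last first.
  by rewrite act_mp_eval; apply: vP; exact: act_on_curve.
have [h [hh hx hy]] := act_transitive hg group_id.
have := vP _ _ _ (act_on_curve hh on); rewrite act_mp_eval.
suff [-> -> //] : actx g (actx h x y) (acty h y) = x /\ acty g (acty h y) = y.
rewrite actx_comp acty_comp.
case: g h {hg hh vP} hx hy => [b c] [b' c']; rewrite /actx /acty /= /actx => ex ey.
have {}ey : b' = - b by apply/eqP; rewrite -addr_eq0 addrC ey.
have {}ex : c' = - c - b' ^+ q * b.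
  by apply/eqP; rewrite -subr_eq0 -[X in _ == X]ex; apply/eqP; ring.
by rewrite ex ey addNr expr0n eqn0Ngt (ltnW q_gt1) /= frobN; split; ring.
Qed.

Definition poly_w (c : {poly k}) : R3 := (map_poly (@mpolyC 3 k) c).['X_o2].

Lemma poly_w_eval c x y w : (poly_w c).@[vec3 x y w] = c.[w].
Proof.
rewrite /poly_w; elim/poly_ind: c => [|c a IH].
  by rewrite rmorph0 !horner0 meval0.
rewrite rmorphD rmorphM /= map_polyX map_polyC !hornerE mevalD mevalM IH.
by rewrite mevalXU mevalC.
Qed.

Section Field.
Variables (K : fieldType) (phi : {rmorphism R3 -> K}).
Hypothesis phi_ker : forall P, phi P = 0 <-> vanish P.
Hypothesis phi_frac : forall a, exists P Q, phi Q != 0 /\ a = phi P / phi Q.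
Variables (K0 : fieldType) (phi0 : {rmorphism {poly k} -> K0}).
Hypothesis phi0_ker : forall c, phi0 c = 0 <-> c = 0.
Hypothesis phi0_frac : forall a, exists c d, phi0 d != 0 /\ a = phi0 c / phi0 d.

Lemma phi_eq P Q : (forall x y w, onC x y w -> P.@[vec3 x y w] = Q.@[vec3 x y w]) <->
  phi P = phi Q.
Proof.
split=> [e|/eqP].
  apply/eqP; rewrite -subr_eq0 -rmorphB; apply/eqP/phi_ker => x y w on.
  by rewrite mevalB e ?subrr.
rewrite -subr_eq0 -rmorphB => /eqP/phi_ker h x y w on.
by apply/eqP; rewrite -subr_eq0 -mevalB h.
Qed.

Lemma iota_exists : exists iota : {rmorphism K0 -> K}, forall c, iota (phi0 c) = phi (poly_w c).
Proof.
have cf : commr_rmorph (@mpolyC 3 k : {rmorphism k -> R3}) 'X_o2 by move=> x; exact: mulrC.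
pose psi : {rmorphism {poly k} -> K} := phi \o (horner_morph cf).
apply: (@extend_to_fractions _ _ _ phi0 psi phi0_frac) => c.
rewrite phi0_ker -[psi c]/(phi (poly_w c)) phi_ker; split=> [-> x y w _|v].
  by rewrite poly_w_eval horner0.
apply: poly_eq0_horner => w; have [x [y on]] := curve_over s q_gt1 q_eq0 w.
by rewrite -(poly_w_eval c x y); exact: v.
Qed.

Lemma conjugation_exists : exists F : k * k -> {rmorphism K -> K},
  forall g, in_group g -> forall P, F g (phi P) = phi (P \mPo act_mp g).
Proof.
have h (g : k * k) : exists f : {rmorphism K -> K}, in_group g ->
    forall P, f (phi P) = phi (P \mPo act_mp g).
  have [hg|hg] := pselect (in_group g); last by exists idfun.
  have [P|f fP] := @extend_to_fractions _ _ _ phi (phi \o comp_mpoly (act_mp g)) phi_frac.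
    by rewrite /= !phi_ker act_mp_vanish.
  by exists f.
by have [F FP] := choice h; exists F.
Qed.

Variables (iota : {rmorphism K0 -> K}) (F : k * k -> {rmorphism K -> K}).
Hypothesis iotaE : forall c, iota (phi0 c) = phi (poly_w c).
Hypothesis FE : forall g, in_group g -> forall P, F g (phi P) = phi (P \mPo act_mp g).
Variable G : seq (k * k).
Hypothesis G_uniq : uniq G.
Hypothesis G_size : size G = (q ^ 3)%N.
Hypothesis mem_G : forall g, g \in G <-> in_group g.

Lemma phi_poly_w_eq0 c : phi (poly_w c) = 0 -> c = 0.
Proof.
move/phi_ker => v; apply: poly_eq0_horner => w.
have [x [y on]] := curve_over s q_gt1 q_eq0 w.
by rewrite -(poly_w_eval c x y); exact: v.
Qed.

Lemma conj_poly_w g c : in_group g -> F g (phi (poly_w c)) = phi (poly_w c).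
Proof.
move=> hg; rewrite FE //; apply/phi_eq => x y w _; by rewrite act_mp_eval !poly_w_eval.
Qed.

Lemma conj_comp g h : g \in G -> h \in G ->
  exists2 l, l \in G & forall a, F g (F h a) = F l a.
Proof.
move=> /mem_G hg /mem_G hh; have hl := group_comp_in hg hh.
exists (group_comp g h); first exact/mem_G.
have e U : F g (F h (phi U)) = F (group_comp g h) (phi U).
  rewrite (FE hh) (FE hg) (FE hl).
  by apply/phi_eq => x y w on; rewrite !act_mp_eval actx_comp acty_comp.
by move=> a; have [P [Q [Q0 ->]]] := phi_frac a; rewrite !fmorph_div (e P) (e Q).
Qed.

Lemma conj_id : exists2 g, g \in G & forall a, F g a = a.
Proof.
exists (0, 0); first by apply/mem_G; exact: group_id.
have e U : F (0, 0) (phi U) = phi U.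
  rewrite (FE group_id); apply/phi_eq => x y w on.
  by rewrite act_mp_eval /actx /acty /= expr0n eqn0Ngt (ltnW q_gt1) mul0r !addr0.
by move=> a; have [P [Q [Q0 ->]]] := phi_frac a; rewrite fmorph_div (e P) (e Q).
Qed.

Lemma conj_iota g a : g \in G -> F g (iota a) = iota a.
Proof.
move=> /mem_G hg; have [c [d [d0 ->]]] := phi0_frac a.
by rewrite !fmorph_div !iotaE !conj_poly_w.
Qed.

Lemma phi_fiberwise P : (forall x y x' y' w, onC x y w -> onC x' y' w ->
    P.@[vec3 x y w] = P.@[vec3 x' y' w]) -> exists c, phi P = phi (poly_w c).
Proof.
move=> /(fiberwise_constant q_gt1 q_eq0 s_gt0 s_coprime)[c cP]; exists c.
by apply/phi_eq => x y w on; rewrite poly_w_eval; exact: cP.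
Qed.

Lemma orbit_perm x y w r : onC x y w -> uniq r -> size r = (q ^ 3)%N ->
  (forall y x, ((y, x) \in r) <-> onC x y w) ->
  perm_eq [seq (acty g y, actx g x y) | g <- G] r.
Proof.
move=> on ur sr rP.
have u : uniq [seq (acty g y, actx g x y) | g <- G].
  by rewrite map_inj_uniq // => g h [e1 e2]; exact: act_inj e2 e1.
have sub : {subset [seq (acty g y, actx g x y) | g <- G] <= r}.
  by move=> _ /mapP[g /mem_G hg ->]; apply/rP; exact: act_on_curve.
by have [|_ e] := uniq_min_size u sub; rewrite ?size_map ?G_size ?sr //; apply: uniq_perm.
Qed.

Lemma norm_in_base Q : exists c, phi (\prod_(g <- G) (Q \mPo act_mp g)) = phi (poly_w c).
Proof.
apply: phi_fiberwise => x y x' y' w on on'; have [r [ur sr rP]] := fiber w.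
suff h x1 y1 : onC x1 y1 w -> (\prod_(g <- G) (Q \mPo act_mp g)).@[vec3 x1 y1 w] =
    \prod_(u <- r) Q.@[vec3 u.2 u.1 w] by rewrite !h.
move=> on1; rewrite -(perm_big _ (orbit_perm on1 ur sr rP)) big_map rmorph_prod /=.
by apply: eq_bigr => g _; rewrite act_mp_eval.
Qed.

(** The denominator of a fraction can be made a norm, hence a function of [w]; if
    the fraction is fixed, its numerator is then constant on the fibres of [w]. *)
Lemma conj_fixed a : (forall g, g \in G -> F g a = a) -> exists c, a = iota c.
Proof.
move=> aF; have [P [Q [Q0 aE]]] := phi_frac a.
(* The cofactor of [Q] in its norm. *)
pose E := \prod_(g <- G | g != (0, 0)) (Q \mPo act_mp g).
have G0 : (0, 0) \in G by apply/mem_G; exact: group_id.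
have QE : phi (\prod_(g <- G) (Q \mPo act_mp g)) = phi Q * phi E.
  rewrite (bigD1_seq (0, 0)) //= rmorphM; congr (_ * _).
  apply/phi_eq => x y w on; rewrite act_mp_eval /actx /acty /= expr0n eqn0Ngt (ltnW q_gt1).
  by rewrite mul0r !addr0.
have [d dE] := norm_in_base Q.
have D0 : phi (poly_w d) != 0.
  rewrite -dE rmorph_prod prodf_seq_neq0; apply/allP => g /mem_G hg /=.
  by rewrite -FE // fmorph_eq0.
have nE : phi (P * E) = a * phi (poly_w d).
  by rewrite -dE QE rmorphM aE mulrA divfK.
have [c cE] : exists c, phi (P * E) = phi (poly_w c).
  apply: phi_fiberwise => x y x' y' w on on'.
  have [g [hg <- <-]] := act_transitive on on'; rewrite -act_mp_eval.
  apply: (phi_eq _ _).2 on => //; rewrite -FE // nE rmorphM conj_poly_w // aF //.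
  exact/mem_G.
exists (phi0 c / phi0 d); rewrite fmorph_div !iotaE -cE nE mulfK //.
Qed.

Theorem function_field_galois : galois_extension iota.
Proof.
exact: (artin_galois conj_comp conj_id conj_iota conj_fixed).
Qed.

Variable m : nat.
Hypothesis m_gt0 : (0 < m)%N.
Hypothesis m_neq0 : m%:R != 0 :> k.

Lemma linear_independent (a b c : k) :
  (forall x y w, onC x y w -> a * x + b * y + c = 0) -> [/\ a = 0, b = 0 & c = 0].
Proof.
move=> h; pose P : R3 := a *: 'X_[mon3 1 0 0] + b *: 'X_[mon3 0 1 0] + c *: 'X_[mon3 0 0 0].
have P0 : P = 0.
  (* The monomials [x], [y] and [1] are normal. *)
  apply: (normal_vanishes q_gt1 q_eq0 (s := s)).
    have qq : (1 < q ^ 2)%N by rewrite -[1%N](expn0 q) ltn_exp2l.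
    move=> u /msuppD_le; rewrite mem_cat => /orP[/msuppD_le|/msuppZ_le].
      rewrite mem_cat => /orP[] /msuppZ_le; rewrite msuppX inE => /eqP ->;
      by rewrite /normal !mon3E; lia.
    by rewrite msuppX inE => /eqP ->; rewrite /normal !mon3E; lia.
  move=> x y w on; rewrite !mevalD !mevalZ !evalX3 !mon3E -[RHS](h x y w on).
  by rewrite !expr0 !expr1; ring.
have ne (u v : 'X_{1..3}) i : u i != v i -> (u == v) = false.
  by move=> uv; apply/eqP => e; rewrite e eqxx in uv.
split.
- have := congr1 (mcoeff (mon3 1 0 0)) P0; rewrite !mcoeffD !mcoeffZ !mcoeffX mcoeff0 eqxx.
  by rewrite (@ne _ _ o0) ?mon3E // (@ne _ _ o0) ?mon3E // !mulr0 !addr0 mulr1.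
- have := congr1 (mcoeff (mon3 0 1 0)) P0; rewrite !mcoeffD !mcoeffZ !mcoeffX mcoeff0 eqxx.
  by rewrite (@ne _ _ o0) ?mon3E // (@ne _ _ o1) ?mon3E // !mulr0 !addr0 add0r mulr1.
- have := congr1 (mcoeff (mon3 0 0 0)) P0; rewrite !mcoeffD !mcoeffZ !mcoeffX mcoeff0 eqxx.
  by rewrite (@ne _ _ o0) ?mon3E // (@ne _ _ o1) ?mon3E // !mulr0 !add0r mulr1.
Qed.

(** If two conjugates of [x] have the same [m]-th power, they differ by a root of
    unity.  Both are of the form [x + b ^ q y + c], so by linear independence this
    root of unity is [1] and the group elements agree. *)
Lemma conj_power_inj : {in G &, injective (fun g => F g (phi ('X_o0 ^+ m)))}.
Proof.
move=> g h /mem_G hg /mem_G hh; rewrite !FE // !rmorphXn /= => e.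
have [z zm] := prim_root_exists m_gt0 m_neq0.
pose X u : R3 := ('X_o0 : R3) \mPo act_mp u.
have X0 u : in_group u -> phi (X u) != 0.
  move=> hu; apply/eqP => /phi_ker v.
  have [] := linear_independent (a := 1) (b := u.1 ^+ q) (c := u.2).
    by move=> x y w on; rewrite mul1r; have := v x y w on; rewrite act_mp_eval mevalXU.
  by move/eqP; rewrite oner_eq0.
pose zeta : {rmorphism k -> K} := phi \o @mpolyC 3 k.
have zm' : m.-primitive_root (zeta z) by rewrite fmorph_primitive_root.
have [i ui] : {i : 'I_m | phi (X g) / phi (X h) = zeta z ^+ i}.
  apply: (prim_rootP zm'); have {}e : phi (X g) ^+ m = phi (X h) ^+ m := e.
  rewrite expr_div_n e; apply: divff; apply: expf_neq0; exact: X0.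
have {ui} /phi_eq E : phi (X g) = phi ((z ^+ i)%:MP * X h).
  have -> : phi (X g) = zeta z ^+ i * phi (X h).
    by rewrite -ui; symmetry; apply: divfK; exact: X0.
  by rewrite -(rmorphXn zeta); symmetry; exact: (rmorphM phi).
case: g h hg hh e E => [b c] [b' c'] _ _ _ E.
have [] := @linear_independent (1 - z ^+ i) (b ^+ q - z ^+ i * b' ^+ q) (c - z ^+ i * c').
  move=> x y w on; have := E x y w on; rewrite mevalM mevalC !act_mp_eval !mevalXU /vec3 /=.
  by rewrite /actx /= => /eqP; rewrite -subr_eq0 => /eqP <-; ring.
move/eqP; rewrite subr_eq0 => /eqP <-; rewrite !mul1r => bb cc.
congr (_, _); last by apply/eqP; rewrite -subr_eq0 cc.
have : (b - b') ^+ q = 0 by rewrite frobD frobN.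
by move/eqP; rewrite expf_eq0 subr_eq0 => /andP[_ /eqP].
Qed.

(** The coordinates [(1 : x ^ m : w)] of the generic point of the plane curve. *)
Definition plane_tuple : 3.-tuple R3 := [tuple 1; 'X_o0 ^+ m; 'X_o2].
Definition phi_plane : {rmorphism R3 -> K} := phi \o comp_mpoly plane_tuple.

Lemma plane_tuple_eval (P : R3) x y w :
  (P \mPo plane_tuple).@[vec3 x y w] = P.@[vec3 1 (x ^+ m) w].
Proof.
rewrite comp_mpoly_meval; congr (P.@[_]); apply/funext.
by apply: ord3P; rewrite (tnth_nth 0) /= ?meval1 ?rmorphXn /= ?mevalXU.
Qed.

Lemma phi_planeE P : phi_plane P = 0 <->
  forall x y w, onC x y w -> P.@[vec3 1 (x ^+ m) w] = 0.
Proof.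
rewrite /phi_plane /= phi_ker; split=> v x y w on; have := v x y w on;
  by rewrite plane_tuple_eval.
Qed.

Lemma phi_planeX : (phi_plane 'X_o0 = 1) * (phi_plane 'X_o1 = phi ('X_o0 ^+ m)) *
  (phi_plane 'X_o2 = phi 'X_o2).
Proof. by rewrite /phi_plane /= !comp_mpolyXU /= rmorph1. Qed.

Let plane_ratio a := exists P Q, phi_plane Q != 0 /\ a = phi_plane P / phi_plane Q.

Lemma plane_ratio_phi P : plane_ratio (phi_plane P).
Proof. by exists P, 1; rewrite rmorph1 divr1 oner_neq0. Qed.

Lemma plane_ratioD a b : plane_ratio a -> plane_ratio b -> plane_ratio (a + b).
Proof.
move=> [P [Q [Q0 ->]]] [P' [Q' [Q'0 ->]]]; exists (P * Q' + P' * Q), (Q * Q').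
by rewrite rmorphD !rmorphM mulf_neq0 // addf_div.
Qed.

Lemma plane_ratioM a b : plane_ratio a -> plane_ratio b -> plane_ratio (a * b).
Proof.
move=> [P [Q [Q0 ->]]] [P' [Q' [Q'0 ->]]]; exists (P * P'), (Q * Q').
by rewrite !rmorphM mulf_neq0 // mulf_div.
Qed.

Lemma plane_ratioV a : plane_ratio a -> plane_ratio a^-1.
Proof.
move=> [P [Q [Q0 ->]]]; have [P0|P0] := eqVneq (phi_plane P) 0.
  by rewrite P0 mul0r invr0 -(rmorph0 phi_plane); exact: plane_ratio_phi.
by exists Q, P; rewrite invf_div.
Qed.

Lemma plane_ratio_poly_w c : plane_ratio (phi (poly_w c)).
Proof.
rewrite (_ : phi (poly_w c) = phi_plane (poly_w c)); first exact: plane_ratio_phi.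
by apply/phi_eq => x y w _; rewrite plane_tuple_eval !poly_w_eval.
Qed.

Lemma plane_ratio_horner p : plane_ratio (map_poly iota p).[phi ('X_o0 ^+ m)].
Proof.
rewrite horner_coef; elim/big_ind: _ => [|a b|i _].
- by rewrite -(rmorph0 phi_plane); exact: plane_ratio_phi.
- exact: plane_ratioD.
apply: plane_ratioM; last first.
  by rewrite -phi_planeX.1.2 -rmorphXn; exact: plane_ratio_phi.
rewrite coef_map /=; have [c [d [d0 ->]]] := phi0_frac p`_i.
rewrite fmorph_div !iotaE; apply: plane_ratioM; last apply: plane_ratioV;
  exact: plane_ratio_poly_w.
Qed.

(** The conjugates of [x ^ m] over [k(w)] are distinct, so that [x ^ m] and [w]
    generate the function field. *)
Lemma plane_birational a : exists P Q, phi_plane Q != 0 /\ a = phi_plane P / phi_plane Q.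
Proof.
have [p [r [_ ->]]] := rational_in_primitive conj_comp conj_id conj_fixed G_uniq conj_power_inj a.
apply: plane_ratioM; last apply: plane_ratioV; exact: plane_ratio_horner.
Qed.

Lemma plane_homogeneous_ratio a : exists d (P Q : R3),
  [/\ P \is d.-homog, Q \is d.-homog, phi_plane Q != 0 & a = phi_plane P / phi_plane Q].
Proof.
have [P [Q [Q0 ->]]] := plane_birational a.
have [d1 h1] := homogenize P o0; have [d2 h2] := homogenize Q o0.
have [P' [hP eP]] := h1 (maxn d1 d2) (leq_maxl _ _).
have [Q' [hQ eQ]] := h2 (maxn d1 d2) (leq_maxr _ _).
by exists (maxn d1 d2), P', Q'; rewrite eP ?eQ ?phi_planeX.
Qed.

(** A form vanishing on the plane curve restricts on the line through
    [(0 : 1 : 0)] with slope [w] to a polynomial having the [q ^ 3] conjugates of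
    [x ^ m] as roots, while its degree drops because the form vanishes at
    [(0 : 1 : 0)]. *)
Lemma plane_degree d (P : R3) : P \is d.-homog -> P != 0 -> phi_plane P = 0 ->
  P.@[vec3 0 1 0] = 0 -> (q ^ 3 < d)%N.
Proof.
move=> /dhomogP hP P0 vP P010; rewrite ltnNge; apply/negP => dq; move/eqP: P0; apply.
pose zeta : {rmorphism k -> K} := phi \o @mpolyC 3 k.
pose w := phi 'X_o2; pose t := phi ('X_o0 ^+ m).
(* The restriction of [P] to the generic line through [(0 : 1 : 0)]. *)
pose g : {poly K} := \sum_(u <- msupp P) (zeta P@_u * w ^+ u o2) *: 'X^(u o1).
have zetaF h c : h \in G -> F h (zeta c) = zeta c.
  move=> /mem_G hh; have -> : zeta c = phi (poly_w c%:P).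
    by apply/phi_eq => x y v _; rewrite poly_w_eval hornerC mevalC.
  exact: conj_poly_w.
have wF h : h \in G -> F h w = w.
  move=> /mem_G hh; have -> : w = phi (poly_w 'X).
    by apply/phi_eq => x y v _; rewrite poly_w_eval hornerX mevalXU.
  exact: conj_poly_w.
have gF h : h \in G -> g.[F h t] = F h g.[t].
  move=> hG; rewrite /g !horner_sum rmorph_sum; apply: eq_bigr => u _.
  by rewrite !hornerZ !hornerXn !rmorphM !rmorphXn /= zetaF // wF.
have gt : g.[t] = 0.
  rewrite -vP [in RHS](mpolyE P) rmorph_sum /g horner_sum; apply: eq_bigr => u _.
  rewrite hornerZ hornerXn -mul_mpolyC rmorphM mpolyXE_id big3 !rmorphM !rmorphXn.
  rewrite !phi_planeX expr1n mul1r -mulrA; congr (_ * _); last by rewrite mulrC.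
  by rewrite /zeta /phi_plane /= comp_mpolyC.
have md u : u \in msupp P -> (u o1 < d)%N.
  move=> uP; have /= := hP u uP; rewrite mdegE big3 /= => ud.
  rewrite ltn_neqAle -{2}ud addnCA leq_addr andbT; apply/eqP => u1.
  have e0 : u o0 = 0%N by move: ud; rewrite -u1; lia.
  have e2 : u o2 = 0%N by move: ud; rewrite -u1; lia.
  have : P@_u = 0; last by apply/eqP; rewrite -mcoeff_msupp.
  rewrite -P010 eval3E (big_rem u uP) /= e0 e2 !expr0 expr1n !mulr1.
  rewrite big1_seq ?addr0 // => v /=; rewrite mem_rem_uniq ?msupp_uniq // inE => /andP[vu vP'].
  have /= := hP v vP'; rewrite mdegE big3 /= => vd.
  rewrite !expr0n; have [v0|] := eqVneq (v o0) 0%N; last by rewrite !mul0r mulr0.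
  have [v2|] := eqVneq (v o2) 0%N; last by rewrite !mulr0.
  by case/eqP: vu; apply: mnm3P; rewrite ?e0 ?e2 // u1; move: vd; rewrite v0 v2; lia.
have g0 : g = 0.
  apply: (@roots_geq_poly_eq0 _ _ [seq F h t | h <- G]).
  - by apply/allP => _ /mapP[h hG ->]; rewrite /root gF // gt rmorph0.
  - by rewrite map_inj_in_uniq //; exact: conj_power_inj.
  rewrite size_map G_size; apply: leq_trans dq; rewrite /g big_seq.
  elim/big_ind: _ => [|p1 p2 h1 h2|u uP]; first by rewrite size_poly0.
    by apply: (leq_trans (size_polyD _ _)); rewrite geq_max h1.
  by apply: (leq_trans (size_scale_leq _ _)); rewrite size_polyXn md.
apply/mpolyP => u; rewrite mcoeff0; have [uP|/memN_msupp_eq0 //] := boolP (u \in msupp P).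
have c0 : \sum_(v <- [seq v : 'X_{1..3} <- msupp P | v o1 == u o1]) P@_v *: 'X^(v o2) = 0 :> {poly k}.
  apply: phi_poly_w_eq0; have := congr1 (fun p : {poly K} => p`_(u o1)) g0.
  rewrite /g poly_sum_coef coef0 => <-; rewrite big_filter.
  have cf : commr_rmorph (@mpolyC 3 k : {rmorphism k -> R3}) 'X_o2 by move=> x; exact: mulrC.
  rewrite -[phi _]/((phi \o (horner_morph cf)) _) rmorph_sum; apply: eq_bigr => v _.
  rewrite -mul_polyC rmorphM rmorphXn /= horner_morphX; congr (_ * _).
  by rewrite horner_morphC.
have := congr1 (fun p : {poly k} => p`_(u o2)) c0; rewrite coef0 poly_sum_coef.
rewrite big_filter_cond (big_rem u uP) /= !eqxx /= big1_seq ?addr0 // => v /=.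
rewrite mem_rem_uniq ?msupp_uniq // inE => /andP[/andP[/eqP e1 /eqP e2] /andP[vu vP']].
case/eqP: vu; apply: mnm3P => //.
have /= := hP v vP'; have /= := hP u uP; rewrite !mdegE !big3 /= e1 e2; lia.
Qed.

End Field.
End CurveField.

(** * The points of the Giulietti-Korchmaros curve *)

Section GKPoints.
Variables (k : closedFieldType) (q : nat).
Hypothesis q_gt1 : (1 < q)%N.
Hypothesis q_pchar : [pchar k].-nat q.
Local Notation N := (q ^ 2 - q + 1)%N.
Local Notation onX := (@on_curve k q N).
Local Notation R3 := {mpoly k[3]}.
Local Notation R4 := {mpoly k[4]}.
Let q_eq0 := pchar_nat_eq0 q_gt1 q_pchar.
Let fD := frobD q_pchar.
Let fN := frobN q_gt1 q_pchar.

Lemma GK_exponentE : (N + q = q ^ 2 + 1)%N.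
Proof. by rewrite addnAC subnK // -{1}[q]expn1 leq_exp2l. Qed.

Lemma coprime_GK_exponent : coprime q N.
Proof.
have -> : N = ((q - 1) * q + 1)%N by rewrite mulnBl mul1n mulnn.
by rewrite /coprime -gcdn_modr modnMDl modn_small // gcdn1.
Qed.

Lemma GK_exponent_gt0 : (0 < N)%N. Proof. by rewrite addn1. Qed.

(** In this form the curve is a cyclic cover of the Hermitian curve; the exponents
    match because [(q + 1) (q - 1) + 1 = q ^ 2]. *)
Lemma GK_equation (x y z : k) : x ^+ q + x - y ^+ q.+1 = 0 ->
  (y * ((x ^+ q + x) ^+ (q - 1) - 1) - z ^+ N = 0) <-> (y ^+ (q ^ 2) - y = z ^+ N).
Proof.
move=> /eqP; rewrite subr_eq0 => /eqP ->.
have -> : y * ((y ^+ q.+1) ^+ (q - 1) - 1) = y ^+ (q ^ 2) - y.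
  rewrite mulrBr mulr1 -exprM -exprS; congr (y ^+ _ - y).
  by have := q_gt1; case: (q) => // n _; rewrite subn1 /=; lia.
by split=> [/eqP|->]; rewrite ?subrr // subr_eq0 => /eqP.
Qed.

(** A lift of the involution of the Hermitian curve that exchanges the origin and
    the point at infinity. *)
Lemma GK_involution (x y z : k) : x != 0 -> onX x y z -> onX x^-1 (- (y / x)) (z / x).
Proof.
move=> x0 [e1 e2]; have xq : x ^+ q = y * y ^+ q - x by rewrite -exprS -e1 addrK.
have x2 : x ^+ (q ^ 2) = x - y * y ^+ q + y ^+ q * y ^+ (q ^ 2).
  by rewrite -mulnn !exprM xq fD fN exprMn {1}xq; ring.
split.
  rewrite exprS fN mulrNN exprMn exprVn mulrACA -invfM -exprS -e1.
  by rewrite invfM mulrDl mulrCA mulfV ?expf_neq0 // mulr1 mulrA mulfV // mul1r addrC.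
have -> : (- (y / x)) ^+ (q ^ 2) = - (y ^+ (q ^ 2) / x ^+ (q ^ 2)).
  by rewrite -mulnn !exprM !fN -!exprM expr_div_n.
rewrite opprK expr_div_n -e2 addrC -mulNr addf_div ?expf_neq0 //.
have xN : x ^+ N * x ^+ q = x ^+ (q ^ 2) * x by rewrite -exprD GK_exponentE exprD.
apply/eqP; rewrite eqr_div ?mulf_neq0 ?expf_neq0 // [x * _]mulrC -xN; apply/eqP.
by rewrite x2 xq; ring.
Qed.

Definition u0 : 'I_4 := @Ordinal 4 0 isT.
Definition u1 : 'I_4 := @Ordinal 4 1 isT.
Definition u2 : 'I_4 := @Ordinal 4 2 isT.
Definition u3 : 'I_4 := @Ordinal 4 3 isT.

Lemma ord4P (P : 'I_4 -> Prop) : P u0 -> P u1 -> P u2 -> P u3 -> forall i, P i.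
Proof.
move=> P0 P1 P2 P3 [[|[|[|[|//]]]] h].
- by rewrite (_ : Ordinal h = u0) //; apply: val_inj.
- by rewrite (_ : Ordinal h = u1) //; apply: val_inj.
- by rewrite (_ : Ordinal h = u2) //; apply: val_inj.
- by rewrite (_ : Ordinal h = u3) //; apply: val_inj.
Qed.

Lemma row4_coords (v : 'rV[k]_4) : v = row4 (v 0 u0) (v 0 u1) (v 0 u2) (v 0 u3).
Proof. by apply/rowP; apply: ord4P; rewrite mxE. Qed.

Lemma row4_eq0 (a b c d : k) : (row4 a b c d == 0) = [&& a == 0, b == 0, c == 0 & d == 0].
Proof.
apply/eqP/and4P => [e|[/eqP-> /eqP-> /eqP-> /eqP->]].
  have h i : row4 a b c d 0 i = 0 by rewrite e mxE.
  by have := (h u0, h u1, h u2, h u3); rewrite !mxE /= => -[[[-> ->] ->] ->].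
by apply/rowP; apply: ord4P; rewrite !mxE.
Qed.

Lemma row4_scale (l a b c d : k) : l *: row4 a b c d = row4 (l * a) (l * b) (l * c) (l * d).
Proof. by apply/rowP; apply: ord4P; rewrite !mxE. Qed.

Lemma row4_1neq0 x y z : row4 1 x y z != 0 :> 'rV[k]_4.
Proof. by rewrite row4_eq0 oner_eq0. Qed.

Definition affine_pt (x y z : k) : pt k 3 := pt_of (row4 1 x y z).
Definition infinity_pt : pt k 3 := pt_of (row4 0 1 0 0).

Lemma infinity_neq0 : row4 0 1 0 0 != 0 :> 'rV[k]_4.
Proof. by rewrite row4_eq0 oner_eq0 andbF. Qed.

Lemma GK_affineE x y z : onX x y z -> GK_affine q (affine_pt x y z).
Proof.
move=> [e1 e2]; have e1' : x ^+ q + x - y ^+ q.+1 = 0 by rewrite e1 subrr.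
by exists x, y, z; split=> //; apply/(GK_equation _ e1').
Qed.

Lemma GK_affineP (P : pt k 3) : GK_affine q P -> exists x y z, P = affine_pt x y z /\ onX x y z.
Proof.
move=> [x [y [z [-> e1 e2]]]]; exists x, y, z; split=> //.
split; last exact/(GK_equation _ e1).
by move/eqP: e1; rewrite subr_eq0 => /eqP.
Qed.

Lemma GK_affine_points (P : pt k 3) : GK_affine q P -> GK_points q P.
Proof. by move=> aP Z _; apply. Qed.

(** The homogenized equations; they have the point [(0 : 1 : 0 : 0)] as only common
    zero at infinity. *)
Definition GK_form1 : R4 :=
  'X_u1 ^+ q * 'X_u0 + 'X_u1 * 'X_u0 ^+ q - 'X_u2 ^+ q.+1.
Definition GK_form2 : R4 :=
  'X_u2 * (('X_u1 ^+ q + 'X_u1 * 'X_u0 ^+ (q - 1)) ^+ (q - 1) - 'X_u0 ^+ (q * (q - 1)))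
  - 'X_u3 ^+ N.

Lemma homogX n (i : 'I_n) : ('X_i : {mpoly k[n]}) \is 1.-homog.
Proof. by rewrite dhomogX /= mdeg1. Qed.

Lemma homogXn n (i : 'I_n) d : ('X_i ^+ d : {mpoly k[n]}) \is d.-homog.
Proof. by rewrite -[X in X.-homog]mul1n; apply: dhomogMn; exact: homogX. Qed.

Lemma GK_form1_homog : GK_form1 \is q.+1.-homog.
Proof.
apply: rpredB; last exact: homogXn; apply: rpredD.
  by rewrite -[q.+1]addn1; apply: dhomogM; [exact: homogXn|exact: homogX].
by rewrite -[q.+1]add1n; apply: dhomogM; [exact: homogX|exact: homogXn].
Qed.

Lemma GK_form2_homog : GK_form2 \is N.-homog.
Proof.
apply: rpredB; last exact: homogXn.
have -> : N = (1 + q * (q - 1))%N by rewrite mulnBr muln1 mulnn addnC.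
apply: dhomogM; first exact: homogX.
apply: rpredB; last exact: homogXn.
apply: dhomogMn; apply: rpredD; first exact: homogXn.
have h : ('X_u1 * 'X_u0 ^+ (q - 1) : R4) \is (1 + (q - 1)).-homog.
  by apply: dhomogM; [exact: homogX|exact: homogXn].
by move: h; rewrite subnKC // ltnW.
Qed.

Definition mevalsimp := (mevalB, mevalD, mevalM, mevalXU, mevalC).

Lemma GK_form1_eval a b c d : heval GK_form1 (row4 a b c d) =
  b ^+ q * a + b * a ^+ q - c ^+ q.+1.
Proof. by rewrite /heval /GK_form1 !mevalsimp !rmorphXn /= !mevalXU !mxE. Qed.

Lemma GK_form2_eval a b c d : heval GK_form2 (row4 a b c d) =
  c * ((b ^+ q + b * a ^+ (q - 1)) ^+ (q - 1) - a ^+ (q * (q - 1))) - d ^+ N.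
Proof.
by rewrite /heval /GK_form2 !(mevalsimp, rmorphXn) /= !(mevalsimp, rmorphXn) /= !mevalXU !mxE.
Qed.

Lemma GK_points_form (P : pt k 3) d (F : R4) : GK_points q P -> F \is d.-homog ->
  (forall x y z, onX x y z -> heval F (row4 1 x y z) = 0) -> heval F (coords P) = 0.
Proof.
move=> gP hF vF; apply: (gP [set Q | peval F Q = 0]).
  exists [set F]; first by move=> _ ->; exists d.
  by apply/seteqP; split=> Q /= h; [move=> _ ->|exact: h].
move=> _ /GK_affineP[x [y [z [-> on]]]]; apply/eqP.
by rewrite (peval_eq0 (row4_1neq0 _ _ _) hF) vF.
Qed.

Lemma GK_points_cases (P : pt k 3) : GK_points q P ->
  (exists x y z, P = affine_pt x y z /\ onX x y z) \/ P = infinity_pt.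
Proof.
move=> gP; have f1 := GK_points_form gP GK_form1_homog.
have f2 := GK_points_form gP GK_form2_homog.
have {}f1 : heval GK_form1 (coords P) = 0.
  apply: f1 => x y z [e1 _]; by rewrite GK_form1_eval expr1n !mulr1 e1 subrr.
have {}f2 : heval GK_form2 (coords P) = 0.
  apply: f2 => x y z [e1 e2]; rewrite GK_form2_eval !expr1n !mulr1; apply/GK_equation => //.
  by rewrite e1 subrr.
have nz := coords_neq0 P; have PE := pt_of_coords P.
rewrite (row4_coords (coords P)) in f1 f2 nz PE.
move: (coords P 0 u0) (coords P 0 u1) (coords P 0 u2) (coords P 0 u3) f1 f2 nz PE.
move=> a b c d f1 f2 nz PE; have [a0|a0] := eqVneq a 0.
  right; move: f1 f2; rewrite a0 GK_form1_eval GK_form2_eval mulr0 !expr0n.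
  have q0 : (q == 0)%N = false by case: (q) q_gt1.
  rewrite q0 mulr0 add0r sub0r => /eqP; rewrite oppr_eq0 expf_eq0 /= => /eqP c0.
  rewrite c0 mul0r sub0r => /eqP; rewrite oppr_eq0 expf_eq0 addn1 /= => /eqP d0.
  rewrite -PE a0 c0 d0; apply/eq_pt_of; [|exact: infinity_neq0|].
    by move: nz; rewrite a0 c0 d0.
  exists b; last by rewrite row4_scale !mulr0 mulr1.
  by move: nz; rewrite row4_eq0 a0 c0 d0 !eqxx /= andbT.
left; have E : row4 a b c d = a *: row4 1 (b / a) (c / a) (d / a).
  by rewrite row4_scale mulr1 !mulrA ![a * _]mulrC !mulfK.
exists (b / a), (c / a), (d / a); split.
  by rewrite -PE; apply/eq_pt_of => //; [exact: row4_1neq0|exists a].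
move: f1 f2; rewrite E (heval_scale _ _ GK_form1_homog) (heval_scale _ _ GK_form2_homog).
move=> /eqP; rewrite mulf_eq0 expf_eq0 (negPf a0) andbF /= GK_form1_eval expr1n !mulr1 => /eqP e1.
move=> /eqP; rewrite mulf_eq0 expf_eq0 (negPf a0) andbF /= GK_form2_eval !expr1n !mulr1 => /eqP.
move/(GK_equation _ e1) => e2; split=> //.
by move/eqP: e1; rewrite subr_eq0 => /eqP.
Qed.

Definition tuple4 (a b c d : R3) : 4.-tuple R3 := [tuple a; b; c; d].

Lemma tuple4_eval a b c d (F : R4) v :
  (F \mPo tuple4 a b c d).@[v] = heval F (row4 a.@[v] b.@[v] c.@[v] d.@[v]).
Proof.
rewrite comp_mpoly_meval /heval; congr (F.@[_]); apply/funext.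
by apply: ord4P; rewrite (tnth_nth 0) mxE.
Qed.

Lemma origin_on_curve : onX 0 0 0.
Proof.
have q0 : (q == 0)%N = false by case: (q) q_gt1.
by split; rewrite !expr0n ?q0 ?addr0 //= addn1 /= expn_eq0 q0 /= subr0.
Qed.

(** A form vanishing at the affine points vanishes at infinity, by continuity
    carried to the origin through the involution that exchanges these points. *)
Lemma form_at_infinity d (F : R4) : F \is d.-homog ->
  (forall x y z, onX x y z -> heval F (row4 1 x y z) = 0) -> heval F (row4 0 1 0 0) = 0.
Proof.
move=> hF vF; pose Q : R3 := F \mPo tuple4 'X_o0 1 (- 'X_o1) 'X_o2.
have QE x y z : Q.@[vec3 x y z] = heval F (row4 x 1 (- y) z).
  by rewrite tuple4_eval mevalN !mevalXU meval1.
have v : vanishes q N ('X_o0 * Q).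
  move=> x y z on; rewrite mevalM mevalXU /= QE.
  have [->|x0] := eqVneq x 0; first by rewrite mul0r.
  have -> : row4 x 1 (- y) z = x *: row4 1 x^-1 (- (y / x)) (z / x).
    by rewrite row4_scale mulr1 mulfV // mulrN !mulrA ![x * _]mulrC !mulfK.
  by rewrite (heval_scale _ _ hF) vF ?mulr0 //; exact: GK_involution.
have [vX|vQ] := vanishes_prime q_gt1 q_eq0 GK_exponent_gt0 coprime_GK_exponent v.
  have /eqP : ('X_o0 : R3) = 0.
    apply: (normal_vanishes q_gt1 q_eq0 (s := N)) => // u.
    rewrite msuppX inE => /eqP ->; rewrite /normal !mnm1E /=.
    by rewrite q_gt1 expn_gt0 (ltnW q_gt1).
  by rewrite -msupp_eq0 msuppX.
by have := vQ 0 0 0 origin_on_curve; rewrite QE oppr0.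
Qed.

Lemma infinity_in_GK : GK_points q infinity_pt.
Proof.
move=> Z [E hE ->] sub F EF; have [d hF] := hE _ EF; apply/eqP.
rewrite (peval_eq0 infinity_neq0 hF); apply/eqP/(form_at_infinity hF) => x y z on.
apply/eqP; rewrite -(peval_eq0 (row4_1neq0 _ _ _) hF); apply/eqP.
exact: (sub _ (GK_affineE on)).
Qed.

Lemma GK_points_affine x y z : onX x y z -> GK_points q (affine_pt x y z).
Proof. by move/GK_affineE/GK_affine_points. Qed.

Section Coordinates.
Variables (K : fieldType) (phi : {rmorphism R3 -> K}).
Hypothesis phi_ker : forall P, phi P = 0 <-> vanishes q N P.

Definition phi_GK : {rmorphism R4 -> K} := phi \o comp_mpoly (tuple4 1 'X_o0 'X_o1 'X_o2).

Lemma phi_GK_ker d (G : R4) : G \is d.-homog ->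
  (phi_GK G = 0 <-> forall P : GK_curve k q, peval G (sval P) = 0).
Proof.
move=> hG; rewrite /phi_GK /= phi_ker; split.
  move=> v [P gP] /=; apply: (GK_points_form gP hG) => x y z on.
  by have := v x y z on; rewrite tuple4_eval !mevalXU meval1.
move=> v x y z on; rewrite tuple4_eval !mevalXU meval1 /=; apply/eqP.
rewrite -(peval_eq0 (row4_1neq0 _ _ _) hG).
by apply/eqP; exact: (v (exist _ _ (GK_points_affine on))).
Qed.
End Coordinates.
End GKPoints.

(** * Subgroups of the cyclic group *)

Lemma to_orbit_eq (T : Type) (H G : set (T -> T)) (P P' : T) : is_subgroup H G ->
  to_orbit H P = to_orbit H P' <-> exists2 h, H h & h P = P'.
Proof.
case=> _ Hid Hcomp Hinv; split.
  move=> /(congr1 sval) /= e; have : orbit_of H P' P' by exists id.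
  by rewrite -e => -[h Hh <-]; exists h.
case=> h Hh hP; apply: eq_exist; apply/seteqP; split=> Q [s Hs <-].
  have [t Ht [ht _]] := Hinv _ Hh; exists (s \o t); first exact: Hcomp.
  by rewrite /= -hP ht.
by exists (s \o h); [exact: Hcomp|rewrite /= hP].
Qed.

Section CyclicGroup.
Variables (k : closedFieldType) (q : nat).
Hypothesis q_gt1 : (1 < q)%N.
Hypothesis q_pchar : [pchar k].-nat q.
Local Notation N := (q ^ 2 - q + 1)%N.
Local Notation onX := (@on_curve k q N).

Definition rotate (zeta : k) (P : pt k 3) : pt k 3 :=
  pt_of (coords P *m diag_mx (row4 1 1 1 zeta)).

Lemma row4_diag (a b c d zeta : k) :
  row4 a b c d *m diag_mx (row4 1 1 1 zeta) = row4 a b c (zeta * d).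
Proof.
by apply/rowP; apply: ord4P; rewrite mul_mx_diag !mxE /= ?mulr1 // mulrC.
Qed.

Lemma rotate_affine zeta x y z : rotate zeta (affine_pt x y z) = affine_pt x y (zeta * z).
Proof.
have [c c0 cE] := coords_pt_of (row4_1neq0 x y z).
have := row4_1neq0 x y (zeta * z) => nz.
rewrite /rotate cE -scalemxAl row4_diag; apply/eq_pt_of => //; last by exists c.
by rewrite scaler_eq0 (negPf c0).
Qed.

Lemma rotate_infinity zeta : rotate zeta (infinity_pt k) = infinity_pt k.
Proof.
have [c c0 cE] := coords_pt_of (infinity_neq0 k).
rewrite /rotate cE -scalemxAl row4_diag mulr0; apply/eq_pt_of.
- by rewrite scaler_eq0 (negPf c0) (negPf (infinity_neq0 k)).
- exact: infinity_neq0.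
- by exists c.
Qed.

Lemma rotateM a b (P : GK_curve k q) : rotate a (rotate b (sval P)) = rotate (b * a) (sval P).
Proof.
case: P => P gP /=; have [[x [y [z [-> _]]]]|->] := GK_points_cases q_gt1 gP.
  by rewrite !rotate_affine mulrA [a * b]mulrC.
by rewrite !rotate_infinity.
Qed.

Lemma rotate1 (P : GK_curve k q) : rotate 1 (sval P) = sval P.
Proof.
case: P => P gP /=; have [[x [y [z [-> _]]]]|->] := GK_points_cases q_gt1 gP.
  by rewrite rotate_affine mul1r.
by rewrite rotate_infinity.
Qed.

Lemma GK_exponent_neq0 : N%:R != 0 :> k.
Proof.
have pd : pdiv q \in [pchar k].
  by apply: (pnatP _ (ltnW q_gt1) q_pchar); rewrite ?pdiv_prime ?pdiv_dvd.
rewrite -(dvdn_pcharf pd); apply/negP => dv.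
have := coprime_GK_exponent q_gt1; rewrite /coprime => /eqP g1.
have : (pdiv q %| gcdn q N)%N by rewrite dvdn_gcd pdiv_dvd.
by rewrite g1 dvdn1; have := pdiv_prime q_gt1; case: (pdiv q) => [|[]].
Qed.

Variable H : set (GK_curve k q -> GK_curve k q).
Hypothesis H_subgroup : is_subgroup H (@GK_cyclic_group k q).

(** The exponents [i] for which [H] contains the rotation by the [i]-th power of a
    primitive [N]-th root of unity are the multiples of the least positive one, a
    divisor of [N]. *)
Lemma subgroup_rotations : exists m s, [/\ (s * m = N)%N,
  forall h, H h -> exists2 zeta, zeta ^+ m = 1 & forall P, sval (h P) = rotate zeta (sval P) &
  forall zeta, zeta ^+ m = 1 -> exists2 h, H h & forall P, sval (h P) = rotate zeta (sval P)].
Proof.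
have [HG Hid Hcomp Hinv] := H_subgroup.
have [z zN] := prim_root_exists (GK_exponent_gt0 q) GK_exponent_neq0.
pose A i := exists2 h, H h & forall P, sval (h P) = rotate (z ^+ i) (sval P).
have A0 : A 0%N by exists id => // P; rewrite expr0 rotate1.
have AD i j : A i -> A j -> A (i + j)%N.
  move=> [h Hh hE] [h' Hh' hE']; exists (h' \o h); first exact: Hcomp.
  by move=> P; rewrite /= hE' hE rotateM exprD.
have AM i j : A i -> A (j * i)%N.
  by move=> Ai; elim: j => [|j IH] //; rewrite mulSn; exact: AD.
have Amod i j l : A i -> (i = j + l * N)%N -> A j.
  move=> [h Hh hE] e; exists h => // P.
  by rewrite hE e exprD mulnC exprM (prim_expr_order zN) expr1n mulr1.
have AN : A N by exists id => // P; rewrite (prim_expr_order zN) rotate1.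
have ex : exists d, (0 < d)%N && `[< A d >].
  by exists N; rewrite GK_exponent_gt0; apply/asboolP.
case: (ex_minnP ex) => d /andP[d0 /asboolP Ad] dmin.
have dv i : A i -> (d %| i)%N.
  move=> Ai; rewrite /dvdn -leqn0 leqNgt; apply/negP => r0.
  have Ar : A (i %% d)%N.
    (* The exponent [- d] is written [(N - 1) d], since the [N]-th power is trivial. *)
    apply: (Amod (i + (i %/ d * (N - 1)) * d)%N _ (i %/ d * d)%N); first exact: AD (AM _ _ Ad).
    rewrite {1}(divn_eq i d); have := GK_exponent_gt0 q; move: (N) => M M0.
    by rewrite mulnBr muln1 mulnBl -addnA addnCA subnKC ?leq_mul // ?leq_pmulr // mulnAC addnC.
  have := dmin (i %% d)%N; rewrite r0 => /(_ (asboolT Ar)).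
  by rewrite leqNgt ltn_mod d0.
have dN := dv _ AN; exists (N %/ d)%N, d; split; first by rewrite mulnC divnK.
  move=> h Hh; have [_ [zeta zetaN hE]] := HG _ Hh.
  have [i iE] := prim_rootP zN zetaN; exists zeta => //.
  have Ai : A i by exists h => // P; rewrite hE iE.
  rewrite iE -exprM; have /dvdnP[c ->] := dv _ Ai.
  by rewrite -mulnA [(d * _)%N]mulnC divnK // mulnC exprM (prim_expr_order zN) expr1n.
move=> zeta zm; have zetaN : zeta ^+ N = 1 by rewrite -(divnK dN) exprM zm expr1n.
have [i iE] := prim_rootP zN zetaN.
have : (N %| i * (N %/ d))%N by rewrite (prim_order_dvd zN) exprM -iE zm.
rewrite -{1}(divnK dN) mulnC dvdn_pmul2r; last by rewrite divn_gt0 // dvdn_leq ?GK_exponent_gt0.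
by rewrite iE => /dvdnP[c ->]; exact: AM.
Qed.

End CyclicGroup.

(** * The plane equation *)

Section PowerDescent.
Variables (k : fieldType) (n : nat).
Implicit Types (c : 'I_n -> k) (P : {mpoly k[n]}).

Definition scaling c : n.-tuple {mpoly k[n]} := [tuple c i *: 'X_i | i < n].

Lemma scaling_eval P c v : (P \mPo scaling c).@[v] = P.@[fun i => c i * v i].
Proof.
rewrite comp_mpoly_meval; congr (P.@[_]); apply/funext => i.
by rewrite tnth_mktuple mevalZ mevalXU.
Qed.

Lemma scalingX c u : 'X_[u] \mPo scaling c = (\prod_(i < n) c i ^+ u i) *: 'X_[u].
Proof.
rewrite comp_mpolyX mpolyXE_id -scaler_prod; apply: eq_bigr => i _.
by rewrite tnth_mktuple exprZn.
Qed.

Lemma scaling_coef P c u : (P \mPo scaling c)@_u = (\prod_(i < n) c i ^+ u i) * P@_u.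
Proof.
have -> : P@_u = \sum_(v <- msupp P) P@_v * (v == u)%:R.
  by rewrite {1}(mpolyE P) raddf_sum /=; apply: eq_bigr => v _; rewrite mcoeffZ mcoeffX.
rewrite comp_mpolyEX raddf_sum mulr_sumr; apply: eq_bigr => v _ /=.
rewrite scalingX !mcoeffZ mcoeffX.
by have [->|] := eqVneq; rewrite ?mulr1 ?mulr0 // mulrC.
Qed.

Lemma scaling_scaling P c d : (P \mPo scaling c) \mPo scaling d = P \mPo scaling (fun i => c i * d i).
Proof.
apply/mpolyP => u; rewrite !scaling_coef mulrA -big_split /=; congr (_ * _).
by apply: eq_bigr => i _; rewrite -exprMn mulrC.
Qed.

Lemma scaling_homog d P c : P \is d.-homog -> P \mPo scaling c \is d.-homog.
Proof.
move=> /dhomogP hP; apply/dhomogP => u; rewrite mcoeff_msupp scaling_coef mulf_eq0 negb_or.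
by rewrite -mcoeff_msupp => /andP[_ /hP].
Qed.

Definition powers m : n.-tuple {mpoly k[n]} := [tuple 'X_i ^+ m | i < n].

Lemma powers_eval P m v : (P \mPo powers m).@[v] = P.@[fun i => v i ^+ m].
Proof.
rewrite comp_mpoly_meval; congr (P.@[_]); apply/funext => i.
by rewrite tnth_mktuple rmorphXn /= mevalXU.
Qed.

(** Invariance under multiplying each variable by a primitive [m]-th root of unity
    makes all exponents multiples of [m]. *)
Lemma power_descent m (z : k) P d : (0 < m)%N -> m.-primitive_root z ->
  (forall i, P \mPo scaling (fun j => if j == i then z else 1) = P) ->
  P \is (m * d).-homog ->
  exists2 F : {mpoly k[n]}, F \is d.-homog & F \mPo powers m = P.
Proof.
move=> m0 zm Pi /dhomogP hP.
have dv u i : u \in msupp P -> (m %| u i)%N.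
  move=> uP; have := scaling_coef P (fun j => if j == i then z else 1) u.
  rewrite Pi (bigD1 i) //= eqxx big1 ?mulr1 => [/esym/eqP|j /negPf ->]; last by rewrite expr1n.
  rewrite -subr_eq0 -{2}[P@_u]mul1r -mulrBl mulf_eq0 subr_eq0 (negPf (_ : P@_u != 0)) ?orbF.
    by rewrite -(prim_order_dvd zm).
  by rewrite -mcoeff_msupp.
pose r (u : 'X_{1..n}) : 'X_{1..n} := [multinom (u i %/ m)%N | i < n].
have rE u : u \in msupp P -> (r u *+ m)%MM = u.
  by move=> uP; apply/mnmP => i; rewrite mulmnE mnmE divnK // dv.
exists (\sum_(u <- msupp P) P@_u *: 'X_[r u]).
  rewrite big_seq; apply: rpred_sum => u uP; apply: rpredZ; rewrite dhomogX /=.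
  have /= := hP u uP; rewrite -{1}(rE u uP) mdegMn mulnC => /eqP; by rewrite eqn_pmul2l.
rewrite raddf_sum /= [RHS](mpolyE P); apply: eq_big_seq => u uP.
rewrite comp_mpolyZ comp_mpolyX; congr (_ *: _); rewrite -[in RHS](rE u uP) mpolyXE_id.
by apply: eq_bigr => i _; rewrite tnth_mktuple -exprM mulmnE mulnC.
Qed.

End PowerDescent.

Lemma prod_shift (R : comNzRingType) (f : nat -> R) m l :
  (forall i, f (i + m)%N = f i) -> \prod_(i < m) f (i + l)%N = \prod_(i < m) f i.
Proof.
case: m => [|m] fm; first by rewrite !big_ord0.
elim: l => [|l IH]; first by apply: eq_bigr => i _; rewrite addn0.
rewrite -IH big_ord_recr /= [RHS]big_ord_recl /= mulrC.
congr (_ * _); first by rewrite add0n -addSnnS addnC fm.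
by apply: eq_bigr => i _; rewrite /bump /= add1n addSnnS.
Qed.

Section PlaneEquation.
Variables (k : closedFieldType) (q s m : nat).
Hypothesis q_gt1 : (1 < q)%N.
Hypothesis q_pchar : [pchar k].-nat q.
Local Notation N := (q ^ 2 - q + 1)%N.
Hypothesis smN : (s * m)%N = N.
Local Notation onX := (@on_curve k q N).
Local Notation R3 := {mpoly k[3]}.
Local Notation n := (q ^ 3 + 1)%N.
Let fD := frobD q_pchar.
Let fN := frobN q_gt1 q_pchar.

(** The plane equation for the trivial group: with [a = 1] it is
    [z ^ n = u (u ^ (q - 1) - 1) ^ (q + 1)] for [u = x ^ q + x], the result of eliminating
    [y] from [u = y ^ (q + 1)] and [y (u ^ (q - 1) - 1) = z ^ N].  The first factor of the
    product homogenizes [u (u ^ (q - 1) - 1) = x ^ (q ^ 2) - x]. *)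
Definition base_value (a b c : k) := c ^+ n - (b ^+ (q ^ 2) * a - b * a ^+ (q ^ 2)) *
  ((b ^+ q + b * a ^+ (q - 1)) ^+ (q - 1) - a ^+ (q * (q - 1))) ^+ q.

Definition base_form : R3 := 'X_o2 ^+ n - ('X_o1 ^+ (q ^ 2) * 'X_o0 - 'X_o1 * 'X_o0 ^+ (q ^ 2)) *
  (('X_o1 ^+ q + 'X_o1 * 'X_o0 ^+ (q - 1)) ^+ (q - 1) - 'X_o0 ^+ (q * (q - 1))) ^+ q.

Lemma degreeE : (n = (q + 1) * N)%N.
Proof.
have : (q <= q ^ 2)%N by rewrite -{1}[q]expn1 leq_exp2l.
by move=> h; rewrite mulnDr muln1 mulnBr; nia.
Qed.

Lemma base_formE a b c : base_form.@[vec3 a b c] = base_value a b c.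
Proof.
by rewrite /base_form /base_value !(mevalsimp, rmorphXn) /= !(mevalsimp, rmorphXn) /=
  !(mevalsimp, rmorphXn) /= !mevalXU.
Qed.

Lemma base_form_homog : base_form \is n.-homog.
Proof.
apply: rpredB; first exact: homogXn.
have -> : n = ((q ^ 2 + 1) + (q * (q - 1)) * q)%N.
  by have := q_gt1; case: (q) => // j _; rewrite subn1 /=; lia.
apply: dhomogM.
  apply: rpredB; first by apply: dhomogM; [exact: homogXn|exact: homogX].
  by rewrite addnC; apply: dhomogM; [exact: homogX|exact: homogXn].
apply: dhomogMn; apply: rpredB; last exact: homogXn.
apply: dhomogMn; apply: rpredD; first exact: homogXn.
have h : ('X_o1 * 'X_o0 ^+ (q - 1) : R3) \is (1 + (q - 1)).-homog.
  by apply: dhomogM; [exact: homogX|exact: homogXn].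
by move: h; rewrite subnKC // ltnW.
Qed.

(** The exchange of [a] and [b] changes the sign of the first factor, and also that
    of the base of the [q]-th power: in terms of [A = a ^ (q - 1)] and
    [B = b ^ (q - 1)] this is [(A + B) ^ q = A ^ q + B ^ q]. *)
Lemma base_value_swap a b c : base_value b a c = base_value a b c.
Proof.
rewrite /base_value; congr (_ - _).
set D := (X in _ = _ * X ^+ q); set D' := (X in _ * X ^+ q = _).
suff -> : D' = - D by rewrite fN; ring.
apply/eqP; rewrite -addr_eq0; apply/eqP; rewrite /D /D' => {D D'}.
have qE x y : x ^+ q + x * y ^+ (q - 1) = x * (x ^+ (q - 1) + y ^+ (q - 1)) :> k.
  by rewrite mulrDr -exprS subn1 prednK // ltnW.
rewrite !qE ![_ ^+ (q * _)]exprM ![(_ ^+ q) ^+ _]exprAC !exprMn.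
move: (a ^+ (q - 1)) (b ^+ (q - 1)) => A B; rewrite [B + A]addrC.
have e : (A + B) ^+ q = (A + B) ^+ (q - 1) * (A + B).
  by rewrite -exprSr subn1 prednK // ltnW.
have -> : A * (A + B) ^+ (q - 1) - B ^+ q + (B * (A + B) ^+ (q - 1) - A ^+ q) =
   (A + B) ^+ (q - 1) * (A + B) - (A ^+ q + B ^+ q) by ring.
by rewrite -e fD subrr.
Qed.

(** The point above is [y = z ^ N / d] when [d = u ^ (q - 1) - 1] is not zero; otherwise
    [z = 0] and any [y] with [y ^ (q + 1) = u] will do. *)
Lemma base_value_affine x z : base_value 1 x z = 0 <-> exists y, onX x y z.
Proof.
set u := x ^+ q + x; set d := u ^+ (q - 1) - 1.
have -> : base_value 1 x z = z ^+ n - u * d ^+ q.+1.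
  rewrite /base_value !expr1n !mulr1 exprS -/u -/d.
  have -> : x ^+ (q ^ 2) - x = u * d.
    rewrite mulrBr mulr1 -exprS subn1 prednK ?(ltnW q_gt1) // /u fD -exprM mulnn; ring.
  by rewrite mulrA.
have gk y : onX x y z <-> u = y ^+ q.+1 /\ y * d = z ^+ N.
  split=> -[e1 e2]; split=> //.
    by apply/eqP; rewrite -subr_eq0; apply/eqP/GK_equation => //; rewrite e1 subrr.
  have e1' : x ^+ q + x - y ^+ q.+1 = 0 by rewrite -/u e1 subrr.
  by apply/(GK_equation q_gt1 _ e1'); rewrite -/u -/d e2 subrr.
have zn : z ^+ n = (z ^+ N) ^+ q.+1 by rewrite -exprM [(N * _)%N]mulnC -[q.+1]addn1 -degreeE.
split; last first.
  by case=> y /gk[uE yd]; rewrite zn -yd exprMn -uE subrr.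
rewrite zn => /eqP; rewrite subr_eq0 => /eqP e.
have [d0|d0] := eqVneq d 0.
  have [y yE] := nth_root_exists u (ltn0Sn q); exists y; apply/gk; rewrite yE; split=> //.
  move: e; rewrite d0 mulr0 expr0n mulr0 => /eqP.
  by rewrite expf_eq0 => /andP[_ /eqP ->].
exists (z ^+ N / d); apply/gk; split; last by rewrite divfK.
by rewrite expr_div_n e mulfK // expf_neq0.
Qed.

Lemma base_value_infinity b c : (base_value 0 b c == 0) = (c == 0).
Proof.
have q0 j : (0 < j)%N -> 0 ^+ j = 0 :> k by case: j => // j _; rewrite expr0n.
by rewrite /base_value mulr0 (q0 (q ^ 2)%N) ?expn_gt0 ?(ltnW q_gt1) // mulr0 subrr mul0r subr0
  expf_eq0 addn1.
Qed.

Lemma m_gt0 : (0 < m)%N.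
Proof. by have := GK_exponent_gt0 q; rewrite -smN; case: (m); rewrite ?muln0. Qed.

Lemma m_neq0 : m%:R != 0 :> k.
Proof.
have := GK_exponent_neq0 q_gt1 q_pchar; rewrite -smN natrM mulf_eq0 negb_or.
by case/andP.
Qed.

(** The product [P] of the forms [f (X0, eta X1, X2)], for [eta ^ m = 1], must be
    invariant under each coordinate scaling by an [m]-th root of unity [z].  For
    the second coordinate this permutes the factors.  For the third, [X2] enters
    [f] through [X2 ^ n] only, and [m] divides [n].  For the first, [f] is invariant
    under scaling all coordinates, again because [m] divides [n]. *)
Lemma plane_equation : exists F : R3, F \is n.-homog /\
  exists2 z : k, m.-primitive_root z & forall a b c,
    F.@[vec3 (a ^+ m) (b ^+ m) (c ^+ m)] = \prod_(i < m) base_value a (z ^+ i * b) c.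
Proof.
have [z zm] := prim_root_exists m_gt0 m_neq0.
have zn : z ^+ n = 1.
  by rewrite degreeE -smN mulnA mulnC exprM (prim_expr_order zm) expr1n.
pose f i : R3 := base_form \mPo scaling (vec3 1 (z ^+ i) 1).
pose P := \prod_(i < m) f i.
have fm i : f (i + m)%N = f i by rewrite /f exprD (prim_expr_order zm) mulr1.
have Pz l : \prod_(i < m) f (i + l)%N = P by exact: prod_shift.
(* The scalings that fix the form for the trivial group. *)
have f_last eta : eta ^+ n = 1 -> base_form \mPo scaling (vec3 1 1 eta) = base_form.
  move=> en; have eX i : 'X_i \mPo scaling (vec3 1 1 eta) = vec3 1 1 eta i *: 'X_i.
    by rewrite comp_mpolyXU -tnth_nth tnth_mktuple.
  rewrite /base_form !(rmorphB, rmorphM, rmorphXn, rmorphD) /= !eX /vec3 /=.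
  by rewrite !scale1r exprZn en scale1r.
have f_all : base_form \mPo scaling (fun=> z) = base_form.
  apply/mpolyP => u; rewrite scaling_coef; have [uf|/memN_msupp_eq0 ->] := boolP (u \in msupp base_form);
    last by rewrite mulr0.
  rewrite -expr_sum -mdegE; have /dhomogP/(_ u uf)/= -> := base_form_homog.
  by rewrite zn mul1r.
have Pinv i : P \mPo scaling (fun j => if j == i then z else 1) = P.
  rewrite /P rmorph_prod /=; move: i; apply: ord3P.
  - rewrite -[RHS](Pz m.-1); apply: eq_bigr => i _; rewrite /f scaling_scaling.
    have zV : z^-1 ^+ n = 1 by rewrite exprVn zn invr1.
    rewrite -[in RHS]f_all -[in RHS](f_last _ zV) !scaling_scaling; congr (_ \mPo scaling _).
    have z0 : z != 0.
      by apply/eqP => z0; move/eqP: zn; rewrite z0 expr0n addn1 /= eq_sym oner_eq0.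
    apply/funext; apply: ord3P; rewrite /vec3 /= ?mulr1 ?mul1r ?mulVf //.
    by rewrite -exprS -addnS prednK ?m_gt0 // exprD (prim_expr_order zm) mulr1.
  - rewrite -[RHS](Pz 1%N); apply: eq_bigr => i _; rewrite /f scaling_scaling.
    congr (_ \mPo scaling _); apply/funext; apply: ord3P; rewrite /vec3 /= ?mulr1 //.
    by rewrite addn1 exprSr.
  - apply: eq_bigr => i _; rewrite /f scaling_scaling -{2}(f_last _ zn) scaling_scaling.
    congr (_ \mPo scaling _); apply/funext; apply: ord3P; rewrite /vec3 /= ?mulr1 ?mul1r //.
have Phom : P \is (m * n).-homog.
  suff hom j : \prod_(i < j) f i \is (j * n).-homog by exact: hom.
  elim: j => [|j IH]; first by rewrite big_ord0 mul0n dhomog1.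
  rewrite big_ord_recr mulSn addnC; apply: dhomogM => //; apply: scaling_homog.
  exact: base_form_homog.
have [F hF FE] := power_descent m_gt0 zm Pinv Phom; exists F; split=> //; exists z => // a b c.
have := congr1 (meval (vec3 a b c)) FE; rewrite powers_eval => e.
have -> : F.@[vec3 (a ^+ m) (b ^+ m) (c ^+ m)] = F.@[fun i => vec3 a b c i ^+ m].
  by congr (F.@[_]); apply/funext; apply: ord3P.
rewrite e rmorph_prod; apply: eq_bigr => i _.
rewrite /f /= scaling_eval -base_formE; congr (base_form.@[_]).
by apply/funext; apply: ord3P; rewrite /vec3 /= ?mul1r.
Qed.

Variables (F : R3) (z : k).
Hypothesis F_homog : F \is n.-homog.
Hypothesis z_prim : m.-primitive_root z.
Hypothesis F_powers : forall a b c,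
  F.@[vec3 (a ^+ m) (b ^+ m) (c ^+ m)] = \prod_(i < m) base_value a (z ^+ i * b) c.

Lemma base_value_scale l a b c : base_value (l * a) (l * b) (l * c) = l ^+ n * base_value a b c.
Proof.
rewrite -!base_formE -[vec3 (l * a) _ _]/(fun i => vec3 (l * a) (l * b) (l * c) i).
have -> : vec3 (l * a) (l * b) (l * c) = fun i => l * vec3 a b c i.
  by apply/funext; apply: ord3P.
rewrite -(scaling_eval base_form (fun=> l)) -mevalZ; congr (meval _ _).
apply/mpolyP => u; rewrite scaling_coef mcoeffZ.
have [uf|/memN_msupp_eq0 ->] := boolP (u \in msupp base_form); last by rewrite !mulr0.
by rewrite -expr_sum -mdegE; have /dhomogP/(_ u uf)/= -> := base_form_homog.
Qed.

Lemma plane_zeros t0 t1 t2 : F.@[vec3 t0 t1 t2] = 0 <-> exists a b c,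
  [/\ a ^+ m = t0, b ^+ m = t1, c ^+ m = t2 & base_value a b c = 0].
Proof.
split; last first.
  case=> a [b [c [<- <- <- e]]]; rewrite F_powers.
  have := m_gt0; case: m => // j _; by rewrite big_ord_recl mul1r e mul0r.
have [a <-] := nth_root_exists t0 m_gt0; have [b <-] := nth_root_exists t1 m_gt0.
have [c <-] := nth_root_exists t2 m_gt0.
rewrite F_powers => /eqP/prodf_eq0[i _ /eqP e].
exists a, (z ^+ i * b), c; split=> //.
by rewrite exprMn -exprM mulnC exprM (prim_expr_order z_prim) expr1n mul1r.
Qed.

Lemma plane_swap t0 t1 t2 : F.@[vec3 t1 t0 t2] = 0 <-> F.@[vec3 t0 t1 t2] = 0.
Proof.
by rewrite !plane_zeros; split=> -[a [b [c [e0 e1 e2 e]]]]; exists b, a, c;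
  rewrite base_value_swap.
Qed.

Lemma plane_affine t w : F.@[vec3 1 t w] = 0 <-> exists x y v, [/\ onX x y v, t = x ^+ m & w = v ^+ m].
Proof.
rewrite plane_zeros; split.
  case=> a [b [c [a1 <- <- e]]].
  have a0 : a != 0.
    apply/eqP => a0; move/eqP: a1; rewrite a0 expr0n eqn0Ngt m_gt0 /= eq_sym; exact/negP/oner_neq0.
  have : base_value 1 (b / a) (c / a) = 0.
    move: e; have -> : base_value a b c = base_value (a * 1) (a * (b / a)) (a * (c / a)).
      by rewrite mulr1 !mulrA ![a * _]mulrC !mulfK.
    by rewrite base_value_scale => /eqP; rewrite mulf_eq0 expf_eq0 (negPf a0) andbF => /eqP.
  move/base_value_affine => [y on]; exists (b / a), y, (c / a).
  by rewrite !expr_div_n a1 !divr1.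
case=> x [y [v [on -> ->]]]; exists 1, x, v; rewrite expr1n; split=> //.
by apply/base_value_affine; exists y.
Qed.

Lemma plane_infinity t w : F.@[vec3 0 t w] = 0 <-> w = 0.
Proof.
rewrite plane_zeros; split.
  case=> a [b [c [/eqP + _ <- /eqP]]]; rewrite expf_eq0 m_gt0 /= => /eqP ->.
  by rewrite base_value_infinity => /eqP ->; rewrite expr0n eqn0Ngt m_gt0.
move=> ->; have [b <-] := nth_root_exists t m_gt0; exists 0, b, 0.
by rewrite !expr0n eqn0Ngt m_gt0; split=> //; apply/eqP; rewrite base_value_infinity.
Qed.

(** Substituting [t ^ m] multiplies the order of vanishing at [0] by [m]. *)
Lemma simple_zero (p h : {poly k}) : (forall t, p.[t ^+ m] = t ^+ m * h.[t]) -> h.[0] != 0 ->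
  p`_1 != 0.
Proof.
move=> ph h0; apply/eqP => p1.
have p0 : p`_0 = 0.
  by rewrite -horner_coef0; have := ph 0; rewrite expr0n eqn0Ngt m_gt0 mul0r.
have pE : p = drop_poly 2 p * 'X^2.
  rewrite -[LHS](poly_take_drop 2 p) (_ : take_poly 2 p = 0) ?add0r //.
  apply/polyP => -[|[|i]]; rewrite coef_take_poly coef0 //=.
set r := drop_poly 2 p in pE.
have : 'X * (h - 'X^m * (r \Po 'X^m)) = 0.
  apply: poly_eq0_horner => t; rewrite !hornerE horner_comp !hornerE.
  have [->|t0] := eqVneq t 0; first by rewrite mul0r.
  have : t ^+ m * (t ^+ m * r.[t ^+ m]) = t ^+ m * h.[t].
    by rewrite -ph {1}pE hornerM hornerXn mulrA -expr2 mulrC.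
  by move/(mulfI (expf_neq0 m t0)) => ->; rewrite subrr mulr0.
move/eqP; rewrite mulf_eq0 polyX_eq0 /= subr_eq0 => /eqP hE.
by case/eqP: h0; rewrite hE !hornerE expr0n eqn0Ngt m_gt0 mul0r.
Qed.

Lemma mderiv_eval (P : R3) i (v : 'I_3 -> k) : P^`M(i).@[v] =
  \sum_(u <- msupp P) (u i)%:R * P@_u * 'X_[(u - U_(i))%MM].@[v].
Proof. by rewrite /mderiv raddf_sum /=; apply: eq_bigr => u _; rewrite mevalZ. Qed.

Lemma root_neq0 : z != 0.
Proof.
apply/eqP => z0; have /eqP := prim_expr_order z_prim.
by rewrite z0 expr0n eqn0Ngt m_gt0 /= eq_sym oner_eq0.
Qed.

(** What remains of the equation on the line [c = 0] after removing its zero at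
    [a = 0]; the zero is simple because this does not vanish there. *)
Definition tangent_poly (b : k) : {poly k} :=
  - ((b ^+ (q ^ 2))%:P - b%:P * 'X^(q ^ 2 - 1)) *
  (((b ^+ q)%:P + b%:P * 'X^(q - 1)) ^+ (q - 1) - 'X^(q * (q - 1))) ^+ q.

Lemma tangent_polyE t b : base_value t b 0 = t * (tangent_poly b).[t].
Proof.
rewrite /base_value /tangent_poly !hornerE.
rewrite expr0n addn1 /= sub0r; have -> : t ^+ (q ^ 2) = t * t ^+ (q ^ 2 - 1).
  by rewrite -exprS subn1 prednK // expn_gt0 (ltnW q_gt1).
ring.
Qed.

Lemma tangent_poly0 b : b != 0 -> (tangent_poly b).[0] != 0.
Proof.
move=> b0; have z0 j : (0 < j)%N -> 0 ^+ j = 0 :> k by case: j => // j _; rewrite expr0n.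
rewrite /tangent_poly !hornerE.
have q2 : (1 < q ^ 2)%N by rewrite -[1%N](expn0 q) ltn_exp2l.
rewrite !(z0 (q - 1)%N) ?(z0 (q ^ 2 - 1)%N) ?(z0 (q * (q - 1))%N) ?muln_gt0 ?subn_gt0 ?(ltnW q_gt1) //.
by rewrite !mulr0 ?addr0 ?subr0 mulf_neq0 ?oppr_eq0 ?expf_neq0.
Qed.

(** This partial derivative is the linear coefficient of the form on the line
    [X2 = 0]; after substituting [m]-th powers that restriction splits into [m]
    factors, each with a simple zero. *)
Lemma plane_smooth_infinity : F^`M(o0).@[vec3 0 1 0] != 0.
Proof.
pose p : {poly k} := \sum_(u <- msupp F) (F@_u * 0 ^+ u o2) *: 'X^(u o0).
have -> : F^`M(o0).@[vec3 0 1 0] = p`_1.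
  rewrite mderiv_eval /p poly_sum_coef [RHS]big_mkcond; apply: eq_bigr => u _.
  rewrite evalX3 expr1n mulr1 !mnmBE !mnm1E /= subn0.
  by case: (u o0) => [|[|j]] /=; rewrite ?mul0r ?mul1r ?expr0n //= ?mul1r // mul0r mulr0.
pose h := \prod_(i < m) tangent_poly (z ^+ i).
have z0 := root_neq0.
apply: (@simple_zero p h) => [t|]; last first.
  by rewrite horner_prod; apply/prodf_neq0 => i _; apply: tangent_poly0; rewrite expf_neq0.
rewrite horner_prod; have -> : p.[t ^+ m] = F.@[vec3 (t ^+ m) (1 ^+ m) (0 ^+ m)].
  rewrite eval3E horner_sum expr1n expr0n eqn0Ngt m_gt0; apply: eq_bigr => u _.
  by rewrite hornerZ hornerXn expr1n mulr1 -mulrA [X in _ * X]mulrC.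
rewrite F_powers; have -> : t ^+ m = \prod_(i < m) t by rewrite prodr_const card_ord.
rewrite -big_split /=; apply: eq_bigr => i _.
by rewrite mulr1 tangent_polyE.
Qed.

Lemma plane_smooth_origin : F^`M(o1).@[vec3 1 0 0] != 0.
Proof.
pose p : {poly k} := \sum_(u <- msupp F) (F@_u * 0 ^+ u o2) *: 'X^(u o1).
have -> : F^`M(o1).@[vec3 1 0 0] = p`_1.
  rewrite mderiv_eval /p poly_sum_coef [RHS]big_mkcond; apply: eq_bigr => u _.
  rewrite evalX3 expr1n mul1r !mnmBE !mnm1E /= subn0.
  by case: (u o1) => [|[|j]] /=; rewrite ?mul0r ?mul1r ?expr0n //= ?mul1r // mul0r mulr0.
pose h := \prod_(i < m) ((z ^+ i)%:P * (tangent_poly 1 \Po ((z ^+ i)%:P * 'X))).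
have z0 := root_neq0.
apply: (@simple_zero p h) => [t|]; last first.
  rewrite horner_prod; apply/prodf_neq0 => i _; rewrite hornerM hornerC horner_comp.
  have -> : ((z ^+ i)%:P * 'X).[0] = 0 by rewrite hornerM hornerX mulr0.
  apply: mulf_neq0; first exact: expf_neq0.
  apply: tangent_poly0; exact: oner_neq0.
rewrite horner_prod; have -> : p.[t ^+ m] = F.@[vec3 (1 ^+ m) (t ^+ m) (0 ^+ m)].
  rewrite eval3E horner_sum expr1n expr0n eqn0Ngt m_gt0; apply: eq_bigr => u _.
  by rewrite hornerZ hornerXn expr1n mul1r -mulrA [X in _ * X]mulrC.
rewrite F_powers; have -> : t ^+ m = \prod_(i < m) t by rewrite prodr_const card_ord.
rewrite -big_split /=; apply: eq_bigr => i _.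
rewrite base_value_swap tangent_polyE; move: (tangent_poly 1) (z ^+ i) => r c.
by rewrite hornerM hornerC horner_comp hornerM hornerC hornerX mulrA [t * c]mulrC.
Qed.

End PlaneEquation.

(** * The embedding of the quotient *)

Lemma power_decomposition (k : closedFieldType) m (P : {mpoly k[3]}) : (0 < m)%N ->
  exists g : 'I_m -> {mpoly k[3]}, forall x y z,
    P.@[vec3 x y z] = \sum_(l < m) (g l).@[vec3 x y (z ^+ m)] * z ^+ l.
Proof.
move=> m0; exists (fun l : 'I_m => \sum_(u <- msupp P | (u o2 %% m)%N == l :> nat)
  P@_u *: 'X_[mon3 (u o0) (u o1) (u o2 %/ m)]) => x y z.
rewrite eval3E; transitivity (\sum_(u <- msupp P) \sum_(l < m | (u o2 %% m)%N == l :> nat)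
    P@_u * (x ^+ u o0 * y ^+ u o1 * z ^+ u o2)).
  apply: eq_bigr => u _; have lt : (u o2 %% m < m)%N by rewrite ltn_mod.
  by rewrite (big_pred1 (Ordinal lt)) // => l; rewrite -val_eqE /= eq_sym.
rewrite (exchange_big_dep xpredT) //=; apply: eq_bigr => l _; rewrite raddf_sum mulr_suml /=.
apply: eq_bigr => u /eqP ul; rewrite mevalZ evalX3 !mon3E -exprM -!mulrA -exprD -ul.
by rewrite [(m * _)%N]mulnC -divn_eq.
Qed.

(** A polynomial of degree less than [m] has fewer than [m] roots. *)
Lemma prim_power_independent (k : fieldType) m (z : k) (c : 'I_m -> k) : m.-primitive_root z ->
  (forall zeta, zeta ^+ m = 1 -> \sum_(l < m) c l * zeta ^+ l = 0) -> forall l, c l = 0.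
Proof.
move=> zm h l; pose p : {poly k} := \poly_(i < m) (if insub i is Some i' then c i' else 0).
have p0 : p = 0.
  apply: (@roots_geq_poly_eq0 _ _ [seq z ^+ i | i <- index_iota 0 m]).
  - apply/allP => _ /mapP[i _ ->]; rewrite /root horner_poly; apply/eqP.
    rewrite -[RHS](h (z ^+ i)); first by apply: eq_bigr => l' _; rewrite valK.
    by rewrite -exprM mulnC exprM (prim_expr_order zm) expr1n.
  - rewrite map_inj_in_uniq ?iota_uniq // => i i'; rewrite !mem_index_iota /= => li li'.
    by move/eqP; rewrite (eq_prim_root_expr zm) !modn_small // => /eqP.
  - by rewrite size_map size_iota subn0 size_poly.
by have := congr1 (fun p : {poly k} => p`_l) p0; rewrite coef_poly ltn_ord valK coef0.
Qed.

Section Embedding.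
Variables (k : closedFieldType) (q s m : nat).
Hypothesis q_gt1 : (1 < q)%N.
Hypothesis q_pchar : [pchar k].-nat q.
Local Notation N := (q ^ 2 - q + 1)%N.
Hypothesis smN : (s * m)%N = N.
Local Notation onX := (@on_curve k q N).
Local Notation onC := (@on_curve k q s).
Local Notation R3 := {mpoly k[3]}.
Local Notation R4 := {mpoly k[4]}.
Local Notation n := (q ^ 3 + 1)%N.
Let m0 : (0 < m)%N := m_gt0 smN.

Lemma on_quotient x y z : onX x y z <-> onC x y (z ^+ m).
Proof. by rewrite /on_curve -exprM mulnC smN. Qed.

Definition row3 (a b c : k) : 'rV[k]_3 := \row_i vec3 a b c i.

Lemma heval_row3 G a b c : heval G (row3 a b c) = G.@[vec3 a b c].
Proof. by rewrite /heval; congr (G.@[_]); apply/funext => i; rewrite mxE. Qed.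

Lemma row3_coords (v : 'rV[k]_3) : v = row3 (v 0 o0) (v 0 o1) (v 0 o2).
Proof. by apply/rowP; apply: ord3P; rewrite mxE. Qed.

Lemma row3_eq0 a b c : (row3 a b c == 0) = [&& a == 0, b == 0 & c == 0].
Proof.
apply/eqP/and3P => [e|[/eqP-> /eqP-> /eqP->]].
  have h i : row3 a b c 0 i = 0 by rewrite e mxE.
  by have := (h o0, h o1, h o2); rewrite !mxE /vec3 /= => -[[-> ->] ->].
by apply/rowP; apply: ord3P; rewrite !mxE.
Qed.

Lemma row3_scale l a b c : l *: row3 a b c = row3 (l * a) (l * b) (l * c).
Proof. by apply/rowP; apply: ord3P; rewrite !mxE. Qed.

Lemma row3_1neq0 t w : row3 1 t w != 0.
Proof. by rewrite row3_eq0 oner_eq0. Qed.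

Lemma row3_010_neq0 : row3 0 1 0 != 0.
Proof. by rewrite row3_eq0 oner_eq0 andbF. Qed.

Definition plane_pt t w : pt k 2 := pt_of (row3 1 t w).
Definition plane_inf : pt k 2 := pt_of (row3 0 1 0).

Lemma plane_pt_inj t w t' w' : plane_pt t w = plane_pt t' w' -> t = t' /\ w = w'.
Proof.
move/(eq_pt_of (row3_1neq0 _ _) (row3_1neq0 _ _)) => -[c _].
rewrite row3_scale => /rowP e; have := e o0; rewrite !mxE /vec3 /= mulr1 => c1.
by have := (e o1, e o2); rewrite !mxE /vec3 /= -c1 !mul1r => -[-> ->].
Qed.

Lemma plane_pt_inf t w : plane_pt t w <> plane_inf.
Proof.
move/(eq_pt_of (row3_1neq0 _ _) row3_010_neq0) => -[c _].
by rewrite row3_scale => /rowP/(_ o0)/eqP; rewrite !mxE /vec3 /= mulr0 oner_eq0.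
Qed.

Lemma peval_plane d (G : R3) t w : G \is d.-homog ->
  (peval G (plane_pt t w) == 0) = (G.@[vec3 1 t w] == 0).
Proof. by move=> hG; rewrite (peval_eq0 (row3_1neq0 _ _) hG) heval_row3. Qed.

Lemma peval_plane_inf d (G : R3) : G \is d.-homog ->
  (peval G plane_inf == 0) = (G.@[vec3 0 1 0] == 0).
Proof. by move=> hG; rewrite (peval_eq0 row3_010_neq0 hG) heval_row3. Qed.

Lemma peval_ratio d (G G' : R3) t w : G \is d.-homog -> G' \is d.-homog ->
  peval G (plane_pt t w) / peval G' (plane_pt t w) = G.@[vec3 1 t w] / G'.@[vec3 1 t w].
Proof.
move=> hG hG'; have [c c0 cE] := peval_pt_of (row3_1neq0 t w).
by rewrite (cE _ _ hG) (cE _ _ hG') !heval_row3 invfM mulrACA divff ?mul1r // expf_neq0.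
Qed.

Definition power_map (P : pt k 3) : pt k 2 :=
  pt_of (row3 (coords P 0 u0 ^+ m) (coords P 0 u1 ^+ m) (coords P 0 u3 ^+ m)).

Lemma power_map_affine x y z : power_map (affine_pt x y z) = plane_pt (x ^+ m) (z ^+ m).
Proof.
have [c c0 cE] := coords_pt_of (row4_1neq0 x y z).
have cm : c ^+ m != 0 by rewrite expf_neq0.
apply/eq_pt_of; first by rewrite row3_eq0 cE !mxE /= mulr1 (negPf cm).
  exact: row3_1neq0.
exists (c ^+ m) => //; by rewrite row3_scale cE !mxE /= !exprMn expr1n.
Qed.

Lemma power_map_infinity : power_map (infinity_pt k) = plane_inf.
Proof.
have [c c0 cE] := coords_pt_of (infinity_neq0 k).
have cm : c ^+ m != 0 by rewrite expf_neq0.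
have z0 : 0 ^+ m = 0 :> k by rewrite expr0n eqn0Ngt m0.
apply/eq_pt_of; first by rewrite row3_eq0 cE !mxE /= !mulr0 mulr1 z0 (negPf cm) andbF.
  exact: row3_010_neq0.
by exists (c ^+ m) => //; rewrite row3_scale cE !mxE /= !mulr0 !mulr1 z0.
Qed.

Lemma power_map_rotate zeta (P : GK_curve k q) : zeta ^+ m = 1 ->
  power_map (rotate zeta (sval P)) = power_map (sval P).
Proof.
move=> zm; case: P => P gP /=.
have [[x [y [z [-> _]]]]|->] := GK_points_cases q_gt1 gP.
  by rewrite rotate_affine !power_map_affine exprMn zm mul1r.
by rewrite rotate_infinity.
Qed.

Definition power_tuple : 3.-tuple R4 := [tuple 'X_u0 ^+ m; 'X_u1 ^+ m; 'X_u3 ^+ m].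

Lemma comp_homog n' n'' (t : n'.-tuple {mpoly k[n'']}) e d (G : {mpoly k[n']}) :
  (forall i, tnth t i \is e.-homog) -> G \is d.-homog -> G \mPo t \is (e * d).-homog.
Proof.
move=> ht /dhomogP hG; rewrite comp_mpolyE big_seq; apply: rpred_sum => u uG; apply: rpredZ.
have /= <- := hG u uG; rewrite mdegE big_distrr /=.
elim/big_ind2: _ => [|a b c' d' h1 h2|i _]; [exact: dhomog1|exact: dhomogM|].
by apply: dhomogMn; exact: ht.
Qed.

Lemma power_map_pullback (P : GK_curve k q) : exists2 c : k, c != 0 &
  forall d (H : R3), H \is d.-homog ->
    peval H (power_map (sval P)) = c ^+ d * peval (H \mPo power_tuple) (sval P).
Proof.
have nz : row3 (coords (sval P) 0 u0 ^+ m) (coords (sval P) 0 u1 ^+ m)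
    (coords (sval P) 0 u3 ^+ m) != 0.
  case: P => P gP /=; have [[x [y [z [-> _]]]]|->] := GK_points_cases q_gt1 gP.
    have [c c0 ->] := coords_pt_of (row4_1neq0 x y z).
    by rewrite row3_eq0 !mxE /= mulr1 expf_eq0 (negPf c0) andbF.
  have [c c0 ->] := coords_pt_of (infinity_neq0 k).
  by rewrite row3_eq0 !mxE /= mulr1 !expf_eq0 (negPf c0) andbF /= andbF.
have [c c0 cE] := peval_pt_of nz; exists c => // d H hH.
rewrite /power_map (cE _ _ hH) heval_row3 /peval comp_mpoly_meval; congr (_ * H.@[_]).
by apply/funext; apply: ord3P; rewrite (tnth_nth 0) /= rmorphXn /= mevalXU.
Qed.

Lemma power_map_morphism : @morphism k (GK_curve k q) (proj_space k 2) (power_map \o sval).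
Proof.
have := @pullback_morphism k 3 2 (GK_curve k q) sval (power_map \o sval) (comp_mpoly power_tuple) m; apply.
- exact: (embedded_subspace (GK_points q) (embedded_id k 3)).
- move=> d H hH; apply: comp_homog hH; apply: ord3P; rewrite (tnth_nth 0) /=; exact: homogXn.
- exact: power_map_pullback.
Qed.

Variable H : set (GK_curve k q -> GK_curve k q).
Hypothesis H_subgroup : is_subgroup H (@GK_cyclic_group k q).
Hypothesis H_rotation : forall h, H h ->
  exists2 zeta, zeta ^+ m = 1 & forall P, sval (h P) = rotate zeta (sval P).
Hypothesis rotation_H : forall zeta, zeta ^+ m = 1 ->
  exists2 h, H h & forall P, sval (h P) = rotate zeta (sval P).

Local Notation XH := (quotient_space H).

Definition orbit_point (O : XH) : GK_curve k q := projT1 (cid (svalP O)).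

Lemma orbit_pointK (O : XH) : to_orbit H (orbit_point O) = O.
Proof. by case: O => O hO; apply: eq_exist; rewrite /orbit_point /=; case: cid. Qed.

Definition psi (O : XH) : proj_space k 2 := power_map (sval (orbit_point O)).

Lemma to_orbitP (P P' : GK_curve k q) : to_orbit H P = to_orbit H P' <->
  exists2 zeta, zeta ^+ m = 1 & sval P' = rotate zeta (sval P).
Proof.
rewrite (to_orbit_eq _ _ H_subgroup); split.
  by case=> h /H_rotation[zeta zm hE] <-; exists zeta.
case=> zeta /rotation_H[h Hh hE] e; exists h => //; apply: eq_sig_hprop => [x|].
  exact: Prop_irrelevance.
by rewrite e; exact: hE.
Qed.

Lemma psi_to_orbit P : psi (to_orbit H P) = power_map (sval P).
Proof.
have /to_orbitP[zeta zm ->] := orbit_pointK (to_orbit H P).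
by rewrite power_map_rotate.
Qed.

Lemma psi_morphism : morphism psi.
Proof.
have e : psi \o @to_orbit _ H = power_map \o sval by apply/funext => P; exact: psi_to_orbit.
move=> V oV; have [o r] := power_map_morphism oV.
split; first by rewrite -e in o.
by move=> g rg; have := r g rg; rewrite -e.
Qed.

Variables (F : R3) (z0 : k).
Hypothesis F_homog : F \is n.-homog.
Hypothesis z_prim : m.-primitive_root z0.
Hypothesis F_powers : forall a b c,
  F.@[vec3 (a ^+ m) (b ^+ m) (c ^+ m)] = \prod_(i < m) base_value q a (z0 ^+ i * b) c.

Lemma plane_curve_cases (P : pt k 2) : peval F P = 0 <->
  (exists x y z, onX x y z /\ P = plane_pt (x ^+ m) (z ^+ m)) \/ P = plane_inf.
Proof.
split; last first.
  case=> [[x [y [z [on ->]]]]|->]; apply/eqP.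
    rewrite (peval_plane _ _ F_homog); apply/eqP.
    by apply/(plane_affine q_gt1 q_pchar smN z_prim F_powers); exists x, y, z.
  rewrite (peval_plane_inf F_homog); apply/eqP.
  by apply/(plane_infinity q_gt1 smN z_prim F_powers).
have nz := coords_neq0 P; have PE := pt_of_coords P.
rewrite -[peval F P]/(heval F (coords P)); rewrite (row3_coords (coords P)) in nz PE *.
move: (coords P 0 o0) (coords P 0 o1) (coords P 0 o2) nz PE => a b c nz PE.
rewrite heval_row3 => Fabc; have [a0|a0] := eqVneq a 0.
  right; move: Fabc nz PE; rewrite a0 => /(plane_infinity q_gt1 smN z_prim F_powers) -> nz <-.
  apply/eq_pt_of => //; first exact: row3_010_neq0.
  exists b; last by rewrite row3_scale !mulr0 mulr1.
  by move: nz; rewrite row3_eq0 !eqxx andbT.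
left; have E : row3 a b c = a *: row3 1 (b / a) (c / a).
  by rewrite row3_scale mulr1 !mulrA ![a * _]mulrC !mulfK.
have : F.@[vec3 1 (b / a) (c / a)] = 0.
  move: Fabc; rewrite -heval_row3 E (heval_scale _ _ F_homog) => /eqP.
  by rewrite mulf_eq0 expf_eq0 (negPf a0) andbF heval_row3 => /eqP.
move=> /(plane_affine q_gt1 q_pchar smN z_prim F_powers)[x [y [v [on tE wE]]]].
exists x, y, v; split=> //; rewrite -tE -wE -PE.
by apply/eq_pt_of => //; [exact: row3_1neq0|exists a].
Qed.

Lemma psi_affine x y z (on : onX x y z) :
  psi (to_orbit H (exist _ _ (GK_points_affine q_gt1 on))) = plane_pt (x ^+ m) (z ^+ m).
Proof. by rewrite psi_to_orbit /= power_map_affine. Qed.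

Lemma psi_cases (O : XH) : (exists x y z, exists on : onX x y z,
    O = to_orbit H (exist _ _ (GK_points_affine q_gt1 on))) \/
  psi O = plane_inf.
Proof.
rewrite -[O]orbit_pointK; case: (orbit_point O) => P gP.
have [[x [y [z [PE on]]]]|PE] := GK_points_cases q_gt1 gP; [left|right].
  exists x, y, z, on; congr (to_orbit H _).
  by apply: eq_sig_hprop => // w; exact: Prop_irrelevance.
by rewrite psi_to_orbit /= PE power_map_infinity.
Qed.

Lemma range_psi : range psi = [set P | peval F P = 0].
Proof.
apply/seteqP; split=> P /=.
  case=> O _ <-; apply/plane_curve_cases.
  have [[x [y [z [on ->]]]]|->] := psi_cases O; last by right.
  by left; exists x, y, z; rewrite psi_affine.
move/plane_curve_cases => [[x [y [z [on ->]]]]|->].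
  by rewrite -(psi_affine on); exists (to_orbit H (exist _ _ (GK_points_affine q_gt1 on))).
exists (to_orbit H (exist _ _ (infinity_in_GK q_gt1 q_pchar))) => //.
by rewrite psi_to_orbit /= power_map_infinity.
Qed.

Lemma range_psi_zero P : range psi P -> peval F P = 0.
Proof. by rewrite range_psi. Qed.

Lemma same_orbit x y z x' y' z' (on : onX x y z) (on' : onX x' y' z') :
  x = x' -> y = y' -> z ^+ m = z' ^+ m ->
  to_orbit H (exist _ _ (GK_points_affine q_gt1 on)) =
  to_orbit H (exist _ _ (GK_points_affine q_gt1 on')).
Proof.
move=> xx yy zz; apply/to_orbitP => /=; have [z'0|z'0] := eqVneq z' 0.
  exists 1; rewrite ?expr1n // rotate_affine mul1r xx yy.
  move: zz; rewrite z'0 expr0n eqn0Ngt m0 => /eqP.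
  by rewrite expf_eq0 m0 => /eqP ->.
have z0' : z != 0.
  by apply: contraTneq z'0 => zE; move: zz => /esym/eqP; rewrite zE expr0n eqn0Ngt m0 /= expf_eq0 m0 => /eqP ->; rewrite eqxx.
exists (z' / z); first by rewrite expr_div_n zz divff // expf_neq0.
by rewrite rotate_affine divfK // xx yy.
Qed.

Variables (K : fieldType) (phi : {rmorphism R3 -> K}).
Hypothesis phi_ker : forall P, phi P = 0 <-> vanishes q s P.
Local Notation phiP := (phi_plane phi m).
Hypothesis phi_gen : forall a, exists d (P Q : R3),
  [/\ P \is d.-homog, Q \is d.-homog, phiP Q != 0 & a = phiP P / phiP Q].

Lemma power_tuple_eval (G : R3) a b c d :
  heval (G \mPo power_tuple) (row4 a b c d) = G.@[vec3 (a ^+ m) (b ^+ m) (d ^+ m)].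
Proof.
rewrite /heval comp_mpoly_meval; congr (G.@[_]).
by apply/funext; apply: ord3P; rewrite (tnth_nth 0) /= rmorphXn /= mevalXU mxE.
Qed.

(** Vanishing at the affine points suffices, because a form in the [m]-th powers of
    the space coordinates that vanishes at the affine points vanishes at infinity. *)
Lemma phi_plane_ker d (G : R3) : G \is d.-homog ->
  (phiP G = 0 <-> forall P : pt k 2, peval F P = 0 -> peval G P = 0).
Proof.
move=> hG; rewrite (phi_planeE phi_ker); split.
  move=> G0 P /plane_curve_cases[[x [y [z [on ->]]]]|->]; apply/eqP.
    by rewrite (peval_plane _ _ hG) (G0 x y (z ^+ m)) //; exact/on_quotient.
  rewrite (peval_plane_inf hG).
  have hG' : G \mPo power_tuple \is (m * d).-homog.
    apply: comp_homog hG; apply: ord3P; rewrite (tnth_nth 0) /=; exact: homogXn.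
  have := form_at_infinity q_gt1 q_pchar hG'; rewrite power_tuple_eval expr1n expr0n.
  rewrite eqn0Ngt m0 => -> // x y z on; rewrite power_tuple_eval expr1n.
  by rewrite (G0 x y) //; exact/on_quotient.
move=> v x y w on; have [z zm] := nth_root_exists w m0; apply/eqP; rewrite -(peval_plane _ _ hG).
by apply/eqP/v/plane_curve_cases; left; exists x, y, z; rewrite zm on_quotient zm.
Qed.

(** The inverse of the embedding where [D] does not vanish: a common denominator
    for [x] and [y] as functions of the plane coordinates. *)
Lemma inverse_forms : exists d (D X Y : R3),
  [/\ D \is d.-homog, X \is d.-homog, Y \is d.-homog, phiP D != 0 &
   forall x y w, onC x y w -> X.@[vec3 1 (x ^+ m) w] = D.@[vec3 1 (x ^+ m) w] * x /\
     Y.@[vec3 1 (x ^+ m) w] = D.@[vec3 1 (x ^+ m) w] * y].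
Proof.
have [d [P [Q [hP hQ Q0 xE]]]] := phi_gen (phi 'X_o0).
have [d' [P' [Q' [hP' hQ' Q'0 yE]]]] := phi_gen (phi 'X_o1).
exists (d + d')%N, (Q * Q'), (P * Q'), (Q * P'); split; try exact: dhomogM.
  by rewrite rmorphM mulf_neq0.
have /(phi_eq phi_ker) ex : phi (P \mPo plane_tuple k m) = phi ('X_o0 * (Q \mPo plane_tuple k m)).
  by rewrite rmorphM xE divfK.
have /(phi_eq phi_ker) ey : phi (P' \mPo plane_tuple k m) = phi ('X_o1 * (Q' \mPo plane_tuple k m)).
  by rewrite rmorphM yE divfK.
move=> x y w on; have := ex x y w on; have := ey x y w on.
rewrite !mevalM !mevalXU !plane_tuple_eval => -> ->; split; rewrite /vec3 /=; ring.
Qed.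

Section InverseForms.
Variables (dD : nat) (D X Y : R3).
Hypothesis D_homog : D \is dD.-homog.
Hypothesis X_homog : X \is dD.-homog.
Hypothesis Y_homog : Y \is dD.-homog.
Hypothesis DXY : forall x y w, onC x y w ->
  X.@[vec3 1 (x ^+ m) w] = D.@[vec3 1 (x ^+ m) w] * x /\
  Y.@[vec3 1 (x ^+ m) w] = D.@[vec3 1 (x ^+ m) w] * y.

(** Substituting [X / D] and [Y / D] for [x] and [y] and clearing denominators; the
    padding with powers of [D] and of the first coordinate makes the result
    homogeneous. *)
Lemma substitute_forms (g : R3) e : (msize g <= e)%N -> exists E : R3,
  E \is (dD * e + e).-homog /\ forall x y w, onC x y w ->
    E.@[vec3 1 (x ^+ m) w] = D.@[vec3 1 (x ^+ m) w] ^+ e * g.@[vec3 x y w].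
Proof.
move=> ge; have le u : u \in msupp g -> (u o0 + u o1 <= e)%N /\ (u o2 <= e)%N.
  move=> ug; have : (mdeg u <= e)%N by apply: leq_trans ge; exact: ltnW (msize_mdeg_lt ug).
  by rewrite mdegE big3 /=; lia.
exists (\sum_(u <- msupp g) g@_u *: (X ^+ u o0 * Y ^+ u o1 * D ^+ (e - (u o0 + u o1)) *
   ('X_o2 ^+ u o2 * 'X_o0 ^+ (e - u o2)))); split.
  rewrite big_seq; apply: rpred_sum => u /le[l1 l2]; apply: rpredZ; apply: dhomogM.
    have -> : (dD * e = dD * u o0 + dD * u o1 + dD * (e - (u o0 + u o1)))%N.
      by rewrite -!mulnDr subnKC.
    by do 2 ?apply: dhomogM; apply: dhomogMn.
  by rewrite -[X in X.-homog](subnKC l2); apply: dhomogM; exact: homogXn.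
move=> x y w on; have [ex ey] := DXY on; rewrite raddf_sum [g.@[_]]eval3E mulr_sumr.
apply: eq_big_seq => u /le[l1 l2] /=; rewrite mevalZ !mevalM !rmorphXn /= !mevalXU ex ey.
rewrite -[in RHS](subnKC l1) !exprD !exprMn expr1n /vec3 /=; ring.
Qed.

(** The points at finite distance, where the cover by the curve is unramified and
    where [X / D] and [Y / D] are defined. *)
Definition good_locus (P : pt k 2) := peval ('X_o0 * 'X_o2 * D) P != 0.

Lemma good_homog : 'X_o0 * 'X_o2 * D \is (1 + 1 + dD).-homog.
Proof. by do 2 ?apply: dhomogM => //; exact: homogX. Qed.

Lemma good_point (P : pt k 2) : peval F P = 0 -> good_locus P ->
  exists x y z, [/\ onX x y z, P = plane_pt (x ^+ m) (z ^+ m), z != 0 &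
    D.@[vec3 1 (x ^+ m) (z ^+ m)] != 0].
Proof.
rewrite /good_locus => /plane_curve_cases[[x [y [z [on ->]]]]|->].
  rewrite (peval_plane _ _ good_homog) !mevalM !mevalXU mul1r mulf_eq0 negb_or.
  case/andP=> z1 D1; exists x, y, z; split=> //.
  by move: z1; rewrite expf_eq0 m0.
by rewrite (peval_plane_inf good_homog) !mevalM !mevalXU !mul0r eqxx.
Qed.

Lemma good_injective (O O' : XH) : good_locus (psi O) -> psi O = psi O' -> O = O'.
Proof.
move=> gO e; have fO : peval F (psi O) = 0.
  by have : range psi (psi O) by [exists O]; rewrite range_psi.
have [[x [y [z [on OE]]]]|OE] := psi_cases O; last first.
  by move: gO; rewrite /good_locus OE (peval_plane_inf good_homog) !mevalM !mevalXU !mul0r eqxx.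
have [[x' [y' [z' [on' OE']]]]|OE'] := psi_cases O'; last first.
  by move: e; rewrite OE OE' psi_affine => /plane_pt_inf.
move: e gO; rewrite OE OE' !psi_affine => /plane_pt_inj[ex ez].
rewrite /good_locus (peval_plane _ _ good_homog) !mevalM !mevalXU mul1r mulf_eq0 negb_or.
case/andP=> _ D1.
have [ax ay] := DXY ((on_quotient x y z).1 on).
have [ax' ay'] := DXY ((on_quotient x' y' z').1 on').
rewrite -ex -ez in ax' ay'; apply: same_orbit => //; apply: (mulfI D1).
  by rewrite -ax -ax'.
by rewrite -ay -ay'.
Qed.

Lemma good_neq0 : phiP D != 0 -> exists O : XH, good_locus (psi O).
Proof.
move=> D_neq0; apply: contrapT => /forallNP no; have : phiP ('X_o0 * 'X_o2 * D) = 0.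
  apply/(phi_plane_ker good_homog) => P fP; have : range psi P by rewrite range_psi.
  by case=> O _ <-; apply/eqP; apply: contrapT => /negP; exact: no.
apply/eqP; rewrite !rmorphM !phi_planeX // mul1r mulf_neq0 //.
apply/eqP => /phi_ker v; have [x [y on]] := curve_over s q_gt1 (pchar_nat_eq0 q_gt1 q_pchar) 1.
by have /eqP := v _ _ _ on; rewrite mevalXU /vec3 /= oner_eq0.
Qed.

Definition good_set : set (subspace (range psi)) := [set Q | good_locus (sval Q)].

Variable chi : subspace good_set -> XH.
Hypothesis psi_chi : forall w, psi (chi w) = sval (sval w).

Lemma chi_point (w : subspace good_set) : exists x y z, exists on : onX x y z,
  [/\ z != 0, D.@[vec3 1 (x ^+ m) (z ^+ m)] != 0, sval (sval w) = plane_pt (x ^+ m) (z ^+ m) &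
    chi w = to_orbit H (exist _ _ (GK_points_affine q_gt1 on))].
Proof.
have gw : good_locus (sval (sval w)) := svalP w.
have fw : peval F (sval (sval w)) = 0 := range_psi_zero (svalP (sval w)).
have [x [y [z [on wE z1 D1]]]] := good_point fw gw; exists x, y, z, on; split=> //.
by apply: good_injective; rewrite psi_chi // psi_affine.
Qed.

(** The group moves [z] but not [z ^ m], so the coefficients of a form as a
    polynomial in [z] of degree less than [m] are invariant. *)
Lemma form_coefficients (G : R4) : exists g : 'I_m -> R3, forall x y z zeta,
  zeta ^+ m = 1 -> heval G (row4 1 x y (zeta * z)) =
    \sum_(l < m) (g l).@[vec3 x y (z ^+ m)] * z ^+ l * zeta ^+ l.
Proof.
have [g gE] := power_decomposition (G \mPo tuple4 1 'X_o0 'X_o1 'X_o2) m0.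
exists g => x y z zeta zm; have := gE x y (zeta * z).
rewrite tuple4_eval !mevalXU meval1 => ->; apply: eq_bigr => l _.
by rewrite !exprMn zm mul1r -mulrA [z ^+ l * _]mulrC.
Qed.

Lemma on_rotate x y z zeta : zeta ^+ m = 1 -> onX x y z -> onX x y (zeta * z).
Proof. by move=> zm /on_quotient on; apply/on_quotient; rewrite exprMn zm mul1r. Qed.

(** A form [G] with coefficients [g l] vanishes on a whole orbit, off [z = 0], exactly
    when all the [g l] do; the latter are forms in the plane coordinates by
    substitution. *)
Lemma chi_open (V : set XH) (w : subspace good_set) : opens XH V -> V (chi w) ->
  exists d (E : R3), [/\ E \is d.-homog, peval E (sval (sval w)) != 0 &
    forall w' : subspace good_set, peval E (sval (sval w')) != 0 -> V (chi w')].
Proof.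
have emb := embedded_subspace (GK_points q) (embedded_id k 3).
move=> oV; have [V4 oV4 VV4] := (emb.1 _).1 oV.
have VE P : V (to_orbit H P) <-> V4 (sval P).
  by have := congr1 (fun A => A P) VV4; rewrite /preimage /= => ->.
have [x [y [z [on [z1 D1 wE ->]]]]] := chi_point w.
move=> /VE/= V4P; have [d [G [hG GP GV]]] := (zariski_openP V4).1 oV4 _ V4P.
have [g gE] := form_coefficients G.
have [l gl] : exists l, (g l).@[vec3 x y (z ^+ m)] != 0.
  apply: contrapT => /forallNP no; case/eqP: GP; apply/eqP.
  rewrite (peval_eq0 (row4_1neq0 _ _ _) hG) -[z]mul1r gE ?expr1n //.
  rewrite big1 // => l _.
  by have /negP := no l; rewrite negbK => /eqP ->; rewrite !mul0r.
have [E [hE EE]] := substitute_forms (leqnn (msize (g l))).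
exists (dD * msize (g l) + msize (g l))%N, E; split=> //.
  rewrite wE (peval_plane _ _ hE) (EE x y); last exact/on_quotient.
  by rewrite mulf_neq0 // expf_neq0.
move=> w'; have [x' [y' [z' [on' [z1' D1' wE' ->]]]]] := chi_point w'.
rewrite wE' (peval_plane _ _ hE) (EE x' y'); last exact/on_quotient.
rewrite mulf_eq0 negb_or => /andP[_ gl'].
have [zeta [zm Gz]] : exists zeta, zeta ^+ m = 1 /\ heval G (row4 1 x' y' (zeta * z')) != 0.
  apply: contrapT => /forallNP no; case/eqP: gl'.
  have := @prim_power_independent k m z0 (fun l => (g l).@[vec3 x' y' (z' ^+ m)] * z' ^+ l) z_prim.
  move=> /(_ _ l)/eqP; rewrite mulf_eq0 expf_eq0 (negPf z1') andbF orbF => h.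
  apply/eqP/h => zeta zm; apply/eqP; apply: contrapT => /negP nz; apply: (no zeta).
  by split=> //; rewrite gE.
have on2 := on_rotate zm on'.
rewrite (@same_orbit _ _ _ _ _ _ on' on2) //; last by rewrite exprMn zm mul1r.
by apply/VE/GV; rewrite (peval_eq0 (row4_1neq0 _ _ _) hG).
Qed.

Variables (KX : fieldType) (phiX : {rmorphism R3 -> KX}).
Hypothesis phiX_ker : forall P, phiX P = 0 <-> vanishes q N P.

(** Let the invariant function [g] be [G / G'] upstairs.  Comparing the coefficients
    of the powers of [z] in [g G' = G] expresses [g] as a quotient of invariant
    coefficients, which are forms in the plane coordinates by substitution. *)
Lemma chi_regular (V : set XH) g (w : subspace good_set) : opens XH V -> regular XH V g ->
  V (chi w) -> exists (d : nat) (A B : R3),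
   [/\ A \is d.-homog, B \is d.-homog, peval B (sval (sval w)) != 0 &
    forall w' : subspace good_set, V (chi w') -> peval B (sval (sval w')) != 0 ->
     g (chi w') = peval A (sval (sval w')) / peval B (sval (sval w'))].
Proof.
have emb := embedded_subspace (GK_points q) (embedded_id k 3).
move=> oV rg; have rg' := (emb.2 _ _).1 rg.
have [x [y [z [on [z1 D1 wE ->]]]]] := chi_point w => VP.
have [V4 [d [G [G' [[oV4 V4P] hG hG' GE]]]]] := rg' _ VP.
have glob := local_ratio_global emb (phi_GK_ker q_gt1 phiX_ker) oV rg' VP oV4 V4P hG hG' GE.
have {glob} glob x' y' z' (on' : onX x' y' z') :
    V (to_orbit H (exist _ _ (GK_points_affine q_gt1 on'))) ->
    g (to_orbit H (exist _ _ (GK_points_affine q_gt1 on'))) * heval G' (row4 1 x' y' z') =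
    heval G (row4 1 x' y' z').
  move=> /glob /=; have [c c0 cE] := peval_pt_of (row4_1neq0 x' y' z').
  rewrite (cE _ _ hG) (cE _ _ hG') mulrCA; exact/mulfI/expf_neq0.
have [G'P _] := GE _ VP V4P.
have [a aE] := form_coefficients G; have [b bE] := form_coefficients G'.
have [l bl] : exists l, (b l).@[vec3 x y (z ^+ m)] != 0.
  apply: contrapT => /forallNP no; case/eqP: G'P; apply/eqP.
  rewrite (peval_eq0 (row4_1neq0 _ _ _) hG') -[z]mul1r bE ?expr1n //.
  rewrite big1 // => l _.
  by have /negP := no l; rewrite negbK => /eqP ->; rewrite !mul0r.
pose e := maxn (msize (a l)) (msize (b l)).
have [A [hA AE]] := @substitute_forms (a l) e (leq_maxl _ _).
have [B [hB BE]] := @substitute_forms (b l) e (leq_maxr _ _).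
exists (dD * e + e)%N, A, B; split=> //.
  rewrite wE (peval_plane _ _ hB) (BE x y); last exact/on_quotient.
  by rewrite mulf_neq0 // expf_neq0.
move=> w'; have [x' [y' [z' [on' [z1' D1' -> ->]]]]] := chi_point w'.
rewrite (peval_ratio _ _ hA hB) (peval_plane _ _ hB) => V'.
have onC' := (on_quotient x' y' z').1 on'.
rewrite (AE _ _ _ onC') (BE _ _ _ onC') mulf_eq0 negb_or => /andP[De0 bl'].
rewrite invfM mulrACA divff // mul1r; set v := g _.
suff h : v * ((b l).@[vec3 x' y' (z' ^+ m)] * z' ^+ l) - (a l).@[vec3 x' y' (z' ^+ m)] * z' ^+ l = 0.
  apply/esym/(canLR (mulfK bl')); apply: (mulIf (expf_neq0 l z1')).
  by apply/esym/eqP; rewrite -subr_eq0 -mulrA h.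
apply: (@prim_power_independent k m z0 (fun l => v * ((b l).@[vec3 x' y' (z' ^+ m)] * z' ^+ l)
   - (a l).@[vec3 x' y' (z' ^+ m)] * z' ^+ l) z_prim _ l) => zeta zm.
have on2 := on_rotate zm on'.
have oE : to_orbit H (exist _ _ (GK_points_affine q_gt1 on')) =
          to_orbit H (exist _ _ (GK_points_affine q_gt1 on2)).
  by apply: same_orbit => //; rewrite exprMn zm mul1r.
have := glob _ _ _ on2; rewrite -oE => /(_ V'); rewrite -/v (aE _ _ _ _ zm) (bE _ _ _ _ zm) => E.
under eq_bigr do rewrite mulrBl -mulrA; rewrite sumrB -E mulr_sumr.
by rewrite subrr.
Qed.

Lemma chi_morphism : morphism chi.
Proof.
have emb : embedded (fun w : subspace good_set => sval (sval w) : pt k 2).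
  exact: (embedded_subspace good_set (embedded_subspace (range psi) (embedded_id k 2))).
move=> V oV; have oc : opens (subspace good_set) (chi @^-1` V).
  apply/emb.1; exists [set P | exists d E, [/\ E \is d.-homog, peval E P != 0 &
      forall w' : subspace good_set, peval E (sval (sval w')) != 0 -> V (chi w')]].
    apply/zariski_openP => P [d [E [hE EP EV]]]; exists d, E; split=> // Q EQ.
    by exists d, E.
  apply/seteqP; split=> w /=; first by move/(chi_open oV).
  by case=> d [E [_ Ew EV]]; exact: EV.
split=> // g rg; apply/emb.2 => w Vw.
have [d [A [B [hA hB Bw e]]]] := chi_regular oV rg Vw.
exists [set P | peval B P != 0], d, A, B; split=> //.
  by split=> //; exact: zariski_openD hB.
by move=> w' Vw' Bw'; split=> //; exact: e.
Qed.

End InverseForms.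

Variables (KX : fieldType) (phiX : {rmorphism R3 -> KX}).
Hypothesis phiX_ker : forall P, phiX P = 0 <-> vanishes q N P.

Theorem psi_birational : birational_embedding psi.
Proof.
split; first exact: psi_morphism.
have [d [D [X [Y [hD hX hY D0 DXY]]]]] := inverse_forms.
have pre (w : subspace (good_set D)) : exists O : XH, psi O = sval (sval w).
  by case: (svalP (sval w)) => O _ e; exists O.
have [chi chiE] := choice pre.
exists (good_set D), chi; split=> //.
- apply: ((embedded_subspace (range psi) (embedded_id k 2)).1 _).2.
  by exists [set P | good_locus D P] => //; exact: zariski_openD (good_homog hD).
- have [O gO] := good_neq0 hD D0.
  by exists (exist _ (psi O) (ex_intro2 _ _ O I erefl)).
- exact: (chi_morphism hD hX hY DXY chiE phiX_ker).
- move=> O w e; apply: (good_injective hD DXY); rewrite chiE; last by [].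
  exact: (svalP w).
Qed.

End Embedding.

(** * Irreducibility of the plane equation *)

Lemma mpoly_morph_eq (k K : nzRingType) n (f g : {rmorphism {mpoly k[n]} -> K}) :
  (forall c, f c%:MP = g c%:MP) -> (forall i, f 'X_i = g 'X_i) -> f =1 g.
Proof.
move=> fgC fgX P; rewrite (mpolyE P) !rmorph_sum; apply: eq_bigr => u _.
rewrite -mul_mpolyC !rmorphM fgC mpolyXE_id !rmorph_prod; congr (_ * _).
by apply: eq_bigr => i _; rewrite !rmorphXn fgX.
Qed.

Section Irreducible.
Variables (k : closedFieldType) (K : fieldType) (phi : {rmorphism {mpoly k[3]} -> K}).
Local Notation R3 := {mpoly k[3]}.

Definition component (P : R3) d : R3 := \sum_(u <- msupp P | mdeg u == d) P@_u *: 'X_[u].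

Lemma component_homog P d : component P d \is d.-homog.
Proof.
by apply: rpred_sum => u /eqP ud; apply: rpredZ; rewrite dhomogX /= ud.
Qed.

Lemma component_neq0 P u : u \in msupp P -> component P (mdeg u) != 0.
Proof.
move=> uP; apply/eqP => /(congr1 (mcoeff u)); rewrite raddf_sum mcoeff0 /=.
rewrite (big_rem u uP) /= eqxx mcoeffZ mcoeffX eqxx mulr1 big1_seq ?addr0.
  by apply/eqP; rewrite -mcoeff_msupp.
move=> v; rewrite mem_rem_uniq ?msupp_uniq // inE => /andP[_ /andP[vu _]].
by rewrite mcoeffZ mcoeffX (negPf vu) mulr0.
Qed.

Lemma component_of_homog P d e : P \is d.-homog -> phi P = 0 -> phi (component P e) = 0.
Proof.
move=> /dhomogP hP P0; have [->|ed] := eqVneq e d.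
  rewrite /component big_seq_cond (eq_bigl (fun u => u \in msupp P)); last first.
    by move=> u; case: (boolP (u \in msupp P)) => //= /hP ->; rewrite eqxx.
  by rewrite -big_seq -mpolyE.
rewrite /component big_seq_cond big_pred0 ?rmorph0 // => u.
by apply/negP => /andP[/hP /= ->]; rewrite eq_sym (negPf ed).
Qed.

(** Restricting a polynomial to the cone over a generic point turns a product
    into a product of polynomials in the homogeneity parameter. *)
Definition cone_poly : {rmorphism R3 -> {poly K}} :=
  mmap (polyC \o (phi \o @mpolyC 3 k)) (fun i => (phi 'X_i)%:P * 'X).

Lemma cone_polyE P : cone_poly P = \sum_(u <- msupp P) phi (P@_u *: 'X_[u]) *: 'X^(mdeg u).
Proof.
rewrite {1}(mpolyE P) rmorph_sum; apply: eq_bigr => u _.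
rewrite -!mul_mpolyC !rmorphM /cone_poly /= mmapC mmapX /mmap1 /=.
under eq_bigr do rewrite exprMn -rmorphXn /=.
rewrite big_split /= -expr_sum -mdegE mpolyXE_id rmorph_prod /= -mul_polyC.
rewrite polyCM -mulrA; congr (_ * (_ * _)); rewrite rmorph_prod /=.
by apply: eq_bigr => i _; rewrite (rmorphXn phi).
Qed.

Lemma cone_poly_coef P d : (cone_poly P)`_d = phi (component P d).
Proof. by rewrite cone_polyE poly_sum_coef /component rmorph_sum. Qed.

(** On the cone over the generic point a product vanishes only if one of the
    factors does.  The homogeneous components of that factor then vanish on the
    curve, so their degrees are at least [d] and the other factor is constant. *)
Lemma irreducible_of_degree (F : R3) d : F \is d.-homog -> F != 0 -> F \isn't a GRing.unit ->
  phi F = 0 -> (forall e (P : R3), P \is e.-homog -> P != 0 -> phi P = 0 -> (d <= e)%N) ->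
  irreducible_mpoly F.
Proof.
move=> hF F0 Fu vF deg; split=> // G H FGH.
have [G0 H0] : G != 0 /\ H != 0.
  by move: F0; rewrite FGH mulf_eq0 negb_or => /andP.
have unit_of P Q : P != 0 -> Q != 0 -> F = P * Q -> cone_poly P = 0 -> Q \is a GRing.unit.
  move=> P0 Q0 FPQ cP; have Fs : msize F = d.+1.
    have : F \is (msize F).-1.-homog by exact: dhomog_msize hF.
    by move/(dhomog_uniq F0 hF) => ->; rewrite prednK // lt0n msize_poly_eq0.
  have [u uP] : exists u, u \in msupp P.
    by move: P0; rewrite -msupp_eq0; case: (msupp P) => // u r _; exists u; rewrite mem_head.
  have du : (d <= mdeg u)%N.
    apply: (deg _ _ (component_homog P (mdeg u)) (component_neq0 uP)).
    by rewrite -cone_poly_coef cP coef0.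
  have := msizeM P0 Q0; rewrite -FPQ Fs => sz.
  have lt := msize_mdeg_lt uP.
  have : (msize Q <= 1)%N by move: sz lt du; move: (mmeasure _ P) (mmeasure _ Q) (mdeg u) => i j l; lia.
  move=> /msize1_polyC QC; move: Q0; rewrite QC mpolyC_eq0 => c0.
  apply/unitrP; exists (Q@_0)^-1%:MP; rewrite -!mpolyCM mulVf // mulfV //.
have /eqP : cone_poly (G * H) = 0.
  by apply/polyP => e; rewrite cone_poly_coef coef0 -FGH; exact: component_of_homog hF vF.
rewrite rmorphM mulf_eq0 => /orP[/eqP cG|/eqP cH]; [right|left].
  exact: (unit_of G H).
by apply: (unit_of H G) => //; rewrite mulrC.
Qed.

End Irreducible.

(** * Galois points from the function field *)

Section GaloisPoint.
Variables (k : closedFieldType).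
Local Notation R3 := {mpoly k[3]}.
Local Notation R2 := {mpoly k[2]}.
Variables (K0 : fieldType) (phi0 : {rmorphism {poly k} -> K0}).
Hypothesis phi0_ker : forall c, phi0 c = 0 <-> c = 0.
Hypothesis phi0_frac : forall a, exists c d, phi0 d != 0 /\ a = phi0 c / phi0 d.

Definition i0 : 'I_2 := ord0.
Definition i1 : 'I_2 := lift ord0 ord0.
Definition vec2 (R : Type) (x y : R) (i : 'I_2) : R := if i == i0 then x else y.

Lemma ord2P (P : 'I_2 -> Prop) : P i0 -> P i1 -> forall i, P i.
Proof.
move=> P0 P1 [[|[|//]] h].
- by rewrite (_ : Ordinal h = i0) //; apply: val_inj.
- by rewrite (_ : Ordinal h = i1) //; apply: val_inj.
Qed.

Definition row2 (a b : k) : 'rV[k]_2 := \row_i vec2 a b i.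

Lemma heval_row2 G a b : heval G (row2 a b) = G.@[vec2 a b].
Proof. by rewrite /heval; congr (G.@[_]); apply/funext => i; rewrite mxE. Qed.

Lemma row2_eq0 a b : (row2 a b == 0) = (a == 0) && (b == 0).
Proof.
apply/eqP/andP => [e|[/eqP-> /eqP->]].
  have h i : row2 a b 0 i = 0 by rewrite e mxE.
  by have := (h i0, h i1); rewrite !mxE /vec2 /= => -[-> ->].
by apply/rowP; apply: ord2P; rewrite !mxE.
Qed.

(** The affine coordinate on the projective line is the ratio of the second
    coordinate to the first. *)
Definition line_poly : {rmorphism R2 -> {poly k}} := mmap (@polyC k) (vec2 1 'X).

Lemma line_polyE (G : R2) t : (line_poly G).[t] = G.@[vec2 1 t].
Proof.
rewrite [in LHS](mpolyE G) [in RHS](mpolyE G) !rmorph_sum horner_sum; apply: eq_bigr => u _.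
rewrite -mul_mpolyC !rmorphM hornerM /line_poly /= mmapC hornerC mevalC mmapX mevalX /mmap1.
rewrite horner_prod; congr (_ * _); apply: eq_bigr => i _; rewrite horner_exp.
by congr (_ ^+ _); move: i; apply: ord2P; rewrite /vec2 /= ?hornerC ?hornerX.
Qed.

Lemma line_poly_eq0 d (G : R2) : G \is d.-homog -> line_poly G = 0 -> G = 0.
Proof.
move=> /dhomogP hG G0; apply/mpolyP => u; rewrite mcoeff0.
have [uG|/memN_msupp_eq0 //] := boolP (u \in msupp G).
have : (line_poly G)`_(u i1) = 0 by rewrite G0 coef0.
have -> : line_poly G = \sum_(v <- msupp G) G@_v *: 'X^(v i1).
  rewrite {1}(mpolyE G) rmorph_sum; apply: eq_bigr => v _.
  rewrite -mul_mpolyC -mul_polyC rmorphM /line_poly /= mmapC mmapX /mmap1.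
  by rewrite !big_ord_recl big_ord0 /vec2 /= expr1n mul1r mulr1.
rewrite poly_sum_coef (big_rem u uG) /= eqxx big1_seq ?addr0 // => v.
rewrite mem_rem_uniq ?msupp_uniq // inE => /andP[/eqP e1 /andP[vu vG]].
case/eqP: vu; apply/mnmP; apply: ord2P => //.
have /= := hG v vG; have /= := hG u uG; rewrite !mdegE !big_ord_recl !big_ord0 /= !addn0.
by move: e1; rewrite -!/i0 -!/i1 => -> <- /addIn.
Qed.

Definition phi_line : {rmorphism R2 -> K0} := phi0 \o line_poly.

Lemma phi_line_ker d (G : R2) : G \is d.-homog ->
  (phi_line G = 0 <-> forall P : proj_space k 1, peval G (id P) = 0).
Proof.
move=> hG; rewrite /phi_line /= phi0_ker; split.
  by move=> /(line_poly_eq0 hG) -> P; rewrite /peval meval0.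
move=> v; apply: poly_eq0_horner => t; rewrite line_polyE -heval_row2; apply/eqP.
by rewrite -(peval_eq0 _ hG) ?row2_eq0 ?oner_eq0 //; apply/eqP; exact: v.
Qed.

Lemma phi_line_gen a : exists d (G H : R2),
  [/\ G \is d.-homog, H \is d.-homog, phi_line H != 0 & a = phi_line G / phi_line H].
Proof.
have lift (c : {poly k}) : exists P : R2, line_poly P = c.
  exists (\sum_(i < size c) c`_i *: 'X_i1 ^+ i).
  rewrite rmorph_sum -[RHS]coefK poly_def; apply: eq_bigr => i _.
  rewrite -mul_mpolyC rmorphM rmorphXn /line_poly /= mmapC mmapX mmap1U /vec2 /=.
  by rewrite mul_polyC.
have [c [d [d0 ->]]] := phi0_frac a; have [P <-] := lift c; have [Q Qd] := lift d.
have X0 : phi_line 'X_i0 = 1 by rewrite /phi_line /line_poly /= mmapX mmap1U /= rmorph1.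
have [d1 h1] := homogenize P i0; have [d2 h2] := homogenize Q i0.
have [P' [hP eP]] := h1 (maxn d1 d2) (leq_maxl _ _).
have [Q' [hQ eQ]] := h2 (maxn d1 d2) (leq_maxr _ _).
exists (maxn d1 d2), P', Q'; rewrite (eP _ phi_line) // (eQ _ phi_line) //.
by rewrite /phi_line /= Qd.
Qed.

Variables (C : set (proj_space k 2)) (K : fieldType) (phi : {rmorphism R3 -> K}).
Hypothesis phi_ker : forall d (G : R3), G \is d.-homog ->
  (phi G = 0 <-> forall P : subspace C, peval G (sval P) = 0).
Hypothesis phi_gen : forall a, exists d (P Q : R3),
  [/\ P \is d.-homog, Q \is d.-homog, phi Q != 0 & a = phi P / phi Q].
Variable iota : {rmorphism K0 -> K}.
Variables (a b : 'I_3).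
Hypothesis ab : (a == o0) && (b == o1) || (a == o1) && (b == o0).
Hypothesis iotaC : forall c, phi c%:MP = iota (phi0 c%:P).
Hypothesis iotaX : phi 'X_o2 = iota (phi0 'X).
Hypothesis phi_a : phi 'X_a = 1.
Hypothesis iota_galois : galois_extension iota.
(* The projection meets every affine point, so preimages of nonempty opens are
   nonempty. *)
Hypothesis C_onto : forall w, exists2 P : proj_space k 2, C P &
  coords P 0 a != 0 /\ coords P 0 o2 = w * coords P 0 a.

Definition center : proj_space k 2 := pt_of (\row_i (i == b)%:R).

Lemma coord_cases (Q : 'I_3 -> Prop) : Q a -> Q b -> Q o2 -> forall i, Q i.
Proof.
by case/orP: ab => /andP[/eqP -> /eqP ->] Qa Qb Q2; apply: ord3P.
Qed.

Lemma ab_neq : (a == b = false) * (b == a = false) * (o2 == a = false) * (o2 == b = false)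
  * (a == o2 = false) * (b == o2 = false).
Proof. by case/orP: ab => /andP[/eqP -> /eqP ->]. Qed.

Lemma center_row_neq0 : (\row_i (i == b)%:R : 'rV[k]_3) != 0.
Proof. by apply/eqP => /rowP/(_ b)/eqP; rewrite !mxE eqxx oner_eq0. Qed.

Lemma center_coords : exists2 c, c != 0 & coords center = c *: \row_i (i == b)%:R.
Proof. exact: coords_pt_of center_row_neq0. Qed.

Lemma not_centerP (P : proj_space k 2) : P <> center <->
  (coords P 0 a != 0) || (coords P 0 o2 != 0).
Proof.
split=> [nP|]; last first.
  have [c c0 cE] := center_coords.
  by move=> h e; move: h; rewrite e cE !mxE !ab_neq !mulr0 eqxx.
rewrite -negb_and; apply/negP => /andP[/eqP Pa /eqP P2]; apply: nP.
rewrite -(pt_of_coords P); apply/eq_pt_of; [exact: coords_neq0|exact: center_row_neq0|].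
have E : coords P = coords P 0 b *: \row_i (i == b)%:R.
  by apply/rowP; apply: coord_cases; rewrite !mxE ?eqxx ?ab_neq ?mulr0 ?mulr1.
exists (coords P 0 b) => //; apply/eqP => b0; have := coords_neq0 P.
by rewrite E b0 scale0r eqxx.
Qed.

Definition proj_mx : 'M[k]_(3, 2) := \matrix_(i < 3, j < 2) (i == vec2 a o2 j)%:R.

Lemma proj_mxE (v : 'rV[k]_3) : v *m proj_mx = row2 (v 0 a) (v 0 o2).
Proof.
apply/rowP => j; rewrite !mxE (bigD1 (vec2 a o2 j)) //= mxE eqxx mulr1 big1 ?addr0.
  by move: j; apply: ord2P.
by move=> i /negPf ne; rewrite mxE ne mulr0.
Qed.

Lemma proj_mx_from : projection_from center proj_mx.
Proof.
split.
  apply/eqP; rewrite -[_ == _]/(row_full proj_mx); apply/row_fullP; exists proj_mx^T.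
  apply/matrixP => i j; rewrite !mxE (bigD1 (vec2 a o2 i)) //= !mxE eqxx mul1r big1 ?addr0.
    by move: i j; apply: ord2P; apply: ord2P; rewrite /vec2 /= ?eqxx ?ab_neq.
  by move=> l /negPf ne; rewrite !mxE ne mul0r.
have [c c0 ->] := center_coords.
by rewrite proj_mxE; apply/eqP; rewrite row2_eq0 !mxE !ab_neq !mulr0 eqxx.
Qed.

Definition line_tuple : 2.-tuple R3 := [tuple 'X_a; 'X_o2].

Lemma line_tuple_homog d (G : R2) : G \is d.-homog -> G \mPo line_tuple \is d.-homog.
Proof.
move=> hG; rewrite -[d]mul1n; apply: comp_homog hG; apply: ord2P;
  rewrite (tnth_nth 0) /=; exact: homogX.
Qed.

Lemma line_tuple_eval (G : R2) (P : proj_space k 2) :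
  peval (G \mPo line_tuple) P = heval G (row2 (coords P 0 a) (coords P 0 o2)).
Proof.
rewrite /peval comp_mpoly_meval heval_row2; congr (G.@[_]); apply/funext.
by apply: ord2P; rewrite (tnth_nth 0) /= mevalXU.
Qed.

Lemma phi_line_tuple (G : R2) : phi (G \mPo line_tuple) = iota (phi_line G).
Proof.
apply: (mpoly_morph_eq (f := phi \o comp_mpoly line_tuple) (g := iota \o phi_line)).
  by move=> c; rewrite /= comp_mpolyC iotaC /phi_line /line_poly /= mmapC.
apply: ord2P; rewrite /= comp_mpolyXU /phi_line /line_poly /= mmapX mmap1U /vec2 /=.
  by rewrite phi_a !rmorph1.
exact: iotaX.
Qed.

Lemma projection_pullback (P : proj_space k 2) : P <> center -> exists2 c, c != 0 &
  forall d (G : R2), G \is d.-homog ->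
    peval G (projection proj_mx P) = c ^+ d * peval (G \mPo line_tuple) P.
Proof.
move=> /not_centerP nP; have nz : row2 (coords P 0 a) (coords P 0 o2) != 0.
  by rewrite row2_eq0 negb_and.
have [c c0 cE] := peval_pt_of nz; exists c => // d G hG.
by rewrite /projection proj_mxE (cE _ _ hG) line_tuple_eval.
Qed.

Let emb : embedded (sval : subspace C -> pt k 2) := embedded_subspace C (embedded_id k 2).
Let line_emb := embedded_id k 1.

Lemma projection_dom_open V : opens (proj_space k 1) V ->
  opens (subspace C) (@projection_dom k C center proj_mx V).
Proof.
move=> oV; apply/emb.1.
exists [set P : pt k 2 | P <> center /\ V (projection proj_mx P)] => //.
apply/zariski_openP => P [nP VP].
have [d [G [hG GP GV]]] := (zariski_openP V).1 oV _ VP.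
have [i [Pi iab]] : exists i, coords P 0 i != 0 /\ (i == a) || (i == o2).
  by case/not_centerP/orP: nP => h; [exists a|exists o2]; rewrite h eqxx ?orbT.
exists (1 + d)%N, ('X_i * (G \mPo line_tuple)); split.
- by apply: dhomogM; [exact: homogX|exact: line_tuple_homog].
- have [c c0 cE] := projection_pullback nP; rewrite pevalM {1}/peval mevalXU mulf_neq0 //.
  by move: GP; rewrite (cE _ _ hG) mulf_eq0 negb_or => /andP[].
move=> Q; rewrite pevalM {1}/peval mevalXU mulf_eq0 negb_or => /andP[Qi GQ].
have nQ : Q <> center.
  by apply/not_centerP; case/orP: iab Qi => /eqP -> ->; rewrite ?orbT.
split=> //; apply: GV; have [c c0 cE] := projection_pullback nQ.
by rewrite (cE _ _ hG) mulf_neq0 // expf_neq0.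
Qed.

Lemma projection_dom_neq0 V : opens (proj_space k 1) V -> V !=set0 ->
  @projection_dom k C center proj_mx V !=set0.
Proof.
move=> oV [P VP]; have [d [G [hG GP GV]]] := (zariski_openP V).1 oV _ VP.
have [w Gw] : exists w, G.@[vec2 1 w] != 0.
  apply: contrapT => /forallNP no; case/eqP: GP; apply: ((phi_line_ker hG).1 _ P); apply/phi0_ker.
  apply: poly_eq0_horner => t; rewrite line_polyE; apply/eqP.
  by apply: contrapT => /negP; exact: no.
have [Q CQ [Qa Q2]] := C_onto w; exists (exist _ Q CQ); have nQ : Q <> center.
  by apply/not_centerP; rewrite Qa.
split=> //=; apply: GV; have [c c0 cE] := projection_pullback nQ.
rewrite (cE _ _ hG) mulf_neq0 ?expf_neq0 // line_tuple_eval Q2.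
have -> : row2 (coords Q 0 a) (w * coords Q 0 a) = coords Q 0 a *: row2 1 w.
  by apply/rowP; apply: ord2P; rewrite !mxE /vec2 /= ?mulr1 // mulrC.
by rewrite (heval_scale _ _ hG) heval_row2 mulf_neq0 // expf_neq0.
Qed.

(** Projection from the [b]-th coordinate point is given by the coordinates [X_a]
    and [X_2], and pulls the affine coordinate of the line back to [phi 'X_o2]; the
    pullback of function fields is therefore [iota]. *)
Theorem galois_point_center : galois_point C center.
Proof.
exists proj_mx; split; first exact: proj_mx_from.
exists K0, (@germ_in k 1 (proj_space k 1) id K0 phi_line).
exists K, (@germ_in k 2 (subspace C) sval K phi), iota; split=> //.
- exact: (function_field_of_germs line_emb phi_line_ker phi_line_gen).
- exact: (function_field_of_germs emb phi_ker phi_gen).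
move=> V h adm; have [oV V0 _] := adm; split; first exact: projection_dom_neq0.
have [c rc] := represents_exists line_emb phi_line_ker adm.
rewrite (germ_inE line_emb phi_line_ker oV V0 rc); apply/esym.
apply: (germ_inE emb phi_ker); [exact: projection_dom_open|exact: projection_dom_neq0|].
have [d [G [G' [hG hG' G'0 -> e]]]] := rc.
exists d, (G \mPo line_tuple), (G' \mPo line_tuple); split.
- exact: line_tuple_homog.
- exact: line_tuple_homog.
- by rewrite phi_line_tuple fmorph_eq0.
- by rewrite fmorph_div !phi_line_tuple.
move=> Q [nQ VQ]; have [c' c0 cE] := projection_pullback nQ.
have := e _ VQ; rewrite (cE _ _ hG) (cE _ _ hG') mulrCA; exact/mulfI/expf_neq0.
Qed.

End GaloisPoint.

(** * The plane curve and its two Galois points *)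

Section PlaneCurve.
Variables (k : closedFieldType) (q s m : nat).
Hypothesis q_gt1 : (1 < q)%N.
Hypothesis q_pchar : [pchar k].-nat q.
Local Notation N := (q ^ 2 - q + 1)%N.
Local Notation n := (q ^ 3 + 1)%N.
Local Notation R3 := {mpoly k[3]}.
Hypothesis smN : (s * m)%N = N.

Lemma factor_gt0 : (0 < s)%N.
Proof. by have := GK_exponent_gt0 q; rewrite -smN muln_gt0 => /andP[]. Qed.

Lemma factor_coprime : coprime q s.
Proof. by have := coprime_GK_exponent q_gt1; rewrite -smN coprimeMr => /andP[]. Qed.

(** Applied both to the quotient, with [t = s], and to the curve itself, with
    [t = N]. *)
Lemma curve_field t : (0 < t)%N -> coprime q t ->
  exists (K : fieldType) (phi : {rmorphism R3 -> K}), (forall P, phi P = 0 <-> vanishes q t P) /\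
    forall a, exists P Q, phi Q != 0 /\ a = phi P / phi Q.
Proof.
move=> t0 qt; have q0 := pchar_nat_eq0 q_gt1 q_pchar; apply: prime_ideal_field.
- by move=> x y w _; rewrite meval0.
- by move=> P Q hP hQ x y w on; rewrite mevalB hP // hQ // subrr.
- by move=> P Q hQ x y w on; rewrite mevalM hQ // mulr0.
- move=> h; have [x [y on]] := curve_over t q_gt1 q0 0.
  by have /eqP := h _ _ _ on; rewrite meval1 oner_eq0.
- exact: (vanishes_prime q_gt1 q0 t0 qt).
Qed.

Lemma line_field : exists (K0 : fieldType) (phi0 : {rmorphism {poly k} -> K0}),
  (forall c, phi0 c = 0 <-> c = 0) /\ forall a, exists c d, phi0 d != 0 /\ a = phi0 c / phi0 d.
Proof.
apply: (@prime_ideal_field _ (fun c : {poly k} => c = 0)) => //.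
- by move=> a b -> ->; rewrite subrr.
- by move=> a b ->; rewrite mulr0.
- by apply/eqP; exact: oner_neq0.
- by move=> a b /eqP; rewrite mulf_eq0 => /orP[] /eqP; [left|right].
Qed.

Definition swap_tuple : 3.-tuple R3 := [tuple 'X_o1; 'X_o0; 'X_o2].

Definition swap_pt (P : pt k 2) : pt k 2 :=
  pt_of (row3 (coords P 0 o1) (coords P 0 o0) (coords P 0 o2)).

Lemma swap_row_neq0 (P : pt k 2) : row3 (coords P 0 o1) (coords P 0 o0) (coords P 0 o2) != 0.
Proof.
have := coords_neq0 P; rewrite {1}(row3_coords (coords P)) !row3_eq0.
by rewrite !andbA [(coords P 0 o1 == 0) && _]andbC.
Qed.

Lemma swap_coords (P : pt k 2) : exists2 c, c != 0 &
  coords (swap_pt P) = row3 (c * coords P 0 o1) (c * coords P 0 o0) (c * coords P 0 o2).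
Proof.
have [c c0 cE] := coords_pt_of (swap_row_neq0 P).
by exists c => //; rewrite /swap_pt cE row3_scale.
Qed.

Lemma swap_ptK : involutive swap_pt.
Proof.
move=> P; have [c c0 cE] := swap_coords P.
rewrite -[RHS]pt_of_coords; apply/eq_pt_of; [exact: swap_row_neq0|exact: coords_neq0|].
by exists c => //; rewrite cE !mxE /vec3 /= -row3_scale -row3_coords.
Qed.

Lemma swap_tuple_homog d (G : R3) : G \is d.-homog -> G \mPo swap_tuple \is d.-homog.
Proof.
move=> hG; rewrite -[d]mul1n; apply: comp_homog hG; apply: ord3P;
  rewrite (tnth_nth 0) /=; exact: homogX.
Qed.

Lemma swap_tuple_eval (G : R3) (v : 'I_3 -> k) :
  (G \mPo swap_tuple).@[v] = G.@[vec3 (v o1) (v o0) (v o2)].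
Proof.
rewrite comp_mpoly_meval; congr (G.@[_]); apply/funext.
by apply: ord3P; rewrite (tnth_nth 0) /= mevalXU.
Qed.

Lemma swap_eval d (G : R3) (P : pt k 2) : G \is d.-homog ->
  (peval G (swap_pt P) == 0) = (peval (G \mPo swap_tuple) P == 0).
Proof.
by move=> hG; rewrite (peval_eq0 (swap_row_neq0 P) hG) heval_row3 /peval swap_tuple_eval.
Qed.

Lemma mderiv_homog d (G : R3) i : G \is d.-homog -> G^`M(i) \is d.-1.-homog.
Proof.
move=> /dhomogP hG; rewrite /mderiv big_seq; apply: rpred_sum => u uG.
have [u0|u0] := posnP (u i); first by rewrite u0 mul0r scale0r rpred0.
apply: rpredZ; rewrite dhomogX -(hG u uG) /=.
have le : (U_(i) <= u)%MM by apply/mnm_lepP => j; rewrite mnm1E; case: eqP => [<-|].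
by rewrite -{2}(submK le) mdegD mdeg1 addn1.
Qed.

Variables (F : R3) (z0 : k).
Hypothesis F_homog : F \is n.-homog.
Hypothesis z_prim : m.-primitive_root z0.
Hypothesis F_powers : forall a b c,
  F.@[vec3 (a ^+ m) (b ^+ m) (c ^+ m)] = \prod_(i < m) base_value q a (z0 ^+ i * b) c.
Let C : set (proj_space k 2) := [set P | peval F P = 0].

Lemma center0E : center k o0 = plane_pt 0 0.
Proof. by congr pt_of; apply/rowP; apply: ord3P; rewrite !mxE. Qed.

Lemma center1E : center k o1 = plane_inf k.
Proof. by congr pt_of; apply/rowP; apply: ord3P; rewrite !mxE. Qed.

Lemma centers_neq : center k o1 <> center k o0.
Proof. by rewrite center0E center1E => /esym; exact: plane_pt_inf. Qed.

Lemma center1_on : F.@[vec3 0 1 0] = 0.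
Proof. exact: (plane_infinity q_gt1 smN z_prim F_powers 1 0).2. Qed.

Lemma center0_on : F.@[vec3 1 0 0] = 0.
Proof. exact: (plane_swap q_gt1 q_pchar smN z_prim F_powers 0 1 0).2 center1_on. Qed.

Lemma swap_curve (P : pt k 2) : C P -> C (swap_pt P).
Proof.
rewrite /C /= => FP; apply/eqP; rewrite (peval_eq0 (swap_row_neq0 P) F_homog) heval_row3.
apply/eqP/(plane_swap q_gt1 q_pchar smN z_prim F_powers); rewrite -heval_row3 -row3_coords.
exact: FP.
Qed.

Variables (K : fieldType) (phi : {rmorphism R3 -> K}).
Hypothesis phi_ker : forall P, phi P = 0 <-> vanishes q s P.
Hypothesis phi_gen : forall a, exists d (P Q : R3),
  [/\ P \is d.-homog, Q \is d.-homog, phi_plane phi m Q != 0 &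
      a = phi_plane phi m P / phi_plane phi m Q].
Hypothesis phi_degree : forall d (P : R3), P \is d.-homog -> P != 0 ->
  phi_plane phi m P = 0 -> P.@[vec3 0 1 0] = 0 -> (q ^ 3 < d)%N.

Let ker d (G : R3) : G \is d.-homog ->
  (phi_plane phi m G = 0 <-> forall P : subspace C, peval G (sval P) = 0).
Proof.
move=> hG; have h := phi_plane_ker q_gt1 q_pchar smN F_homog z_prim F_powers phi_ker hG.
split=> [/h e [P CP]|e]; first exact: e.
by apply/h => P CP; exact: (e (exist _ P CP)).
Qed.

Lemma plane_curve_irreducible : irreducible_mpoly F.
Proof.
apply: (irreducible_of_degree (phi := phi_plane phi m) F_homog).
- apply/eqP => F0; have /eqP : (1 : k) = 0.
    by apply/(plane_infinity q_gt1 smN z_prim F_powers 0); rewrite F0 meval0.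
  by rewrite oner_eq0.
- apply/negP => /mulrV/(congr1 (meval (vec3 0 1 0)))/eqP.
  by rewrite mevalM center1_on mul0r meval1 eq_sym oner_eq0.
- by apply/(ker F_homog) => -[].
move=> e P hP P0 vP; rewrite addn1; apply: phi_degree (hP) P0 (vP) _.
have C1 : C (plane_inf k).
  by apply/eqP; rewrite (peval_plane_inf F_homog) center1_on.
apply/eqP; rewrite -(peval_plane_inf hP); apply/eqP.
exact: ((ker hP).1 vP (exist _ _ C1)).
Qed.

Lemma plane_curve_defining : defining_equation C n F.
Proof. by split=> //; exact: plane_curve_irreducible. Qed.

Lemma smooth_center1 : smooth_point C (center k o1).
Proof.
rewrite center1E; split; first by apply/eqP; rewrite (peval_plane_inf F_homog) center1_on.
exists n, F; split; first exact: plane_curve_defining.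
exists o0; rewrite (peval_plane_inf (mderiv_homog o0 F_homog)).
exact: (plane_smooth_infinity q_gt1 smN z_prim F_powers).
Qed.

Lemma smooth_center0 : smooth_point C (center k o0).
Proof.
rewrite center0E; split; first by apply/eqP; rewrite (peval_plane _ _ F_homog) center0_on.
exists n, F; split; first exact: plane_curve_defining.
exists o1; rewrite (peval_plane _ _ (mderiv_homog o1 F_homog)).
exact: (plane_smooth_origin q_gt1 q_pchar smN z_prim F_powers).
Qed.

Lemma curve_above w : exists2 P : proj_space k 2, C P &
  coords P 0 o0 != 0 /\ coords P 0 o2 = w * coords P 0 o0.
Proof.
have [v vw] := nth_root_exists w (m_gt0 smN).
have [x [y on]] := curve_over N q_gt1 (pchar_nat_eq0 q_gt1 q_pchar) v.
exists (plane_pt (x ^+ m) w).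
  apply/eqP; rewrite (peval_plane _ _ F_homog); apply/eqP.
  by apply/(plane_affine q_gt1 q_pchar smN z_prim F_powers); exists x, y, v.
have [c c0 cE] := coords_pt_of (row3_1neq0 (x ^+ m) w).
by rewrite cE !mxE /vec3 /= mulr1 mulrC.
Qed.

Variables (K0 : fieldType) (phi0 : {rmorphism {poly k} -> K0}).
Hypothesis phi0_ker : forall c, phi0 c = 0 <-> c = 0.
Hypothesis phi0_frac : forall a, exists c d, phi0 d != 0 /\ a = phi0 c / phi0 d.
Variable iota : {rmorphism K0 -> K}.
Hypothesis iotaE : forall c, iota (phi0 c) = phi (poly_w c).
Hypothesis iota_galois : galois_extension iota.

Let iotaC c : phi_plane phi m c%:MP = iota (phi0 c%:P).
Proof. by rewrite iotaE /phi_plane /= comp_mpolyC /poly_w map_polyC hornerC. Qed.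

Let iotaX : phi_plane phi m 'X_o2 = iota (phi0 'X).
Proof. by rewrite iotaE !phi_planeX /poly_w map_polyX hornerX. Qed.

Theorem galois_center1 : inner_galois_point C (center k o1).
Proof.
split; last exact: smooth_center1.
apply: (galois_point_center phi0_ker phi0_frac ker phi_gen (a := o0) (b := o1)
  _ iotaC iotaX _ iota_galois curve_above); first by [].
by rewrite phi_planeX.
Qed.

(** The same function field with the first two coordinates exchanged, so that
    [(1 : 0 : 0)] takes over the part of [(0 : 1 : 0)]. *)
Definition phi_swap : {rmorphism R3 -> K} := phi_plane phi m \o comp_mpoly swap_tuple.

Lemma swap_tupleK (G : R3) : (G \mPo swap_tuple) \mPo swap_tuple = G.
Proof.
apply: (mpoly_morph_eq (f := comp_mpoly swap_tuple \o comp_mpoly swap_tuple) (g := idfun)).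
  by move=> c; rewrite /= !comp_mpolyC.
by apply: ord3P; rewrite /= !comp_mpolyXU.
Qed.

Lemma phi_swap_ker d (G : R3) : G \is d.-homog ->
  (phi_swap G = 0 <-> forall P : subspace C, peval G (sval P) = 0).
Proof.
move=> hG; rewrite /phi_swap /= (ker (swap_tuple_homog hG)); split=> e [P CP] /=.
  apply/eqP; rewrite -(swap_ptK P) (swap_eval _ hG); apply/eqP.
  exact: (e (exist _ _ (swap_curve CP))).
apply/eqP; rewrite -(swap_eval _ hG); apply/eqP.
exact: (e (exist _ _ (swap_curve CP))).
Qed.

Lemma phi_swap_gen a : exists d (P Q : R3),
  [/\ P \is d.-homog, Q \is d.-homog, phi_swap Q != 0 & a = phi_swap P / phi_swap Q].
Proof.
have [d [P [Q [hP hQ Q0 ->]]]] := phi_gen a.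
exists d, (P \mPo swap_tuple), (Q \mPo swap_tuple).
by rewrite /phi_swap /= !swap_tupleK; split=> //; exact: swap_tuple_homog.
Qed.

Lemma swap_above w : exists2 P : proj_space k 2, C P &
  coords P 0 o1 != 0 /\ coords P 0 o2 = w * coords P 0 o1.
Proof.
have [P CP [P0 P2]] := curve_above w; exists (swap_pt P); first exact: swap_curve.
have [c c0 ->] := swap_coords P; rewrite !mxE /vec3 /= mulf_neq0 //.
by rewrite P2 mulrCA.
Qed.

Theorem galois_center0 : inner_galois_point C (center k o0).
Proof.
split; last exact: smooth_center0.
apply: (galois_point_center phi0_ker phi0_frac phi_swap_ker phi_swap_gen (a := o1) (b := o0)
  _ _ _ _ iota_galois swap_above).
- by [].
- by move=> c; rewrite -iotaC /phi_swap /= comp_mpolyC.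
- by rewrite -iotaX /phi_swap /= comp_mpolyXU.
- by rewrite /phi_swap /= comp_mpolyXU -[RHS](phi_planeX phi m).1.1.
Qed.

End PlaneCurve.

Lemma GK_quotient_embedding (k : closedFieldType) (q : nat) (H : set (GK_curve k q -> GK_curve k q)) :
  (1 < q)%N -> [pchar k].-nat q -> is_subgroup H (@GK_cyclic_group k q) ->
  exists psi : quotient_space H -> proj_space k 2,
    [/\ birational_embedding psi, plane_curve_of_degree (range psi) (q ^ 3 + 1)%N &
        exists P1 P2 : proj_space k 2,
          [/\ P1 <> P2, inner_galois_point (range psi) P1 & inner_galois_point (range psi) P2]].
Proof.
move=> q_gt1 q_pchar H_subgroup.
have [m [s [smN H_rot rot_H]]] := subgroup_rotations q_gt1 q_pchar H_subgroup.
have s_gt0 := factor_gt0 smN; have s_coprime := factor_coprime q_gt1 smN.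
have m_gt0 := m_gt0 smN; have m_neq0 := m_neq0 q_gt1 q_pchar smN.
have [K [phi [phi_ker phi_frac]]] := curve_field q_gt1 q_pchar s_gt0 s_coprime.
have [KX [phiX [phiX_ker _]]] :=
  curve_field q_gt1 q_pchar (GK_exponent_gt0 q) (coprime_GK_exponent q_gt1).
have [K0 [phi0 [phi0_ker phi0_frac]]] := line_field k.
have [iota iotaE] := iota_exists q_gt1 q_pchar phi_ker phi0_ker phi0_frac.
have [conj conjE] := conjugation_exists q_gt1 q_pchar s_gt0 phi_ker phi_frac.
have [r [r_uniq r_size rP]] := fiber q_gt1 q_pchar s_gt0 s_coprime 0.
have r_mem g : g \in r <-> in_group q s g by case: g => b c; exact: rP.
have [F [F_homog [z z_prim F_powers]]] := plane_equation q_gt1 q_pchar smN.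
have gen := plane_homogeneous_ratio q_gt1 q_pchar s_gt0 s_coprime phi_ker phi_frac phi0_frac
  iotaE conjE r_uniq r_size r_mem m_gt0 m_neq0.
have deg := plane_degree q_gt1 q_pchar s_gt0 s_coprime phi_ker conjE r_uniq r_size r_mem
  m_gt0 m_neq0.
have gal := function_field_galois q_gt1 q_pchar s_gt0 s_coprime phi_ker phi_frac phi0_frac
  iotaE conjE r_uniq r_size r_mem.
exists (psi m (H := H)); split.
- exact: psi_birational q_gt1 q_pchar smN _ H_subgroup H_rot rot_H _ _ F_homog z_prim F_powers
    _ _ phi_ker gen _ _ phiX_ker.
- rewrite (range_psi q_gt1 q_pchar smN H_subgroup H_rot rot_H F_homog z_prim F_powers).
  by exists F; exact: plane_curve_defining smN _ _ F_homog z_prim F_powers _ _ phi_ker deg.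
rewrite (range_psi q_gt1 q_pchar smN H_subgroup H_rot rot_H F_homog z_prim F_powers).
exists (center k o1), (center k o0); split; first exact: centers_neq.
  exact: galois_center1 F_homog z_prim F_powers _ _ phi_ker gen deg _ _ phi0_ker phi0_frac _
    iotaE gal.
exact: galois_center0 F_homog z_prim F_powers _ _ phi_ker gen deg _ _ phi0_ker phi0_frac _
  iotaE gal.
Qed.

Local Close Scope quotient_scope.
Local Close Scope ring_scope.
Local Close Scope classical_set_scope.

Theorem theorem2 (p : nat) (k : closedFieldType) (char_k : p \in [pchar k]%R)
    (q e : nat) (e_gt0 : 0 < e) (q_def : q = p ^ e)
    (H : set (GK_curve k q -> GK_curve k q))
    (H_subgroup : is_subgroup H (@GK_cyclic_group k q)) :
  exists psi : quotient_space H -> proj_space k 2,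
    [/\ birational_embedding psi,
        plane_curve_of_degree (range psi) (q ^ 3 + 1) &
        exists P1 P2 : proj_space k 2,
          [/\ P1 <> P2,
              inner_galois_point (range psi) P1 &
              inner_galois_point (range psi) P2]].
Proof.
have p_prime := pcharf_prime char_k; apply: GK_quotient_embedding H_subgroup.
  by rewrite q_def -(exp1n e) ltn_exp2r ?prime_gt1.
by rewrite q_def pnatX (eq_pnat _ (pcharf_eq char_k)) pnat_id.
Qed.
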